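(* Let $K$ be a compact Abelian group such that $C:=c(K)$ is locally essential in $K$. The following are equivalent: (a) $K\in\mathcal C_{Clm}$; (b) $\pi^*(K/C)$ is infinite; (c) $K/C$ is infinite.
   Context: Groups are Abelian and Hausdorff; $c(H)$ is the connected component of $0$ and $\widetilde H$ the completion. A subgroup $S$ of $K$ is locally essential if there is a neighbourhood $V$ of $0$ such that $S$ meets non-trivially every non-trivial closed subgroup of $K$ contained in $V$. A topological group is $p$-monothetic if it is a cyclic $p$-group or topologically isomorphic to a subgroup of $\mathbb Z_p$; $td_p(A)$ is the union of all $p$-monothetic subgroups of $A$; $\pi^*(A)=\{p \text{ prime}: td_p(A)\ne\{0\}\}$. A group $G$ is locally minimal if there is a neighbourhood $V$ of $0$ such that every continuous isomorphism $f:G\to H$ onto a Hausdorff group with $f(V)$ a neighbourhood of $0$ is open; a locally minimal $G$ is critical if $c(G)=c(\widetilde G)$ is compact and $G/c(G)$ is not locally minimal. $\mathcal C_{Clm}$ is the class of compact Abelian groups having a dense critical locally minimal subgroup. *)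

(* Defs.v *)
From mathcomp Require Import all_boot all_algebra zify.
From Stdlib Require Import ClassicalEpsilon List.

Set Implicit Arguments.
Unset Strict Implicit.
Unset Printing Implicit Defensive.

Record topab := TopAb {
  car : Type;
  zer : car;
  add : car -> car -> car;
  opp : car -> car;
  opn : (car -> Prop) -> Prop
}.

Arguments zer {t}.
Arguments add {t}.
Arguments opp {t}.
Arguments opn {t}.

Definition subset {T} (A B : T -> Prop) := forall x, A x -> B x.

Definition is_top_ab_group (A : topab) : Prop :=
  (forall x y z : car A, add x (add y z) = add (add x y) z) /\
  (forall x y : car A, add x y = add y x) /\
  (forall x : car A, add zer x = x) /\
  (forall x : car A, add (opp x) x = zer) /\
  opn (fun _ : car A => True) /\
  (forall F : (car A -> Prop) -> Prop, (forall U, F U -> opn U) ->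
     opn (fun x => exists U, F U /\ U x)) /\
  (forall U V : car A -> Prop, opn U -> opn V -> opn (fun x => U x /\ V x)) /\
  (forall (U : car A -> Prop) (x y : car A), opn U -> U (add x (opp y)) ->
     exists V W, opn V /\ opn W /\ V x /\ W y /\
       forall a b, V a -> W b -> U (add a (opp b))).

Definition hausdorff (A : topab) : Prop :=
  forall x y : car A, x <> y -> exists U V, opn U /\ opn V /\ U x /\ V y /\
    forall z, ~ (U z /\ V z).

Definition nbhd0 (A : topab) (V : car A -> Prop) : Prop :=
  exists U, opn U /\ U zer /\ subset U V.

Definition closed (A : topab) (S : car A -> Prop) : Prop := opn (fun x => ~ S x).

Definition dense (A : topab) (S : car A -> Prop) : Prop :=
  forall U : car A -> Prop, opn U -> (exists x, U x) -> exists x, U x /\ S x.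

Definition compact (A : topab) (S : car A -> Prop) : Prop :=
  forall F : (car A -> Prop) -> Prop, (forall U, F U -> opn U) ->
    (forall x, S x -> exists U, F U /\ U x) ->
    exists l : list (car A -> Prop), (forall U, In U l -> F U) /\
      (forall x, S x -> exists U, In U l /\ U x).

Definition connected (A : topab) (S : car A -> Prop) : Prop :=
  forall U V : car A -> Prop, opn U -> opn V ->
    (forall x, S x -> U x \/ V x) ->
    (exists x, S x /\ U x) -> (exists x, S x /\ V x) ->
    exists x, S x /\ U x /\ V x.

Definition comp0 (A : topab) (x : car A) : Prop :=
  exists S, connected S /\ S zer /\ S x.

Definition infinite_set {T} (P : T -> Prop) : Prop :=
  ~ exists l : list T, forall x, P x -> In x l.

Definition image {T U} (f : T -> U) (V : T -> Prop) (y : U) : Prop :=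
  exists x, V x /\ f x = y.

Definition is_hom (A B : topab) (f : car A -> car B) : Prop :=
  forall x y, f (add x y) = add (f x) (f y).

Definition continuous (A B : topab) (f : car A -> car B) : Prop :=
  forall U, opn U -> opn (fun x => U (f x)).

Definition open_map (A B : topab) (f : car A -> car B) : Prop :=
  forall U, opn U -> opn (image f U).

Definition bijective_map {T U} (f : T -> U) : Prop :=
  (forall x y, f x = f y -> x = y) /\ (forall y, exists x, f x = y).

Definition top_iso (A B : topab) (f : car A -> car B) : Prop :=
  is_hom f /\ bijective_map f /\ continuous f /\ open_map f.

Record is_subgroup (A : topab) (S : car A -> Prop) : Prop := IsSubgroup {
  sub0 : S zer;
  subD : forall x y, S x -> S y -> S (add x y);
  subN : forall x, S x -> S (opp x)
}.

Definition subgrp (A : topab) (S : car A -> Prop) (h : is_subgroup S) : topab :=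
  @TopAb {x : car A | S x}
    (exist _ zer (sub0 h))
    (fun x y => exist _ (add (proj1_sig x) (proj1_sig y))
                  (subD h (proj2_sig x) (proj2_sig y)))
    (fun x => exist _ (opp (proj1_sig x)) (subN h (proj2_sig x)))
    (fun V => exists U : car A -> Prop, opn U /\
                forall x : {x : car A | S x}, V x <-> U (proj1_sig x)).

Definition coset (A : topab) (N : car A -> Prop) (x : car A) : car A -> Prop :=
  fun y => exists n, N n /\ y = add x n.

Definition quo_car (A : topab) (N : car A -> Prop) :=
  {C : car A -> Prop | exists x, C = coset N x}.

Definition qmap (A : topab) (N : car A -> Prop) (x : car A) : quo_car N :=
  exist _ (coset N x) (ex_intro _ x erefl).

Definition rep (A : topab) (N : car A -> Prop) (C : quo_car N) : car A :=
  epsilon (inhabits (@zer A)) (fun x => proj1_sig C x).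

Definition quo (A : topab) (N : car A -> Prop) : topab :=
  @TopAb (quo_car N) (qmap N zer)
    (fun C D => qmap N (add (rep C) (rep D)))
    (fun C => qmap N (opp (rep C)))
    (fun U => opn (fun x => U (qmap N x))).

Definition locally_minimal (G : topab) : Prop :=
  exists V : car G -> Prop, nbhd0 V /\
    forall (H : topab) (f : car G -> car H),
      is_top_ab_group H -> hausdorff H ->
      is_hom f -> continuous f -> bijective_map f ->
      nbhd0 (image f V) -> open_map f.

Definition locally_essential (K : topab) (S : car K -> Prop) : Prop :=
  exists V : car K -> Prop, nbhd0 V /\
    forall H : car K -> Prop, is_subgroup H -> closed H -> subset H V ->
      (exists x, H x /\ x <> zer) -> exists x, H x /\ S x /\ x <> zer.

(* The p-adic integers Z_p, as the inverse limit of Z/p^(n+1)Z inside  *)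
(* the product of the discrete groups Z/p^(n+1)Z (index n <-> p^(n+1)). *)
Definition prodZ (p : nat) : topab :=
  @TopAb (forall n : nat, 'Z_(p ^ n.+1))
    (fun n => 0%R)
    (fun x y n => (x n + y n)%R)
    (fun x n => (- x n)%R)
    (fun U => forall x, U x -> exists N, forall y,
       (forall n, n < N -> y n = x n) -> U y).

Definition compat (p : nat) (x : car (prodZ p)) : Prop :=
  forall n : nat, nat_of_ord (x n) = nat_of_ord (x n.+1) %% (Zp_trunc (p ^ n.+1)).+2.
Arguments compat : clear implicits.

Lemma Zp_trunc_dvd (p n : nat) :
  (Zp_trunc (p ^ n.+1)).+2 %| (Zp_trunc (p ^ n.+2)).+2.
Proof.
rewrite /Zp_trunc.
have [p0|p1] := leqP p 1.
  have : p ^ n.+1 <= 1 by rewrite -(exp1n n.+1) leq_exp2r.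
  have : p ^ n.+2 <= 1 by rewrite -(exp1n n.+2) leq_exp2r.
  by case: (p ^ n.+2) => [|[|]] //; case: (p ^ n.+1) => [|[|]].
have h1 : 1 < p ^ n.+1 by rewrite -(exp1n n.+1) ltn_exp2r.
have h2 : 1 < p ^ n.+2 by rewrite -(exp1n n.+2) ltn_exp2r.
have e : forall m, 1 < m -> m.-2.+2 = m by case=> [|[|]].
by rewrite !e // (expnS p n.+1) dvdn_mull.
Qed.

Lemma subn_mod_aux (k m a : nat) : 0 < m -> a < k * m ->
  (k * m - a) %% m = (m - a %% m) %% m.
Proof.
move=> m0 lt.
have ea := divn_eq a m.
have rm : a %% m < m by rewrite ltn_mod.
move: lt rm ea; set q := a %/ m; set r := a %% m => lt rm ea.
rewrite [in k * m - a]ea.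
rewrite ea in lt.
have qk : q < k.
  rewrite -(ltn_pmul2r m0); apply: leq_ltn_trans lt; exact: leq_addr.
have -> : k * m - (q * m + r) = (k - q.+1) * m + (m - r).
  have h : q.+1 * m <= k * m by rewrite leq_mul2r qk orbT.
  rewrite mulnBl. move: h. rewrite mulSn. lia.
by rewrite modnMDl.
Qed.
Lemma compat_subgroup (p : nat) : is_subgroup (compat p).
Proof.
split.
- by move=> n /=; rewrite mod0n.
- move=> x y hx hy n /=.
  rewrite hx hy.
  have Hd := Zp_trunc_dvd p n.
  by rewrite modn_dvdm // modnDm.
- move=> x hx n /=.
  rewrite hx.
  have Hd := Zp_trunc_dvd p n.
  rewrite modn_dvdm //.
  have lt := ltn_ord (x n.+1).
  move: lt; set a := nat_of_ord (x n.+1); move: a => a lt.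
  move: Hd lt; set M := (Zp_trunc _).+2; have M0 : 0 < M by [].
  move: M M0 => M M0 /dvdnP [k ->] lt.
  by symmetry; apply: subn_mod_aux.
Qed.

Definition Zp (p : nat) : topab := subgrp (compat_subgroup p).

Definition natmul (A : topab) (g : car A) (m : nat) : car A := iter m (add g) zer.

Definition cyclic_p_group (p : nat) (A : topab) : Prop :=
  exists (g : car A) (k : nat),
    (forall x : car A, exists m, x = natmul g m) /\
    natmul g (p ^ k) = zer /\
    (forall m, 0 < m < p ^ k -> natmul g m <> zer).

Definition p_monothetic (p : nat) (A : topab) : Prop :=
  cyclic_p_group p A \/
  exists (S : car (Zp p) -> Prop) (h : is_subgroup S) (f : car A -> car (subgrp h)),
    top_iso f.

Definition td_p_nontrivial (p : nat) (A : topab) : Prop :=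
  exists (H : car A -> Prop) (h : is_subgroup H),
    p_monothetic p (subgrp h) /\ exists x, H x /\ x <> zer.

Definition pi_star (A : topab) (p : nat) : Prop := prime p /\ td_p_nontrivial p A.

(* For a dense subgroup G of the compact (hence complete) group K, the   *)
(* completion of G is K, so c(G~) = c(K).                                *)
Definition critical_in (K : topab) (S : car K -> Prop) (h : is_subgroup S) : Prop :=
  locally_minimal (subgrp h) /\
  (forall x : car K,
     comp0 x <-> exists y : car (subgrp h), comp0 y /\ proj1_sig y = x) /\
  compact (@comp0 K) /\
  ~ locally_minimal (quo (@comp0 (subgrp h))).

Definition C_Clm (K : topab) : Prop :=
  is_top_ab_group K /\ hausdorff K /\ compact (fun _ : car K => True) /\
  exists (S : car K -> Prop) (h : is_subgroup S), dense S /\ critical_in h.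

(* Main.v *)
(* Write C = c(K), the intersection of all open subgroups of K.

   Characters. For a finite abelian group, Bogolyubov's counting argument produces a
   character that is large on a given function and nontrivial at a given point.
   Applied to (Z/N)^r, mapped almost homomorphically into K by simultaneous
   recurrence, and followed by a limit in a product of intervals, it yields
   continuous homomorphisms K -> R/Z that kill a closed subgroup and are nontrivial
   at a point outside it.  In particular C is divisible.

   (c) => (b). If C is locally essential, then for each prime p some open subgroup O
   has no topologically p-torsion element modulo C except those of C: such an element
   would produce a small closed subgroup, cyclic of order p or isomorphic to Z_p,
   that meets C trivially.  So an infinite K/C has p-torsion for infinitely many p.

   (c) => (a). For infinitely many p there are z_p of order p modulo C and cyclic
   p-quotients of K/C detecting z_p.  The subgroup G of all x that agree with a
   common integer multiple of generators in all these quotients is dense, contains C,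
   hence is locally minimal, but contains no z_p.  Thus G/C embeds in each
   K/(C + <z_p>), which induces on it strictly coarser topologies in which an
   arbitrarily small neighbourhood stays a neighbourhood.

   (a) => (c). If K/C is finite, then C is open and G/C is discrete, hence locally
   minimal. *)

(* Local essentiality speaks of small closed subgroups of K, while (b) and (c) concern K/C.
   Divisibility of C joins the two: if px lies in C, then px = pc for some c in C, and x - c is
   honest p-torsion in K that differs from x only by an element of C.

   The characters are built without an invariant measure. All counting takes place in (Z/N)^r, so
   every bound has to be independent of r and N in order to survive the limit.

   The single integer k shared by all primes is what keeps z_p out of G: k = 0 is impossible at p,
   and for k nonzero a prime q beyond p and |k| sees z_p as zero but k as invertible. The same
   constraint leaves G dense: finitely many primes are handled by the Chinese remainder theorem, and
   at the remaining ones the correction can be made inside any prescribed open subgroup.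

   Local minimality of G/C fails for an arithmetic reason. A neighbourhood of C contains an open
   subgroup P; if e kills K/P, every p > e puts z_p into P, so P is a union of cosets of C + <z_p>
   and stays open in the coarser topology. *)
From HB Require Import structures.
From mathcomp Require Import all_boot all_order all_algebra ring lra zify.
From mathcomp Require Import Rstruct boolp classical_sets filter reals topology normedtype trigo.
Require Import Defs.

Set Implicit Arguments.
Unset Strict Implicit.
Unset Printing Implicit Defensive.

Import Order.TTheory GRing.Theory Num.Theory numFieldNormedType.Exports.
Local Open Scope ring_scope.

(* [zmod] decides equalities in an abelian group by comparing the integer
   coefficients of every atom on both sides; multipliers may be variables. *)
Inductive zexpr := ZVar of nat | ZZero | ZAdd of zexpr & zexpr | ZOpp of zexpr
  | ZMul of zexpr & int.

Fixpoint zcoef (e : zexpr) (i : nat) : int :=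
  match e with
  | ZVar j => if j == i then 1 else 0
  | ZZero => 0
  | ZAdd a b => zcoef a i + zcoef b i
  | ZOpp a => - zcoef a i
  | ZMul a k => zcoef a i * k
  end.

Section Zeval.
Variables (V : zmodType) (env : seq V).
Fixpoint zeval (e : zexpr) : V :=
  match e with
  | ZVar j => env`_j
  | ZZero => 0
  | ZAdd a b => zeval a + zeval b
  | ZOpp a => - zeval a
  | ZMul a k => zeval a *~ k
  end.

Lemma zevalE e n : (size env <= n)%N -> zeval e = \sum_(i < n) env`_i *~ zcoef e i.
Proof.
move=> hn; elim: e => [j||a ha b hb|a ha|a ha k] /=; rewrite ?ha ?hb.
- case: (ltnP j n) => jn.
    rewrite (bigD1 (Ordinal jn)) //= big1 ?addr0; first by case: eqP.
    by move=> i ij; case: eqP => // e; case/eqP: ij; apply: val_inj.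
  rewrite nth_default; last exact: leq_trans jn.
  by rewrite big1 // => i _; case: eqP => // e; have := ltn_ord i; rewrite -e ltnNge jn.
- by rewrite big1.
- by rewrite -big_split; apply: eq_bigr => i _; rewrite mulrzDr_tmp.
- by rewrite -sumrN; apply: eq_bigr => i _; rewrite mulrNz.
- rewrite (big_morph (fun x : V => x *~ k) (mulrzDl_tmp k) (mul0rz _ k)).
  by apply: eq_bigr => i _; rewrite mulrzA.
Qed.

(** A nested conjunction, so that [repeat split] leaves one linear goal over the integers per
    atom. *)
Fixpoint zcoef_eq (n : nat) (a b : zexpr) : Prop :=
  if n is n'.+1 then zcoef a n' = zcoef b n' /\ zcoef_eq n' a b else True.

Lemma zcoef_eqP n a b j : zcoef_eq n a b -> (j < n)%N -> zcoef a j = zcoef b j.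
Proof.
elim: n => // n IH [h1 h2]; rewrite ltnS leq_eqVlt => /orP [/eqP -> //|]; exact: IH.
Qed.

Lemma zeval_eq a b : zcoef_eq (size env) a b -> zeval a = zeval b.
Proof.
move=> h; rewrite !(zevalE _ (leqnn _)); apply: eq_bigr => i _; congr (_ *~ _).
exact: zcoef_eqP h (ltn_ord i).
Qed.
End Zeval.

Ltac z_index x env :=
  lazymatch env with
  | x :: _ => constr:(O)
  | _ :: ?r => let n := z_index x r in constr:(S n)
  end.
Ltac z_mem x env :=
  lazymatch env with
  | nil => constr:(false)
  | x :: _ => constr:(true)
  | _ :: ?r => z_mem x r
  end.
Ltac z_atoms T t env :=
  lazymatch t with
  | (?a + ?b)%R => let e := z_atoms T a env in z_atoms T b e
  | (- ?a)%R => z_atoms T a env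
  | (?a *+ _)%R => z_atoms T a env
  | (?a *~ _)%R => z_atoms T a env
  | 0%R => env
  | ?x => lazymatch z_mem x env with true => env | false => constr:(@cons T x env) end
  end.
Ltac z_reify t env :=
  lazymatch t with
  | (?a + ?b)%R => let x := z_reify a env in let y := z_reify b env in constr:(ZAdd x y)
  | (- ?a)%R => let x := z_reify a env in constr:(ZOpp x)
  | (?a *+ ?n)%R => let x := z_reify a env in constr:(ZMul x (Posz n))
  | (?a *~ ?n)%R => let x := z_reify a env in constr:(ZMul x n)
  | 0%R => constr:(ZZero)
  | ?x => let i := z_index x env in constr:(ZVar i)
  end.
Ltac zmod :=
  lazymatch goal with
  | |- @eq ?V ?a ?b =>
    let e0 := z_atoms V a (@nil V) in let env := z_atoms V b e0 in
    let x := z_reify a env in let y := z_reify b env in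
    change (zeval env x = zeval env y);
    apply: zeval_eq; rewrite /=; repeat split; lia
  end.

(** * Fourier analysis on finite groups *)

Section FiniteFourier.
Variables (R : realFieldType) (F : finZmodType) (A : finType) (c s : A -> F -> R).
Hypothesis cD : forall a y z, c a (y + z) = c a y * c a z - s a y * s a z.
Hypothesis sD : forall a y z, s a (y + z) = s a y * c a z + c a y * s a z.
Hypothesis cs1 : forall a y, c a y ^+ 2 + s a y ^+ 2 = 1.
Hypothesis c_sum : forall y, \sum_a c a y = (y == 0)%:R *+ #|A|.
Variable G : F -> R.

(** Characters are kept as real pairs [c a], [s a]. [power_spectrum] is the squared modulus of the
    Fourier transform of [G]; it is also the transform of the autocorrelation. *)
Definition autocorr (z : F) : R := \sum_y G y * G (y + z).
Definition cos_coef (a : A) : R := \sum_y G y * c a y.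
Definition sin_coef (a : A) : R := \sum_y G y * s a y.
Definition power_spectrum (a : A) : R := cos_coef a ^+ 2 + sin_coef a ^+ 2.

Local Notation f := autocorr.
Local Notation P := power_spectrum.

Lemma cos_char0 a : c a 0 = 1.
Proof.
have := cs1 a 0; have := cD a 0 0; have := sD a 0 0; rewrite addr0 => h1 h2 h3.
nra.
Qed.

Lemma sin_char0 a : s a 0 = 0.
Proof. have := sD a 0 0; rewrite addr0 cos_char0 => h1; lra. Qed.

Lemma cos_charN a y : c a (- y) = c a y.
Proof.
have := cs1 a y; have := cD a y (- y); have := sD a y (- y).
rewrite addrN cos_char0 sin_char0; set c' := c a (- y); set s' := s a (- y).
move=> h1 h2 h3.
have -> : c' = c' * (c a y ^+ 2 + s a y ^+ 2) by rewrite h3 mulr1.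
have e : s a y * c' = - (c a y * s') by lra.
transitivity (c a y ^+ 2 * c' + s a y * (s a y * c')); first by ring.
rewrite e -[RHS]mulr1 h2; ring.
Qed.

Lemma sin_charN a y : s a (- y) = - s a y.
Proof.
have := cs1 a y; have := cD a y (- y); have := sD a y (- y).
rewrite addrN cos_char0 sin_char0 cos_charN; set s' := s a (- y) => h1 h2 h3.
have -> : s' = s' * (c a y ^+ 2 + s a y ^+ 2) by rewrite h3 mulr1.
have e1 : c a y * s' = - (s a y * c a y) by lra.
have e2 : s a y * s' = c a y * c a y - 1 by lra.
transitivity (c a y * (c a y * s') + s a y * (s a y * s')); first by ring.
rewrite e1 e2; ring.
Qed.

Lemma autocorrN z : f (- z) = f z.
Proof.
rewrite /f (reindex_inj (addIr z)) /=; apply: eq_bigr => y _.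
by rewrite addrK mulrC.
Qed.

(** Wiener-Khinchin: in the double sum over [y] and [y + z] the addition formulas leave only
    [c a z]. *)
Lemma power_spectrumE a : P a = \sum_z f z * c a z.
Proof.
rewrite /P /cos_coef /sin_coef !expr2 !mulr_suml -big_split /=.
transitivity (\sum_y \sum_z G y * G (y + z) * c a z); last first.
  rewrite exchange_big /=; apply: eq_bigr => z _; by rewrite /f mulr_suml.
apply: eq_bigr => y _.
rewrite !mulr_sumr -big_split /= (reindex_inj (addrI y)) /=.
apply: eq_bigr => z _; have := cs1 a y; rewrite cD sD => h.
transitivity (G y * G (y + z) * (c a z * (c a y ^+ 2 + s a y ^+ 2))); first by ring.
by rewrite h mulr1.
Qed.

Lemma power_spectrum_ge0 a : 0 <= P a.
Proof. by rewrite addr_ge0 ?sqr_ge0. Qed.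

(** The sine sum of [f] vanishes, because [f] is even and [s a] is odd. *)
Lemma power_spectrum_shift a u : P a * c a u = \sum_z f z * c a (u + z).
Proof.
have e : \sum_z f z * s a z = 0.
  have : \sum_z f z * s a z = - \sum_z f z * s a z.
    rewrite {1}(reindex_inj oppr_inj) /= -sumrN; apply: eq_bigr => z _.
    by rewrite autocorrN sin_charN mulrN.
  lra.
transitivity (P a * c a u - s a u * \sum_z f z * s a z).
  by rewrite e mulr0 subr0.
rewrite power_spectrumE mulr_suml mulr_sumr -sumrB; apply: eq_bigr => z _.
rewrite cD; ring.
Qed.

Lemma sum_power_spectrum : \sum_a P a = f 0 *+ #|A|.
Proof.
under eq_bigr do rewrite power_spectrumE.
rewrite exchange_big /= (bigD1 0) //= -mulr_sumr c_sum eqxx big1 ?addr0 ?mulrnAr ?mulr1 //.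
by move=> z /negPf z0; rewrite -mulr_sumr c_sum z0 mul0rn mulr0.
Qed.

(** Parseval for the convolution of [f] with itself: orthogonality keeps only [z' = - (u + z)]. *)
Lemma sum_power_spectrum_sqr u :
  \sum_a P a * P a * c a u = (\sum_z f z * f (u + z)) *+ #|A|.
Proof.
transitivity (\sum_a \sum_z \sum_z' f z * f z' * c a (u + z + z')).
  apply: eq_bigr => a _; rewrite -mulrA power_spectrum_shift mulr_sumr.
  apply: eq_bigr => z _; rewrite mulrCA power_spectrum_shift mulr_sumr.
  by apply: eq_bigr => z' _; rewrite mulrA.
rewrite exchange_big -sumrMnl; apply: eq_bigr => z _.
rewrite exchange_big /= (bigD1 (- (u + z))) //= -mulr_sumr c_sum addrN eqxx autocorrN.
rewrite mulrnAr mulr1 big1 ?addr0 // => z' h; rewrite -mulr_sumr c_sum.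
case: eqP => [e|_]; last by rewrite mul0rn mulr0.
by case/eqP: h; apply/eqP; rewrite -subr_eq0 opprK addrC e.
Qed.

(* Bogolyubov's pigeonhole: a nonnegative spectrum of total mass [f 0] cannot be
   uniformly small against its second moment. *)
Lemma exists_large_character (x : F) :
  (0 < #|A|)%N -> 0 < f 0 -> (forall z, f z * f (x + z) = 0) ->
  exists a, \sum_z f z ^+ 2 <= P a * (1 - c a x) * f 0.
Proof.
move=> A0 f0 fx.
have [/existsP //|/existsPn h] := boolP [exists a, \sum_z f z ^+ 2 <= P a * (1 - c a x) * f 0].
have h2 a : P a * (1 - c a x) * f 0 < \sum_z f z ^+ 2 by rewrite real_ltNge ?num_real ?h.
have [a Pa] : exists a, 0 < P a.
  have [/existsP [a ha]|/existsPn n] := boolP [exists a, 0 < P a]; first by exists a.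
  have : \sum_a P a <= 0.
    by apply: sumr_le0 => a _; rewrite real_leNgt ?num_real ?n.
  rewrite sum_power_spectrum leNgt; case/negP.
  by rewrite pmulrn_lgt0.
(* Weighting the supposed strict inequalities by [P a] and summing stays strict. Yet both sides
   equal [f 0] times [\sum_z f z ^+ 2] times [#|A|], as [fx] cancels the term at [x]. *)
have : \sum_a P a * (P a * (1 - c a x) * f 0) < \sum_a P a * (\sum_z f z ^+ 2).
  rewrite (bigD1 a) //= [ltRHS](bigD1 a) //= ltr_leD ?ltr_pM2l //.
  by apply: ler_sum => b _; rewrite ler_wpM2l ?power_spectrum_ge0 // ltW.
rewrite -mulr_suml sum_power_spectrum.
have -> : \sum_a P a * (P a * (1 - c a x) * f 0) = 
    (\sum_a P a * P a * c a 0 - \sum_a P a * P a * c a x) * f 0.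
  rewrite -sumrB mulr_suml; apply: eq_bigr => b _; rewrite cos_char0; ring.
rewrite !sum_power_spectrum_sqr [X in _ - X *+ _]big1; last by move=> z _; exact: fx.
rewrite mul0rn subr0; under eq_bigr do rewrite add0r -expr2.
by rewrite mulrC mulrnAr mulrnAl ltxx.
Qed.

End FiniteFourier.

(** * Cosine and sine of period 1, as functions on R/Z *)

Section Circle.
Variable R : realType.
Implicit Types (x y : R) (k : int).

Definition cosT x : R := cos (pi *+ 2 * x).
Definition sinT x : R := sin (pi *+ 2 * x).

Lemma cosTD x y : cosT (x + y) = cosT x * cosT y - sinT x * sinT y.
Proof. by rewrite /cosT mulrDr cosD. Qed.

Lemma sinTD x y : sinT (x + y) = sinT x * cosT y + cosT x * sinT y.
Proof. by rewrite /sinT mulrDr sinD. Qed.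

Lemma cosT2sinT2 x : cosT x ^+ 2 + sinT x ^+ 2 = 1.
Proof. exact: cos2Dsin2. Qed.

Lemma cosTDn x (n : nat) : cosT (x + n%:R) = cosT x.
Proof. by rewrite /cosT mulrDr mulr_natr (periodicn (@cosD2pi R)). Qed.

Lemma sinTDn x (n : nat) : sinT (x + n%:R) = sinT x.
Proof. by rewrite /sinT mulrDr mulr_natr (periodicn (@sinD2pi R)). Qed.

Lemma cosTDz x k : cosT (x + k%:~R) = cosT x.
Proof.
case: k => n; first exact: cosTDn.
by rewrite -[LHS](cosTDn _ n.+1) NegzE mulrNz -pmulrn subrK.
Qed.

Lemma cosTN x : cosT (- x) = cosT x.
Proof. by rewrite /cosT mulrN cosN. Qed.

Lemma cosT0 : cosT 0 = 1. Proof. by rewrite /cosT mulr0 cos0. Qed.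

Lemma cosT_lt1 x : 0 < x < 1 -> cosT x < 1.
Proof.
move=> /andP [x0 x1].
have p0 := pi_gt0 R.
have h : 0 < sin (pi * x).
  apply: sin_gt0_pi; rewrite mulr_gt0 //=; nra.
rewrite /cosT mulrnAl mulr2n cosD.
have := cos2Dsin2 (pi * x); nra.
Qed.

Lemma cosT_gt0_near_int x : 0 < cosT x -> exists k, `|x - k%:~R| < 1 / 4.
Proof.
move=> h.
pose k := Num.floor (x + 1 / 2); exists k.
have /andP [h1 h2] := floor_itv (x + 1 / 2).
rewrite -/k in h1 h2; rewrite intrD in h2.
have e : cosT x = cosT `|x - k%:~R|.
  have -> : cosT `|x - k%:~R| = cosT (x - k%:~R) by case: (ger0P (x - k%:~R)) => _;
    rewrite ?cosTN.
  by rewrite -mulrNz cosTDz.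
rewrite e in h.
rewrite ltNge; apply/negP => h3.
have h4 : `|x - k%:~R| <= 1 / 2 by rewrite ler_norml; lra.
move: h; set y := `|x - k%:~R| in h3 h4 *.
have p0 := pi_gt0 R.
rewrite ltNge; case/negP.
rewrite /cosT -[pi *+ 2 * y](subrK (pi : R)) cosDpi oppr_le0.
have h5 : pi * (1 / 4) <= pi * y by rewrite ler_wpM2l // ltW.
have h6 : pi * y <= pi * (1 / 2) by rewrite ler_wpM2l // ltW.
apply: cos_ge0_pihalf; move: p0 h5 h6; move: (pi : R) => p p0 h5 h6; rewrite mulrnAl.
by move: (p * y) h5 h6 => q h5 h6; lra.
Qed.

Lemma cosT_near1 (d : R) : 0 < d ->
  exists2 e, 0 < e & forall x k, `|x - k%:~R| < e -> 1 - cosT x < d.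
Proof.
move=> d0.
have /cvgrPdist_lt /(_ d d0) := @continuous_cos R 0.
move=> /nbhs_ballP [e /= e0 he].
have p0 : 0 < pi *+ 2 :> R by rewrite mulrn_wgt0 ?pi_gt0.
exists (e / (pi *+ 2)); first by rewrite divr_gt0.
move=> x k hx.
have hx' : `|pi *+ 2 * (x - k%:~R)| < e by rewrite normrM (gtr0_norm p0) mulrC -ltr_pdivlMr.
have := he (pi *+ 2 * (x - k%:~R)); rewrite /ball /= sub0r normrN cos0 => /(_ hx').
rewrite -/(cosT _) -mulrNz cosTDz; apply: le_lt_trans; exact: ler_norm.
Qed.
End Circle.

Section ZNCharacters.
Variables (R : realType) (r N : nat).
Hypothesis N1 : (1 < N)%N.
Local Notation F := 'rV['Z_N]_r.

(* The pairing of (Z/N)^r with itself into R/Z, lifted to [R] through the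
   representatives in {0, ..., N - 1}. *)
Definition pairing (a y : F) : R := \sum_i (a 0 i : nat)%:R / N%:R * (y 0 i : nat)%:R.

Lemma pairingC a y : pairing a y = pairing y a.
Proof. by apply: eq_bigr => i _; rewrite mulrC mulrCA mulrC. Qed.

Lemma pairingD a y z : exists n : nat, pairing a y + pairing a z = pairing a (y + z) + n%:R.
Proof.
exists (\sum_i (a 0%R i : nat) * ((y 0%R i + z 0%R i) %/ N))%N.
rewrite natr_sum -!big_split /=; apply: eq_bigr => i _.
have N0 : (N%:R : R) != 0 by rewrite pnatr_eq0 -lt0n ltnW.
have e : nat_of_ord (fun_of_matrix (y + z) 0 i) = ((y 0%R i + z 0%R i) %% N)%N.
  by rewrite mxE /=; congr (_ %% _)%N; exact: Zp_cast.
rewrite e -mulrDr -natrD [in LHS](divn_eq (y 0%R i + z 0%R i) N) natrD !natrM.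
by field.
Qed.

Definition cosZ (a y : F) := cosT (pairing a y).
Definition sinZ (a y : F) := sinT (pairing a y).

Lemma cosZD a y z : cosZ a (y + z) = cosZ a y * cosZ a z - sinZ a y * sinZ a z.
Proof. by have [n e] := pairingD a y z; rewrite -cosTD e cosTDn. Qed.

Lemma sinZD a y z : sinZ a (y + z) = sinZ a y * cosZ a z + cosZ a y * sinZ a z.
Proof. by have [n e] := pairingD a y z; rewrite -sinTD e sinTDn. Qed.

(** For [y] nonzero, shifting [a] by a basis vector [d] rotates the vector ([Sc], [Ss]) by the angle
    of [pairing d y], which is not an integer; a vector fixed by a nontrivial rotation is zero. *)
Lemma cosZ_sum y : \sum_a cosZ a y = (y == 0)%:R *+ #|{: F}|.
Proof.
have [->|y0] := eqVneq y 0.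
  rewrite mulr1n -[#|_|]/(#|xpredT|) -sumr_const; apply: eq_bigr => a _.
  rewrite /cosZ /pairing big1 ?cosT0 // => i _.
  by rewrite mxE mulr0.
rewrite mul0rn.
have [i yi] : exists i, y 0 i != 0.
  by apply/existsP; apply: contraNT y0 => /existsPn h; apply/eqP/rowP => i; rewrite mxE;
    apply/eqP; move: (h i); rewrite negbK.
have N0 : 0 < N%:R :> R by rewrite ltr0n ltnW.
pose d : F := delta_mx 0 i.
have ed : pairing d y = (y 0 i : nat)%:R / N%:R.
  rewrite /pairing (bigD1 i) //= mxE !eqxx /= modn_small //.
  rewrite big1 ?addr0; first by rewrite mul1r mulrC.
  by move=> j /negPf ji; rewrite mxE ji andbF mul0r mul0r.
have lt1 : cosZ d y < 1.
  apply: cosT_lt1; rewrite ed divr_gt0 //=; last by rewrite ltr0n lt0n.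
  by rewrite ltr_pdivrMr // mul1r ltr_nat (leq_trans (ltn_ord _)) // Zp_cast.
set Sc := \sum_a _; pose Ss := \sum_a sinZ a y.
have symC a b : cosZ a b = cosZ b a by rewrite /cosZ pairingC.
have symS a b : sinZ a b = sinZ b a by rewrite /sinZ pairingC.
have e1 : Sc = Sc * cosZ d y - Ss * sinZ d y.
  rewrite {1}/Sc (reindex_inj (addIr d)) /= !mulr_suml -sumrB; apply: eq_bigr => a _.
  by rewrite symC cosZD !(symC y) !(symS y).
have e2 : Ss = Ss * cosZ d y + Sc * sinZ d y.
  rewrite {1}/Ss (reindex_inj (addIr d)) /= !mulr_suml -big_split; apply: eq_bigr => a _.
  by rewrite symS sinZD !(symC y) !(symS y).
have e3 : cosZ d y ^+ 2 + sinZ d y ^+ 2 = 1 by exact: cosT2sinT2.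
have : (1 - cosZ d y) ^+ 2 * Sc + sinZ d y ^+ 2 * Sc = 0.
  have e4 : (1 - cosZ d y) * Sc = - (Ss * sinZ d y) by lra.
  have e5 : (1 - cosZ d y) * Ss = Sc * sinZ d y by lra.
  rewrite expr2 -mulrA e4 mulrN mulrA e5; ring.
move/eqP; rewrite -mulrDl mulf_eq0 => /orP [|/eqP //]; rewrite gt_eqF //.
by rewrite ltr_wpDr ?sqr_ge0 // exprn_gt0 // subr_gt0.
Qed.
End ZNCharacters.

(** * Characters of precompact groups *)

Lemma pigeonhole (T : eqType) (ts : seq T) (c : nat -> T) :
  (forall i, c i \in ts) -> exists i j, [/\ (i < j)%N, (j <= size ts)%N & c i = c j].
Proof.
move=> cts.
have : ~~ uniq (map c (iota 0 (size ts).+1)).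
  apply/negP => u.
  have h : {subset map c (iota 0 (size ts).+1) <= ts} by move=> _ /mapP [i _ ->].
  by have := uniq_leq_size u h; rewrite size_map size_iota ltnn.
case/(uniqPn (c 0%N)) => i [j [ij]]; rewrite size_map size_iota => jn.
rewrite !(nth_map 0%N) ?size_iota //; last exact: ltn_trans ij jn.
rewrite !nth_iota //; last exact: ltn_trans ij jn.
by rewrite !add0n => e; exists i, j.
Qed.

Section SignedSums.
Variable V : zmodType.
Implicit Types (W U : V -> Prop).

(** The [n]-fold sumset of the union of [W] and [- W]. *)
Fixpoint signed_sum (n : nat) W (v : V) : Prop :=
  if n is n'.+1 then exists w u, [/\ W w \/ W (- w), signed_sum n' W u & v = w + u] else v = 0.

Lemma ssumD n m W u v : signed_sum n W u -> signed_sum m W v -> signed_sum (n + m) W (u + v).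
Proof.
elim: n u => [|n IH] u /=; first by move=> -> ; rewrite add0r.
move=> [w [u' [hw hu ->]]] hv; exists w, (u' + v); split=> //; first exact: IH.
by rewrite addrA.
Qed.

Lemma ssumN n W u : signed_sum n W u -> signed_sum n W (- u).
Proof.
elim: n u => [|n IH] u /=; first by move=> ->; rewrite oppr0.
move=> [w [u' [hw hu ->]]]; exists (- w), (- u'); split; [|exact: IH|by rewrite opprD].
by rewrite opprK; case: hw; [right|left].
Qed.

Lemma ssum_1 W w : W w -> signed_sum 1 W w.
Proof. by move=> hw; exists w, 0; split; [left| |rewrite addr0]. Qed.

Lemma ssum_0 n W : W 0 -> signed_sum n W 0.
Proof. by move=> h; elim: n => //= n IH; exists 0, 0; split; [left| |rewrite addr0]. Qed.

Lemma ssum_le n m W u : W 0 -> (n <= m)%N -> signed_sum n W u -> signed_sum m W u.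
Proof.
by move=> h nm hu; rewrite -(subnKC nm) -[u]addr0; apply: ssumD => //; exact: ssum_0.
Qed.

Lemma ssum_sum r W (e : 'I_r -> V) :
  (forall i, signed_sum 1 W (e i)) -> signed_sum r W (\sum_i e i).
Proof.
elim: r e => [|r IH] e he; first by rewrite big_ord0.
rewrite big_ord_recl; apply: (@ssumD 1 r) => //; exact: IH.
Qed.

Lemma ssum_mulrn n W w : W 0 -> W w -> signed_sum n W (w *+ n).
Proof.
move=> h0 hw; elim: n => [|n IH] //=; rewrite mulrS.
by exists w, (w *+ n); split=> //; left.
Qed.
End SignedSums.

(* The topology need not be Hausdorff: the sets [U + S], for [S] a closed
   subgroup of a compact group, are the intended example. *)
Record precompact_base (V : zmodType) (N : (V -> Prop) -> Prop) : Prop := PrecompactBase {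
  pb_zero : forall W, N W -> W 0;
  pb_half : forall W, N W -> exists2 W', N W' & forall a b, W' a -> W' b -> W (a - b);
  pb_cover : forall W, N W -> exists ts : seq V, forall v, exists2 t, t \in ts & W (v - t)
}.

Section Precompact.
Variables (V : zmodType) (N : (V -> Prop) -> Prop).
Hypothesis hN : precompact_base N.

Lemma pb_ssum n W : N W -> exists2 W', N W' & forall v, signed_sum n W' v -> W v.
Proof.
elim: n W => [|n IH] W hW; first by exists W => // v ->; exact: (pb_zero hN).
have [W2 hW2 h2] := pb_half hN hW.
have z2 := pb_zero hN hW2.
case: n IH => [_|n IH].
  exists W2 => // v [w [u [[hw|hw] /= -> ->]]].
    by rewrite addr0 -[w]subr0; exact: h2.
  by rewrite addr0 -[w]opprK -sub0r; exact: h2.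
have [W1 hW1 h1] := IH _ hW2; exists W1 => // v [w [u [hw hu ->]]].
have z1 := pb_zero hN hW1.
rewrite -[u]opprK; apply: h2; apply: h1; last exact: ssumN.
apply: (@ssum_le _ 1) => //; exists w, 0; split=> //; by rewrite addr0.
Qed.

(** Dirichlet's argument, by induction on [s]: for the new [t], two of the multiples [t *+ n *+ i]
    fall into the same translate. The factor [j - i] so gained is at most [size ts], and [W2] is
    chosen small enough for the old elements to tolerate it. *)
Lemma pb_recurrence (s : seq V) (L : nat) W : N W ->
  exists2 n, (L <= n)%N & forall t, t \in s -> W (t *+ n).
Proof.
elim: s W => [|t s IH] W hW; first by exists L.
have [W' hW' h'] := pb_half hN hW.
have [ts hts] := pb_cover hN hW'.
have [W2 hW2 h2] := pb_ssum (size ts) hW.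
have [n Ln hn] := IH _ hW2.
pose c i := xget 0 [set u | u \in ts /\ W' (t *+ n *+ i - u)].
have cP i : c i \in ts /\ W' (t *+ n *+ i - c i).
  rewrite /c; case: xgetP => [u _ //|/= h].
  by have [u uts hu] := hts (t *+ n *+ i); case: (h u).
have [i [j [ij jk e]]] := pigeonhole (fun i => (cP i).1).
have ji0 : (0 < j - i)%N by rewrite subn_gt0.
exists (n * (j - i))%N; first by apply: leq_trans Ln _; rewrite leq_pmulr.
move=> u; rewrite inE => /orP [/eqP ->|us].
  have := h' _ _ (cP j).2 (cP i).2; rewrite e opprB addrA subrK.
  by rewrite -mulrnBr ?mulrnA // ltnW.
apply: h2; rewrite mulrnA.
have := ssum_mulrn (j - i) (pb_zero hN hW2) (hn u us).
apply: ssum_le; [exact: (pb_zero hN)|by apply: leq_trans (leq_subr _ _) jk].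
Qed.

(** The bits [b] are the carries that arise when coefficients are added modulo [n]; see
    [lincombD]. *)
Lemma pb_recurrence_sum (s : seq V) (L : nat) W : N W ->
  exists2 n, (L <= n)%N & forall b : 'I_(size s) -> bool, W (\sum_(i < size s) s`_i *+ n *+ b i).
Proof.
move=> hW; have [W' hW' h'] := pb_ssum (size s) hW.
have [n Ln hn] := pb_recurrence s L hW'; exists n => // b; apply: h'.
apply: ssum_sum => i; case: (b i); last exact: ssum_0 (pb_zero hN hW').
by apply: ssum_1; apply: hn; rewrite mem_nth.
Qed.
End Precompact.

Section Levels.
Variables (V : zmodType) (U W : V -> Prop) (m : nat).
Hypothesis W0 : W 0.

Definition level (j : nat) (v : V) := exists u w, [/\ U u, signed_sum j W w & v = u + w].
(* A plateau equal to [m] on [U], decreasing by at most [1] along each step in [W]. *)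
Definition plateau (v : V) : nat := \max_(j < m.+1 | `[< level j v >]) (m - j).

Lemma plateau_le v : (plateau v <= m)%N.
Proof. by apply/bigmax_leqP => j _; exact: leq_subr. Qed.

Lemma plateau_U v : U v -> plateau v = m.
Proof.
move=> hv; apply/eqP; rewrite eqn_leq plateau_le /plateau.
have h : `[< level (@ord0 m) v >] by apply/asboolP; exists v, 0; rewrite addr0.
by apply: (bigop.bigmax_sup ord0); rewrite /= ?subn0.
Qed.

Lemma plateau_gt0 v : (0 < plateau v)%N -> level m v.
Proof.
rewrite /plateau; case: (pickP [pred j : 'I_m.+1 | `[< level j v >]]) => [j /asboolP|h].
  move=> [u [w [hu hw ->]]] _; exists u, w; split=> //.
  by apply: ssum_le hw => //; rewrite -ltnS.
by rewrite big_pred0.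
Qed.

Lemma plateau_step v w : signed_sum 1 W w -> (plateau v <= (plateau (v + w)).+1)%N.
Proof.
move=> hw; apply/bigmax_leqP => j /asboolP [u [w' [hu hw' e]]].
case: (ltnP j m) => jm; last by have := ltn_ord j; rewrite ltnS => jm';
  rewrite (_ : (m - j = 0)%N) //; apply/eqP; rewrite subn_eq0.
have jm1 : (j.+1 < m.+1)%N by [].
rewrite -(prednK (n := m - j)) ?subn_gt0 // ltnS -subnS.
have h : `[< level (Ordinal jm1) (v + w) >].
  apply/asboolP; exists u, (w' + w); split=> //; last by rewrite e addrA.
  by have := ssumD hw' hw; rewrite addn1.
exact: (bigop.bigmax_sup (Ordinal jm1)).
Qed.

Lemma plateau_steps n v w : signed_sum n W w -> (plateau v <= plateau (v + w) + n)%N.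
Proof.
elim: n v w => [|n IH] v w /=; first by move=> ->; rewrite addr0 addn0.
move=> [w1 [w2 [h1 h2 ->]]]; rewrite addrA.
have s1 : signed_sum 1 W w1 by exists w1, 0; rewrite addr0.
apply: leq_trans (plateau_step v s1) _.
by rewrite addnS ltnS; exact: IH.
Qed.

Lemma plateau_lipschitz (R : realDomainType) n v w : signed_sum n W w ->
  `|(plateau (v + w))%:R - (plateau v)%:R| <= n%:R :> R.
Proof.
move=> hw; have h1 := plateau_steps v hw.
have := plateau_steps (v + w) (ssumN hw); rewrite addrK => h2.
move: h1 h2; rewrite -!(ler_nat R) !natrD ler_norml => h1 h2; lra.
Qed.
End Levels.

Lemma sqr_sum_le (R : realFieldType) (I : finType) (g : I -> R) :
  (\sum_i g i) ^+ 2 <= #|I|%:R * \sum_i g i ^+ 2.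
Proof.
have [I0|I0] := posnP #|I|.
  have h (j : I) : False by have := card0_eq I0 j; rewrite inE.
  by rewrite big1 ?expr0n ?I0 ?mul0r // => i; case: (h i).
have n0 : 0 < #|I|%:R :> R by rewrite ltr0n.
set S := \sum_i g i; set n := #|I|%:R.
have : 0 <= \sum_i (g i - S / n) ^+ 2 by apply: sumr_ge0 => i _; exact: sqr_ge0.
have -> : \sum_i (g i - S / n) ^+ 2 = \sum_i g i ^+ 2 - S ^+ 2 / n.
  under eq_bigr do rewrite sqrrB.
  rewrite !big_split /= sumr_const -mulr_natr sumrN -/n.
  have -> : \sum_i (g i * (S / n) *+ 2) = S * (S / n) *+ 2 by rewrite sumrMnl -mulr_suml.
  by field; rewrite gt_eqF.
by rewrite subr_ge0 ler_pdivrMr // mulrC.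
Qed.

(** * Bogolyubov's argument in (Z/N)^r *)

Section FiniteLevel.
Variables (R : realType) (V : zmodType) (U W : V -> Prop) (k : nat).
Local Notation m := (8 * k ^ 2).+1.
Hypothesis W0 : W 0.
Variables (s : seq V) (N : nat).
Hypothesis N1 : (1 < N)%N.
Hypothesis wrap : forall b : 'I_(size s) -> bool, W (\sum_(i < size s) s`_i *+ N *+ b i).
Variables (q : 'I_k -> 'I_(size s)) (i0 : 'I_(size s)).
Hypothesis cover : forall v, exists j, U (v - s`_(q j)).
Hypothesis far : forall u w, signed_sum 4 U u -> signed_sum (4 * m + 3) W w -> s`_i0 <> u + w.

Local Notation F := 'rV['Z_N]_(size s).

(** Almost a homomorphism from (Z/N)^r to [V]: by [wrap], the carries of one addition cost one
    element of [W]. *)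
Definition lincomb (y : F) : V := \sum_(i < size s) s`_i *+ (y 0 i : nat).
Local Notation pi_ := lincomb.

Lemma lincombD y z : exists2 w, W w & pi_ y + pi_ z = pi_ (y + z) + w.
Proof.
exists (\sum_(i < size s) s`_i *+ N *+ (N <= y 0%R i + z 0%R i)%N); first exact: wrap.
rewrite -!big_split /=; apply: eq_bigr => i _.
have e : nat_of_ord (fun_of_matrix (y + z) 0 i) = ((y 0%R i + z 0%R i) %% N)%N.
  by rewrite mxE /=; congr (_ %% _)%N; exact: Zp_cast.
rewrite e -mulrnDr -mulrnA -mulrnDr; congr (_ *+ _).
have ly : (y 0%R i < N)%N by apply: leq_trans (ltn_ord _) _; rewrite Zp_cast.
have lz : (z 0%R i < N)%N by apply: leq_trans (ltn_ord _) _; rewrite Zp_cast.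
move: (nat_of_ord (y 0 i)) (nat_of_ord (z 0 i)) ly lz => a b la lb.
case: leqP => ab; last by rewrite muln0 addn0 modn_small.
rewrite muln1 -[in RHS](subnK ab) modnDr modn_small ?subnK //; lia.
Qed.

Lemma lincomb_delta i : pi_ (delta_mx 0 i) = s`_i.
Proof.
rewrite /pi_ (bigD1 i) //= mxE !eqxx /= modn_small // big1 ?addr0 // => j /negPf ji.
by rewrite mxE ji andbF.
Qed.

Definition coords (n : 'I_(size s) -> nat) : F := \row_i (n i)%:R.

Lemma coordsE n i : (n i < N)%N -> (coords n 0 i : nat) = n i.
Proof. by move=> ni; rewrite mxE val_Zp_nat // modn_small. Qed.

Lemma lincomb_coords n : (forall i, n i < N)%N ->
  pi_ (coords n) = \sum_(i < size s) s`_i *+ n i.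
Proof. by move=> hn; apply: eq_bigr => i _; rewrite coordsE. Qed.

Let G (y : F) : R := (plateau U W m (pi_ y))%:R.

Local Notation f := (autocorr G).
Local Notation c := (@cosZ R (size s) N).
Local Notation sn := (@sinZ R (size s) N).
Local Notation P := (power_spectrum c sn G).
Local Notation M := (#|{: F}|%:R : R).
Local Notation S := (\sum_y G y).

Let G0 y : 0 <= G y. Proof. exact: ler0n. Qed.

Let Gm y : G y <= m%:R. Proof. by rewrite ler_nat plateau_le. Qed.

Let k0 : (0 < k)%N.
Proof. by have [j _] := cover 0; case: (posnP k) j => // -> []. Qed.

(** One unit is lost for [z] and one for the carry. *)
Lemma plateau_shift y z : signed_sum 1 W (pi_ z) -> `|G (y + z) - G y| <= 2.
Proof.
move=> hz; have [w hw e] := lincombD y z.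
rewrite /G; have -> : pi_ (y + z) = pi_ y + (pi_ z - w) by rewrite addrA e addrK.
apply: plateau_lipschitz; apply: (@ssumD _ 1 1) => //.
by apply: ssumN; exact: ssum_1.
Qed.

(** For every [y] one of the [k] shifted points lands within one step of [U], where the plateau is
    at least [m - 1 = 8 * k ^ 2]. *)
Lemma plateau_sum_ge : (8 * k ^ 2)%:R * M <= k%:R * S.
Proof.
have e (j : 'I_k) : S = \sum_y G (y - delta_mx 0 (q j)).
  by rewrite (reindex_inj (addIr (- delta_mx 0 (q j)))).
have -> : k%:R * S = \sum_y \sum_j G (y - delta_mx 0 (q j)).
  rewrite exchange_big /= -(eq_bigr _ (fun j _ => e j)) sumr_const card_ord.
  by rewrite mulr_natl.
rewrite mulrC mulr_natl -sumr_const; apply: ler_sum => y _.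
have [j hj] := cover (pi_ y).
rewrite (bigD1 j) //= ler_wpDr ?sumr_ge0 //.
have [w hw] := lincombD (y - delta_mx 0 (q j)) (delta_mx 0 (q j)).
rewrite subrK lincomb_delta => /eqP; rewrite -subr_eq => /eqP e1.
have e2 : pi_ (y - delta_mx 0 (q j)) = (pi_ y - s`_(q j)) + w by rewrite -e1; zmod.
have := plateau_step U m (pi_ y - s`_(q j)) (ssum_1 hw).
by rewrite (plateau_U W m hj) ltnS -e2 ler_nat.
Qed.

Let M0 : 0 < M. Proof. by rewrite ltr0n; apply/card_gt0P; exists 0. Qed.

Let S0 : 0 < S.
Proof.
have h := plateau_sum_ge.
have : 0 < k%:R * S by apply: lt_le_trans h; rewrite mulr_gt0 // ltr0n muln_gt0 expn_gt0 k0.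
by rewrite pmulr_rgt0 // ltr0n.
Qed.

Let f_ge0 z : 0 <= f z.
Proof. by apply: sumr_ge0 => y _; rewrite mulr_ge0. Qed.

Let f0E : f 0 = \sum_y G y ^+ 2.
Proof. by apply: eq_bigr => y _; rewrite addr0 expr2. Qed.

Let f_sum : \sum_z f z = S ^+ 2.
Proof.
rewrite /autocorr exchange_big expr2 mulr_suml /=; apply: eq_bigr => y _.
rewrite -mulr_sumr; congr (_ * _).
by rewrite [RHS](reindex_inj (addrI y)).
Qed.

Lemma autocorr_neq0 z : f z != 0 -> exists u w,
  [/\ signed_sum 2 U u, signed_sum (2 * m + 1) W w & pi_ z = u + w].
Proof.
move=> fz.
have [y hy] : exists y, G y * G (y + z) != 0.
  apply/existsP; apply: contraNT fz => /existsPn h.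
  by apply/eqP; apply: big1 => y _; apply/eqP; move: (h y); rewrite negbK.
move: hy; rewrite mulf_eq0 negb_or !pnatr_eq0 -!lt0n => /andP [].
move=> /(plateau_gt0 W0) [u1 [w1 [hu1 hw1 e1]]] /(plateau_gt0 W0) [u2 [w2 [hu2 hw2 e2]]].
have [w3 hw3 e3] := lincombD y z.
exists (u2 - u1), (w2 - w1 + w3); split.
- by apply: (@ssumD _ 1 1); [exact: ssum_1|apply: ssumN; exact: ssum_1].
- by rewrite mul2n -addnn; apply: ssumD; [apply: ssumD => //; exact: ssumN|exact: ssum_1].
have -> : pi_ z = pi_ (y + z) + w3 - pi_ y by rewrite -e3; zmod.
by rewrite e1 e2; zmod.
Qed.

(** This fixes the constants in [far]: twice the support found in [autocorr_neq0] gives four terms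
    in [U] and [4 * m + 2] in [W], and one more carry makes [4 * m + 3]. *)
Lemma autocorr_shift z : f z * f (delta_mx 0 i0 + z) = 0.
Proof.
apply/eqP; apply: contraT; rewrite mulf_eq0 negb_or.
move=> /andP [/autocorr_neq0 [u1 [w1 [hu1 hw1 e1]]] /autocorr_neq0 [u2 [w2 [hu2 hw2 e2]]]].
have [w3 hw3 e3] := lincombD (delta_mx 0 i0) z.
exfalso; apply: (@far (u2 - u1) (w2 - w1 + w3)).
- by apply: (@ssumD _ 2 2) => //; exact: ssumN.
- rewrite (_ : 4 * m + 3 = (2 * m + 1) + (2 * m + 1) + 1)%N; last by lia.
  by apply: ssumD; [apply: ssumD => //; exact: ssumN|exact: ssum_1].
have -> : s`_i0 = pi_ (delta_mx 0 i0 + z) + w3 - pi_ z by rewrite -e3 lincomb_delta; zmod.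
by rewrite e1 e2; zmod.
Qed.

(** Shifting [G] by [z] changes its Fourier coefficient by the factor 1 minus the character at [z],
    whose squared modulus is [2 * (1 - c a z)]. Since [G] moves by at most 2, the real and imaginary
    parts of the change are each at most [2 * M]. *)
Lemma spectrum_continuity a z : signed_sum 1 W (pi_ z) ->
  P a * (1 - c a z) <= 4 * M ^+ 2.
Proof.
move=> hz.
pose Dc := \sum_y (G (y + z) - G y) * c a (y + z).
pose Ds := \sum_y (G (y + z) - G y) * sn a (y + z).
have bound (g : F -> R) : (forall y, `|g y| <= 1) ->
    `|\sum_y (G (y + z) - G y) * g (y + z)| <= 2 * M.
  move=> hg; apply: le_trans (ler_norm_sum _ _ _) _.
  rewrite mulrC mulr_natl -sumr_const; apply: ler_sum => y _; rewrite normrM.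
  have h1 := plateau_shift y hz; have h2 := hg (y + z).
  by rewrite -[leRHS]mulr1 ler_pM.
have cs1 y : c a y ^+ 2 + sn a y ^+ 2 = 1 by exact: cosT2sinT2.
have c1 y : `|c a y| <= 1.
  by rewrite -(@ler_pXn2r _ 2) ?nnegrE // expr1n real_normK ?num_real // -(cs1 y) lerDl sqr_ge0.
have s1 y : `|sn a y| <= 1.
  by rewrite -(@ler_pXn2r _ 2) ?nnegrE // expr1n real_normK ?num_real // -(cs1 y) lerDr sqr_ge0.
have hc : Dc ^+ 2 <= (2 * M) ^+ 2.
  by rewrite -real_normK ?num_real // lerXn2r ?nnegrE ?normr_ge0 ?mulr_ge0 ?ler0n ?bound.
have hs : Ds ^+ 2 <= (2 * M) ^+ 2.
  by rewrite -real_normK ?num_real // lerXn2r ?nnegrE ?normr_ge0 ?mulr_ge0 ?ler0n ?bound.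
have eD (g : F -> R) : \sum_y G (y + z) * g (y + z) = \sum_y G y * g y.
  by rewrite [RHS](reindex_inj (addIr z)).
have ec : Dc = cos_coef c G a * (1 - c a z) + sin_coef sn G a * sn a z.
  rewrite /Dc; under eq_bigr do rewrite mulrBl.
  rewrite sumrB (eD (c a)) /cos_coef /sin_coef mulrBr mulr1 -addrA; congr (_ + _).
  rewrite !mulr_suml -!sumrN -big_split; apply: eq_bigr => y _ /=.
  rewrite cosZD //; ring.
have es : Ds = sin_coef sn G a * (1 - c a z) - cos_coef c G a * sn a z.
  rewrite /Ds; under eq_bigr do rewrite mulrBl.
  rewrite sumrB (eD (sn a)) /cos_coef /sin_coef mulrBr mulr1 -addrA; congr (_ + _).
  rewrite !mulr_suml -!sumrN -big_split; apply: eq_bigr => y _ /=.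
  rewrite sinZD //; ring.
have : Dc ^+ 2 + Ds ^+ 2 = 2 * (P a * (1 - c a z)).
  rewrite ec es /power_spectrum.
  set A := cos_coef _ _ _; set B := sin_coef _ _ _.
  transitivity ((A ^+ 2 + B ^+ 2) * (1 - 2 * c a z + (c a z ^+ 2 + sn a z ^+ 2))); first by ring.
  rewrite cs1; ring.
move: hc hs; rewrite exprMn; set X := M ^+ 2; set Y := P a * _.
move=> hc hs h; lra.
Qed.

(** For the character [a] that is large at the basis vector of [i0], with [d] the value of 1 -
    cosine there, Cauchy-Schwarz gives [S ^+ 3 <= M * (P a * d) * (8 * K ^+ 2 + 1)]. With
    [P a <= S ^+ 2] this bounds [d] from below. A nonpositive cosine on [W] would force
    [P a <= 4 * M ^+ 2], against [S >= 8 * K * M]: the height [8 * k ^ 2 + 1] is tuned so that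
    [512 * K ^+ 3] exceeds [8 * (8 * K ^+ 2 + 1)]. *)
Lemma finite_level (J : nat) : (J < N)%N ->
  exists theta : 'I_(size s) -> R,
    (forall n : 'I_(size s) -> nat, (forall i, (n i <= J)%N) ->
       W (\sum_(i < size s) s`_i *+ n i) -> 0 < cosT (\sum_i theta i * (n i)%:R)) /\
    (2 * k%:R)^-1 <= 1 - cosT (theta i0) /\ (forall i, 0 <= theta i <= 1).
Proof.
move=> JN.
have f0 : 0 < f 0.
  have := sqr_sum_le G; rewrite -f0E => h.
  have : 0 < M * f 0 by apply: lt_le_trans h; rewrite exprn_gt0.
  by rewrite pmulr_rgt0.
have M0N : (0 < #|{: F}|)%N by rewrite -(ltr_nat R).
have [a ha] := exists_large_character (@cosZD R _ _ N1) (@sinZD R _ _ N1)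
  (fun a y => cosT2sinT2 _) (@cosZ_sum R _ _ N1) M0N f0 autocorr_shift.
set K : R := k%:R.
have K1 : 1 <= K by rewrite ler1n.
have mE : m%:R = 8 * K ^+ 2 + 1 :> R by rewrite -addn1 natrD natrM natrX.
have B0 : 0 < 8 * K ^+ 2 + 1 by rewrite ltr_wpDl ?mulr_ge0 ?sqr_ge0.
set d := 1 - c a _ in ha.
have h1 : S ^+ 2 ^+ 2 <= M * \sum_z f z ^+ 2 by rewrite -f_sum; exact: sqr_sum_le.
have h2 : f 0 <= (8 * K ^+ 2 + 1) * S.
  by rewrite f0E -mE mulr_sumr; apply: ler_sum => y _; rewrite expr2 ler_wpM2r.
have h3 : P a <= S ^+ 2.
  rewrite power_spectrumE; [|exact: cosZD|exact: sinZD|by move=> *; exact: cosT2sinT2].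
  rewrite -f_sum; apply: ler_sum => z _; rewrite ler_piMr //.
  by have := cosT2sinT2 (pairing R a z); rewrite -/(cosZ R a z); nra.
have h4 : 8 * K * M <= S.
  have := plateau_sum_ge; rewrite natrM natrX -/K => h.
  have e : 8 * K ^+ 2 * M = K * (8 * K * M) by ring.
  by rewrite e ler_pM2l // in h; lra.
have d02 : 0 <= d <= 2.
  by have := cosT2sinT2 (pairing R a (delta_mx 0 i0)); rewrite -/(cosZ R a _) /d; nra.
have P0 : 0 <= P a := power_spectrum_ge0 c sn G a.
have h5 : S ^+ 3 <= M * (P a * d) * (8 * K ^+ 2 + 1).
  rewrite -(ler_pM2r S0).
  apply: le_trans (_ : M * (P a * d * f 0) <= _).
    by rewrite -exprSr -[4%N]/(2 * 2)%N exprM; apply: le_trans h1 _; rewrite ler_pM2l.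
  rewrite mulrA -[leRHS]mulrA; apply: ler_wpM2l => //.
  by case/andP: d02 => d0 _; rewrite !mulr_ge0 // ltW.
have h6 : S <= M * d * (8 * K ^+ 2 + 1).
  have S2 : 0 < S ^+ 2 by rewrite exprn_gt0.
  rewrite -(ler_pM2r S2) -exprS; apply: le_trans h5 _.
  have -> : M * (P a * d) * (8 * K ^+ 2 + 1) = (M * d * (8 * K ^+ 2 + 1)) * P a by ring.
  by apply: ler_wpM2l => //; case/andP: d02 => d0 _; apply: mulr_ge0; [apply: mulr_ge0;
    rewrite // ltW|exact: ltW].
exists (fun i => (a 0 i : nat)%:R / N%:R); split.
  move=> n nJ hW.
  have nN i : (n i < N)%N by exact: leq_ltn_trans JN.
  rewrite -lincomb_coords // in hW.
  have := spectrum_continuity a (ssum_1 hW).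
  have -> : \sum_i (a 0 i : nat)%:R / N%:R * (n i)%:R = pairing R a (coords n).
    by apply: eq_bigr => i _; rewrite coordsE.
  rewrite -/(cosT _) -/(cosZ R a (coords n)).
  move=> h7; rewrite ltNge; apply/negP => c0.
  have h8 : P a <= 4 * M ^+ 2 by apply: le_trans h7; rewrite ler_peMr //; lra.
  have h9 : S ^+ 3 <= 8 * (8 * K ^+ 2 + 1) * M ^+ 3.
    apply: le_trans h5 _.
    have -> : 8 * (8 * K ^+ 2 + 1) * M ^+ 3 = M * (4 * M ^+ 2 * 2) * (8 * K ^+ 2 + 1) by ring.
    apply: ler_wpM2r; first exact: ltW.
    by apply: ler_wpM2l; [exact: ltW|case/andP: d02 => d0 d2; exact: ler_pM].
  have h10 : (8 * K * M) ^+ 3 <= S ^+ 3.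
    by apply: lerXn2r => //; rewrite nnegrE ?ltW // !mulr_gt0 //; lra.
  have := le_trans h10 h9; rewrite exprMn ler_pM2r ?exprn_gt0 // leNgt; case/negP.
  have -> : (8 * K) ^+ 3 = 512 * K ^+ 2 * K by ring.
  nra.
have -> : cosT ((a 0 i0 : nat)%:R / N%:R) = c a (delta_mx 0 i0).
  rewrite /cosZ /pairing (bigD1 i0) //= mxE !eqxx /= modn_small // mulr1 big1 ?addr0 //.
  by move=> j /negPf ji; rewrite mxE ji andbF mulr0.
rewrite -/d; split; last first.
  move=> i; have N0 : 0 < N%:R :> R by rewrite ltr0n ltnW.
  apply/andP; split; first by rewrite divr_ge0.
  rewrite ler_pdivrMr // mul1r ler_nat.
  by apply: leq_trans (ltnW (ltn_ord _)) _; rewrite Zp_cast.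
rewrite leNgt; apply/negP => hd.
have K2 : 0 < 2 * K by lra.
have h7 : d * (2 * K) < 1 by rewrite -(ltr_pM2r K2) mulVf ?gt_eqF // in hd.
have h8 : 8 * K <= d * (8 * K ^+ 2 + 1).
  by rewrite -(ler_pM2l M0) mulrC mulrA; apply: le_trans h4 h6.
have h9 : 8 * K * (2 * K) <= d * (2 * K) * (8 * K ^+ 2 + 1).
  by rewrite [leRHS]mulrAC ler_pM2r.
have : d * (2 * K) * (8 * K ^+ 2 + 1) < 8 * K ^+ 2 + 1 by rewrite -[ltRHS]mul1r ltr_pM2r.
have e16 : 8 * K * (2 * K) = 16 * K ^+ 2 by ring.
rewrite e16 in h9.
nra.
Qed.
End FiniteLevel.

(** A cluster point of the net [F] in the cube [[0, 1]^T], compact by Tychonoff. *)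
Lemma pointwise_cluster (R : realType) (T : eqType) (I : Type) (le : I -> I -> Prop)
    (i0 : I) (F : I -> T -> R) :
  (forall i j, exists k, forall l, le k l -> le i l /\ le j l) -> (forall i, le i i) ->
  (forall i v, 0 <= F i v <= 1) ->
  exists theta : T -> R, forall (l : seq T) (e : R) i, 0 < e ->
    exists j, le i j /\ forall v, v \in l -> `|theta v - F j v| < e.
Proof.
move=> dir refl F01.
pose K := prod_topology (fun _ : T => R : topologicalType).
pose B i : set K := [set F j | j in [set j | le i j]]%classic.
have FF : ProperFilter (filter_from setT B).
  apply: filter_from_proper; last by move=> i _; exists (F i); exists i => //; exact: refl.
  apply: filter_from_filter; first by exists i0.
  move=> i j _ _; have [k hk] := dir i j; exists k => //.
  by move=> f [l /= kl <-]; have [il jl] := hk l kl; split; exists l.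
have := @tychonoff T (fun _ => R : topologicalType) (fun _ => `[0, 1]%classic) (fun _ =>
  @segment_compact R 0 1).
move=> /(_ _ FF) [].
  exists i0 => // f [j _ <-] v /=; rewrite in_itv /=; exact: F01.
move=> theta [_ clu]; exists theta => l e i e0.
have nb : nbhs (theta : K) [set f : K | forall v, v \in l -> `|theta v - f v| < e]%classic.
  elim: l => [|v l IH]; first by apply: filterE.
  have h : nbhs (theta : K) [set f : K | ball (theta v) e (f v)]%classic.
    exact: (@proj_continuous T (fun _ =>
      R : topologicalType) v theta _ (nbhsx_ballx (theta v) e e0)).
  by apply: filterS (filterI IH h) => f [/= h1 h2] u; rewrite inE => /orP [/eqP ->|] //;
    exact: h1.
have [f [[j ij <-] h]] := clu (B i) _ (ex_intro2 _ _ i Logic.I (fun _ h => h)) nb.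
by exists j.
Qed.

(** If [d * 2 ^ i] is within 3/10 of 0 and its double within 3/10 of an integer, that integer has
    absolute value at most 9/10, so it is 0. The constant lies below 1/3 for this reason, and above
    the 1/4 of [cosT_gt0_near_int] to leave room for a limit. *)
Lemma near_int_doubling (R : realType) (s : R) (n : nat) :
  (forall j : nat, (j <= 2 ^ n)%N -> exists k : int, `|s * j%:R - k%:~R| <= 3 / 10) ->
  exists k : int, `|s - k%:~R| * (2 ^ n)%:R <= 3 / 10.
Proof.
move=> h; have [|k0] := h 1%N; first by rewrite expn_gt0.
rewrite mulr1 => h0; exists k0.
set d := s - k0%:~R in h0 *.
have step i : (i <= n)%N -> `|d * (2 ^ i)%:R| <= 3 / 10.
  elim: i => [_|i IH iN]; first by rewrite expn0 mulr1.
  have {}IH := IH (ltnW iN).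
  have [|k hk] := h (2 ^ i.+1)%N; first by rewrite leq_exp2l.
  have e : s * (2 ^ i.+1)%:R - k%:~R = d * (2 ^ i)%:R * 2 - (k - k0 * (2 ^ i.+1)%N%:Z)%:~R.
    rewrite intrB intrM -pmulrn /d expnSr natrM; ring.
  rewrite e in hk; set k' := (k - _)%R in hk.
  have k'0 : k' = 0.
    move: hk IH; rewrite !ler_norml => /andP [a1 a2] /andP [b1 b2].
    have c1 : k'%:~R < 1%:~R :> R by lra.
    have c2 : (-1)%:~R < k'%:~R :> R by rewrite mulrN1z; lra.
    move: c1 c2; rewrite !ltr_int; lia.
  by move: hk; rewrite k'0 subr0 -mulrA -natrM -expnSr.
by have := step n (leqnn n); rewrite normrM normr_nat.
Qed.

Lemma expn2_arch (R : realType) (e : R) : 0 < e -> exists n : nat, 1 < e * (2 ^ n)%:R.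
Proof.
move=> e0; exists (Num.bound e^-1).
have e1 : 1 = e * e^-1 by rewrite mulfV ?gt_eqF.
rewrite {1}e1 ltr_pM2l //.
apply: lt_trans (archi_boundP _) _; first by rewrite invr_ge0 ltW.
by rewrite ltr_nat ltn_expl.
Qed.

Lemma near_int_multiples (R : realType) (s : R) :
  (forall j : nat, exists k : int, `|s * j%:R - k%:~R| <= 3 / 10) -> exists k : int, s = k%:~R.
Proof.
move=> h; have [k0] := h 0%N => _.
have [k hk] : exists k : int, forall n : nat, `|s - k%:~R| * (2 ^ n)%:R <= 3 / 10.
  have [k hk] := near_int_doubling (n := 0) (fun j _ => h j); exists k => n.
  have [k' hk'] := near_int_doubling (n := n) (fun j _ => h j).
  have -> // : k = k'.
  have h1 : `|s - k'%:~R| <= 3 / 10.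
    by apply: le_trans hk'; rewrite ler_peMr // ler1n expn_gt0.
  move: hk h1; rewrite expn0 mulr1 !ler_norml => /andP [a1 a2] /andP [b1 b2].
  have c1 : (k - k')%:~R < 1%:~R :> R by rewrite intrB; lra.
  have c2 : (-1)%:~R < (k - k')%:~R :> R by rewrite mulrN1z intrB; lra.
  move: c1 c2; rewrite !ltr_int; lia.
exists k; apply/eqP; rewrite -subr_eq0; apply/negPn/negP => d0.
have [|n hn] := @expn2_arch R `|s - k%:~R|; first by rewrite normr_gt0.
have := hk n; lra.
Qed.

(* A homomorphism to R/Z, given by a real-valued lift. *)
Definition circle_hom (R : realType) (V : zmodType) (chi : V -> R) : Prop :=
  forall a b, chi (a + b) - (chi a + chi b) \is a Num.int.

(** * From finite characters to a character of a precompact group *)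

Section LimitCharacter.
Variables (R : realType) (V : zmodType) (N : (V -> Prop) -> Prop).
Hypothesis hN : precompact_base N.
Variables (U W : V -> Prop) (ts : seq V) (x : V).
Hypothesis hW : N W.
Hypothesis cover : forall v, exists2 t, t \in ts & U (v - t).
Hypothesis far : forall u w, signed_sum 4 U u ->
  signed_sum (4 * (8 * size ts ^ 2).+1 + 3) W w -> x <> u + w.

Lemma finite_character (l : seq V) (J : nat) : exists theta : V -> R,
  [/\ forall v, 0 <= theta v <= 1,
      forall a b c j, a \in l -> b \in l -> c \in l -> a + b + c = 0 -> (j <= J)%N ->
        0 < cosT ((theta a + theta b + theta c) * j%:R),
      forall w, w \in l -> W w -> 0 < cosT (theta w) &
      (2 * (size ts)%:R)^-1 <= 1 - cosT (theta x)].
Proof.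
pose s := x :: ts ++ l.
(* Three coinciding indices give coefficients up to [3 * J]; the bound [3 * J + 1] passed to
   [finite_level] also admits the coefficient 1 when [J] is 0. *)
have [n Jn wrap] := pb_recurrence_sum hN s (3 * J).+2 hW.
have q_lt (j : 'I_(size ts)) : (j.+1 < size s)%N.
  by rewrite /= ltnS size_cat; apply: leq_trans (ltn_ord j) (leq_addr _ _).
pose q j := Ordinal (q_lt j).
have sq (j : 'I_(size ts)) : s`_(q j) = ts`_j by rewrite /= nth_cat ltn_ord.
have cov v : exists j, U (v - s`_(q j)).
  have [t tts ht] := cover v; have it : (index t ts < size ts)%N by rewrite index_mem.
  by exists (Ordinal it); rewrite sq nth_index.
have n1 : (1 < n)%N by apply: leq_trans Jn.
have x0 : (0 < size s)%N by [].
have Jn' : ((3 * J).+1 < n)%N by [].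
have [theta [h1 [h2 h3]]] :=
  @finite_level R V U W (size ts) (pb_zero hN hW) s n n1 wrap q (Ordinal x0) cov far _ Jn'.
pose Theta v := if insub (index v s) is Some i then theta i else 0.
have ThetaE v : v \in s -> exists i : 'I_(size s), Theta v = theta i /\ s`_i = v.
  move=> vs; have iv : (index v s < size s)%N by rewrite index_mem.
  by exists (Ordinal iv); rewrite /Theta insubT nth_index.
have ls v : v \in l -> v \in s by move=> vl; rewrite inE mem_cat vl !orbT.
have theta1 (i : 'I_(size s)) : \sum_j theta j * (j == i)%:R = theta i.
  by rewrite (bigD1 i) //= eqxx mulr1 big1 ?addr0 // => j /negPf ->; rewrite mulr0.
have s1 (i : 'I_(size s)) : \sum_(j < size s) s`_j *+ (j == i) = s`_i.
  by rewrite (bigD1 i) //= eqxx big1 ?addr0 // => j /negPf ->.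
exists Theta; split.
- by move=> v; rewrite /Theta; case: insubP => [i _ _|_]; rewrite ?lexx ?ler01.
- move=> a b c k /ls /ThetaE [ia [-> ea]] /ls /ThetaE [ib [-> eb]] /ls /ThetaE [ic [-> ec]]
  abc kJ.
  have := h1 (fun j => (((j == ia) + (j == ib) + (j == ic)) * k)%N).
  have -> : \sum_i theta i * (((i == ia) + (i == ib) + (i == ic)) * k)%:R =
    (theta ia + theta ib + theta ic) * k%:R.
    rewrite -(theta1 ia) -(theta1 ib) -(theta1 ic) -!big_split /= mulr_suml.
    by apply: eq_bigr => j _; rewrite natrM !natrD; ring.
  apply.
    by move=> j; case: (_ == ia); case: (_ == ib); case: (_ == ic); lia.
  have -> : \sum_(i < size s) s`_i *+ (((i == ia) + (i == ib) + (i == ic)) * k) = (a + b + c)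
    *+ k.
    rewrite -ea -eb -ec -(s1 ia) -(s1 ib) -(s1 ic) -!big_split /= -sumrMnl.
    by apply: eq_bigr => j _; rewrite mulrnA !mulrnDr.
  by rewrite abc mul0rn; exact: pb_zero hN _ hW.
- move=> w /ls /ThetaE [iw [-> ew]] Ww.
  have := h1 (fun j => (j == iw)%N); rewrite theta1; apply; first by move=> j; case: eqP.
  by rewrite s1 ew.
- have -> // : Theta x = theta (Ordinal x0).
  by rewrite /Theta /= eqxx insubT.
Qed.

(** The lower bound at [x] in [finite_character] depends only on the number of translates, not on
    [l] or [J], so nontriviality at [x] survives the limit. *)
Lemma limit_character : exists theta : V -> R,
  [/\ circle_hom theta,
      forall w, W w -> exists k : int, `|theta w - k%:~R| <= 3 / 10 &
      theta x \isn't a Num.int].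
Proof.
have [F hF] := choice (fun i : seq V * nat => finite_character i.1 i.2).
pose le (i j : seq V * nat) := {subset i.1 <= j.1} /\ (i.2 <= j.2)%N.
have [|||theta hth] := @pointwise_cluster R V _ le ([::], 0%N) F.
- move=> [l1 n1] [l2 n2]; exists (l1 ++ l2, maxn n1 n2) => [[l n]] [/= h1 h2].
  move: h2; rewrite geq_max => /andP [h2 h3].
  by split; split=> //= v vl; apply: h1; rewrite mem_cat vl ?orbT.
- by move=> i; split.
- by move=> i v; have [/(_ v)] := hF i.
have triple a b c : a + b + c = 0 -> exists k : int, theta a + theta b + theta c = k%:~R.
  move=> abc; apply: near_int_multiples => J.
  (* The three errors, multiplied by [J], stay below 3/100, and 1/4 + 3/100 < 3/10. *)
  pose e : R := 100^-1 / J.+1%:R.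
  have e0 : 0 < e by rewrite divr_gt0 // invr_gt0.
  have [[l n] [[/= ls Jn] hl]] := hth [:: a; b; c] e ([:: a; b; c], J) e0.
  have ma : a \in [:: a; b; c] by rewrite !inE eqxx.
  have mb : b \in [:: a; b; c] by rewrite !inE eqxx orbT.
  have mc : c \in [:: a; b; c] by rewrite !inE eqxx !orbT.
  have [_ /(_ a b c J (ls _ ma) (ls _ mb) (ls _ mc) abc Jn) /cosT_gt0_near_int [k hk] _ _] :=
    hF (l, n).
  exists k.
  have eJ : e * J%:R <= 100^-1.
    rewrite /e mulrAC ler_pdivrMr // ler_pM2l ?invr_gt0 // ler_nat //.
  move: hk (hl a ma) (hl b mb) (hl c mc); set fa := F _ a; set fb := F _ b; set fc := F _ c.
  move=> hk a1 b1 c1.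
  have hs : `|(theta a + theta b + theta c) * J%:R - (fa + fb + fc) * J%:R| <= 3 / 100.
    rewrite -mulrBl normrM normr_nat.
    apply: (@le_trans _ _ (3 * e * J%:R)); last by rewrite -mulrA; lra.
    apply: ler_wpM2r => //; move: a1 b1 c1; rewrite !ltr_norml ler_norml; lra.
  move: hs hk; rewrite !ler_norml ltr_norml; lra.
have small w : W w -> exists k : int, `|theta w - k%:~R| <= 3 / 10.
  move=> Ww; have e0 : 0 < 100^-1 :> R by rewrite invr_gt0.
  have [[l n] [[/= ls _] hl]] := hth [:: w] _ ([:: w], 0%N) e0.
  have mw : w \in [:: w] by rewrite inE eqxx.
  have [_ _ /(_ w (ls _ mw) Ww) /cosT_gt0_near_int [k hk] _] := hF (l, n).
  exists k; move: hk (hl w mw); rewrite !ltr_norml ler_norml; lra.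
(* Three times [theta 0] is an integer and [theta 0] is within 3/10 of one; the distance is thus a
   multiple of 1/3 below 1/3. *)
have [k0 th0] : exists k : int, theta 0 = k%:~R.
  have [k hk] := small 0 (pb_zero hN hW).
  have [k3 h3] := triple 0 0 0 (ltac:(by rewrite !addr0)).
  exists k; move: hk; rewrite ler_norml => hk.
  have c1 : (k3 - k * 3)%:~R < 1%:~R :> R by rewrite intrB intrM; lra.
  have c2 : (-1)%:~R < (k3 - k * 3)%:~R :> R by rewrite mulrN1z intrB intrM; lra.
  move: c1 c2; rewrite !ltr_int => c1 c2; have e : k3 = k * 3 by lia.
  by move: h3; rewrite e intrM; lra.
exists theta; split=> //.
  move=> a b.
  have [k1 h1] := triple a b (- (a + b)) (addrN _).
  have [k2 h2] := triple (a + b) (- (a + b)) 0 (ltac:(by rewrite addr0 addrN)).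
  by apply/intrP; exists (k2 - k1 - k0); rewrite !intrB -h1 -h2 -th0; ring.
apply/negP => /intrP [k hk].
have k_gt0 : (0 < size ts)%N by have [t] := cover 0; case: (ts).
have d0 : 0 < (2 * (size ts)%:R)^-1 :> R by rewrite invr_gt0 mulr_gt0 // ltr0n.
have [e e0 he] := cosT_near1 d0.
have [[l n] [_ hl]] := hth [:: x] _ ([::], 0%N) e0.
have mx : x \in [:: x] by rewrite inE eqxx.
have [_ _ _] := hF (l, n); rewrite leNgt; case/negP; apply: (he _ k).
by rewrite distrC -hk hl.
Qed.
End LimitCharacter.

Theorem precompact_character (R : realType) (V : zmodType) (N : (V -> Prop) -> Prop)
    (W0 : V -> Prop) (x : V) :
  precompact_base N -> N W0 -> ~ W0 x ->
  exists theta : V -> R,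
    [/\ circle_hom theta,
       exists2 W, N W & forall w, W w -> exists k : int, `|theta w - k%:~R| <= 3 / 10 &
       theta x \isn't a Num.int].
Proof.
move=> hN hW0 nx.
(* Four terms come from the hypothesis [far] of [limit_character]; the fifth absorbs the whole sum
   over [W]. *)
have [U hU hU5] := pb_ssum hN 5 hW0.
have [ts hts] := pb_cover hN hU.
have [W hW hWU] := pb_ssum hN (4 * (8 * size ts ^ 2).+1 + 3) hU.
have [|theta [h1 h2 h3]] := @limit_character R V N hN U W ts x hW hts.
  move=> u w hu hw e; apply: nx; apply: hU5; rewrite e.
  by apply: (@ssumD _ 4 1) => //; apply: ssum_1; exact: hWU.
by exists theta; split=> //; exists W.
Qed.

(** * Compact groups and the connected component *)

Record top_group (V : zmodType) (op : (V -> Prop) -> Prop) : Prop := TopGroup {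
  tg_full : op (fun _ => True);
  tg_union : forall F : (V -> Prop) -> Prop, (forall U, F U -> op U) ->
    op (fun x => exists U, F U /\ U x);
  tg_inter : forall U U', op U -> op U' -> op (fun x => U x /\ U' x);
  tg_sub : forall U x y, op U -> U (x - y) ->
    exists A B, op A /\ op B /\ A x /\ B y /\ forall a b, A a -> B b -> U (a - b);
  tg_haus : forall x y : V, x <> y -> exists U U', op U /\ op U' /\ U x /\ U' y /\
    forall z, ~ (U z /\ U' z)
}.

Record compact_group (V : zmodType) (op : (V -> Prop) -> Prop) : Prop := CompactGroup {
  cg_top :> top_group op;
  cg_compact : forall F : (V -> Prop) -> Prop, (forall U, F U -> op U) ->
    (forall x, True -> exists U, F U /\ U x) ->
    exists l : list (V -> Prop), (forall U, List.In U l -> F U) /\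
      (forall x, True -> exists U, List.In U l /\ U x)
}.

Section Topology.
Variables (V : zmodType) (op : (V -> Prop) -> Prop).
Hypothesis hV : top_group op.
Implicit Types (U O A B S H P : V -> Prop) (x y : V).

Definition is_closed S := op (fun x => ~ S x).
Definition open_nbhd0 U := op U /\ U 0.
Definition subgroup S := S 0 /\ forall a b, S a -> S b -> S (a - b).
Definition closed_subgroup S := subgroup S /\ is_closed S.
Definition open_subgroup S := subgroup S /\ op S.
Definition core x := forall P, open_subgroup P -> P x.
Definition closure S x := forall U, open_nbhd0 U -> exists s, S s /\ U (s - x).

Lemma op_ext A B : (forall x, A x <-> B x) -> op A -> op B.
Proof. by move=> h; have -> : A = B by apply: funext => x; apply/propext. Qed.

Lemma op_local A : (forall x, A x -> exists U, [/\ op U, U x & forall y, U y -> A y]) -> op A.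
Proof.
move=> h; apply: (op_ext (A := fun x => exists U, (op U /\ forall y, U y -> A y) /\ U x)).
  move=> x; split; first by move=> [U [[_ hU] Ux]]; exact: hU.
  by move=> /h [U [h1 h2 h3]]; exists U.
by apply: tg_union => // U [].
Qed.

Lemma op_transl U a : op U -> op (fun x => U (x + a)).
Proof.
move=> hU; apply: op_local => x; rewrite -[a]opprK => hx.
have [A [B [hA [hB [Ax [Ba h]]]]]] := tg_sub hV hU hx.
by exists A; split=> // y Ay; exact: h.
Qed.

Lemma op_opp U : op U -> op (fun x => U (- x)).
Proof.
move=> hU; apply: op_local => x; rewrite -sub0r => hx.
have [A [B [hA [hB [A0 [Bx h]]]]]] := tg_sub hV hU hx.
by exists B; split=> // y By; rewrite -sub0r; exact: h.
Qed.

Lemma op_reflect U a : op U -> op (fun x => U (a - x)).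
Proof.
move=> hU; apply: op_ext (op_opp (op_transl a hU)) => x /=; by rewrite addrC.
Qed.

Lemma nb0I U U' : open_nbhd0 U -> open_nbhd0 U' -> open_nbhd0 (fun x => U x /\ U' x).
Proof. by move=> [h1 h2] [h3 h4]; split=> //; exact: tg_inter. Qed.

Lemma nb0T : open_nbhd0 (fun _ => True).
Proof. by split=> //; exact: tg_full hV. Qed.

Lemma nb0_at U x : op U -> U x -> open_nbhd0 (fun y => U (y + x)).
Proof. by move=> h1 h2; split; [exact: op_transl|rewrite add0r]. Qed.

Lemma nb0_half U : open_nbhd0 U -> exists2 A, open_nbhd0 A & forall a b, A a -> A b -> U (a - b).
Proof.
move=> [hU U0]; have U0' : U (0 - 0) by rewrite subr0.
have [A [B [hA [hB [A0 [B0 h]]]]]] := tg_sub hV hU U0'.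
by exists (fun x => A x /\ B x); [exact: nb0I|move=> a b [ha _] [_ hb]; exact: h].
Qed.

Lemma op_mulrn U n : op U -> op (fun x => U (x *+ n)).
Proof.
elim: n U => [|n IH] U hU.
  apply: op_local => x; rewrite mulr0n => U0; exists (fun _ => True); split=> //.
  exact: tg_full hV.
apply: op_local => x; rewrite mulrSr => hx.
have hx' : U (x *+ n - - x) by rewrite opprK.
have [A [B [hA [hB [A0 [Bx h]]]]]] := tg_sub hV hU hx'.
exists (fun y => A (y *+ n) /\ B (- y)); split.
- by apply: tg_inter => //; [exact: IH|exact: op_opp].
- by split.
by move=> y [h1 h2]; have := h _ _ h1 h2; rewrite opprK -mulrSr.
Qed.

Lemma nb0_mulrn U n : open_nbhd0 U -> open_nbhd0 (fun x => U (x *+ n)).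
Proof. by move=> [h1 h2]; split; [exact: op_mulrn|rewrite mul0rn]. Qed.

Lemma nb0_sep x : x <> 0 -> exists2 U, open_nbhd0 U & ~ U x.
Proof.
move=> hx; have [U [U' [h1 [h2 [h3 [h4 h]]]]]] := tg_haus hV hx.
by exists U' => // h5; exact: (h x).
Qed.

Lemma cl_ext A B : (forall x, A x <-> B x) -> is_closed A -> is_closed B.
Proof. by move=> h; apply: op_ext => x; rewrite h. Qed.

Lemma clI A B : is_closed A -> is_closed B -> is_closed (fun x => A x /\ B x).
Proof.
move=> hA hB; apply: op_local => x h.
have [nA|nA] := pselect (A x); last by exists (fun x => ~ A x); split=> // y ? [].
exists (fun x => ~ B x); split=> //; first by move=> hx; exact: h.
by move=> y ? [].
Qed.

Lemma cl_forall (I : Type) (F : I -> V -> Prop) :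
  (forall i, is_closed (F i)) -> is_closed (fun x => forall i, F i x).
Proof.
move=> hF; apply: op_local => x /existsNP [i hi].
by exists (fun x => ~ F i x); split=> [||y hy /(_ i)] //; exact: hF.
Qed.

Lemma cl_imp (Q : Prop) A : (Q -> is_closed A) -> is_closed (fun x => Q -> A x).
Proof. by move=> h; exact: (cl_forall h). Qed.

Lemma cl_transl A a : is_closed A -> is_closed (fun x => A (x + a)).
Proof. exact: op_transl. Qed.

Lemma cl_reflect A a : is_closed A -> is_closed (fun x => A (a - x)).
Proof. exact: op_reflect. Qed.

Lemma cl_mulrn A n : is_closed A -> is_closed (fun x => A (x *+ n)).
Proof. exact: op_mulrn. Qed.

Lemma cl_op A : op A -> is_closed (fun x => ~ A x).
Proof. by apply: op_ext => x; split=> [h /(_ h) //|/contrapT]. Qed.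

Lemma closed_closure A x : is_closed A -> closure A x -> A x.
Proof.
move=> hA h; apply: contrapT => nA.
have [s [As]] := h _ (nb0_at hA nA); by rewrite subrK.
Qed.

Lemma cl_closure A : is_closed (closure A).
Proof.
apply: op_local => x /existsNP [U /not_implyP [hU h]].
have [W hW hWU] := nb0_half hU.
exists (fun y => W (x - y)); split; first by apply: op_reflect; case: hW.
  by rewrite subrr; case: hW.
move=> y hy hc; apply: h.
have [s [As hs]] := hc W hW; exists s; split=> //.
by rewrite (_ : s - x = (s - y) - (x - y)); [exact: hWU|zmod].
Qed.

Lemma cl_of_closure A : (forall x, closure A x -> A x) -> is_closed A.
Proof.
move=> h; apply: cl_ext (@cl_closure A) => x; split; first exact: h.
by move=> Ax U [_ U0]; exists x; rewrite subrr.
Qed.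

Lemma sgN S a : subgroup S -> S a -> S (- a).
Proof. by move=> [h0 h] ha; rewrite -sub0r; exact: h. Qed.

Lemma sgD S a b : subgroup S -> S a -> S b -> S (a + b).
Proof. by move=> hS ha hb; rewrite -[b]opprK; apply: hS.2 => //; exact: sgN. Qed.

Lemma sgMn S a n : subgroup S -> S a -> S (a *+ n).
Proof.
move=> hS ha; elim: n => [|n IH]; first by rewrite mulr0n; case: hS.
by rewrite mulrS; exact: sgD.
Qed.

Lemma sgMz S a k : subgroup S -> S a -> S (a *~ k).
Proof.
move=> hS ha; case: k => n; first exact: sgMn.
by rewrite NegzE mulrNz; apply: sgN => //; exact: sgMn.
Qed.

Lemma sg_eqD S a b : subgroup S -> S (a - b) -> S a <-> S b.
Proof.
move=> hS hab; split=> h; last by rewrite -[a](subrK b); exact: sgD.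
by rewrite (_ : b = a - (a - b)); [exact: hS.2|zmod].
Qed.

Lemma osg_nb0 P : open_subgroup P -> open_nbhd0 P. Proof. by move=> [[h0 _] h]; split. Qed.

Lemma osg_cl P : open_subgroup P -> is_closed P.
Proof.
move=> [hP hO]; apply: op_local => x nx; exists (fun y => P (y - x)); split.
- exact: op_transl.
- by rewrite subrr; case: hP.
by move=> y hy; rewrite (sg_eqD hP hy).
Qed.

Lemma osgI P P' : open_subgroup P -> open_subgroup P' -> open_subgroup (fun x => P x /\ P' x).
Proof.
move=> [[h0 h1] h2] [[h3 h4] h5]; split; last exact: tg_inter.
by split=> // a b [ha ha'] [hb hb']; split; [exact: h1|exact: h4].
Qed.

Lemma osgT : open_subgroup (fun _ => True).
Proof. by split=> //; exact: tg_full hV. Qed.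

Lemma sg_osg S U : subgroup S -> open_nbhd0 U -> (forall u, U u -> S u) -> open_subgroup S.
Proof.
move=> hS [hU U0] US; split=> //; apply: op_local => x Sx.
exists (fun y => U (y - x)); split; [exact: op_transl|by rewrite subrr|].
by move=> y /US h; apply/(sg_eqD hS h).
Qed.

Lemma sg_core : subgroup core.
Proof. by split=> [P [[h0 _] _] //|a b ha hb P hP]; apply: hP.1.2; [exact: ha|exact: hb]. Qed.

Lemma cl_core : is_closed core.
Proof. by apply: cl_forall => P; apply: cl_imp; exact: osg_cl. Qed.

Lemma csg_core : closed_subgroup core. Proof. split; [exact: sg_core|exact: cl_core]. Qed.

End Topology.

Section CompactTopology.
Variables (V : zmodType) (op : (V -> Prop) -> Prop).
Hypothesis hV : compact_group op.
Let hT : top_group op := hV.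
Implicit Types (U O A B S H P : V -> Prop) (x y : V).
Local Notation is_closed := (is_closed op).
Local Notation open_nbhd0 := (open_nbhd0 op).
Local Notation closed_subgroup := (closed_subgroup op).
Local Notation open_subgroup := (open_subgroup op).
Local Notation core := (core op).
Local Notation closure := (closure op).

Lemma fip (I : Type) (D : I -> Prop) (A : I -> V -> Prop) (i0 : I) : D i0 ->
  (forall i, D i -> is_closed (A i)) ->
  (forall i j, D i -> D j -> exists k, [/\ D k, forall x, A k x -> A i x & forall x, A k x ->
    A j x]) ->
  (forall i, D i -> exists x, A i x) -> exists x, forall i, D i -> A i x.
Proof.
move=> Di0 hcl dir ne; apply: contrapT => h.
have [] := cg_compact hV (F := fun U => exists i, D i /\ U = (fun x => ~ A i x)).
- by move=> U [i [Di ->]]; exact: hcl.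
- move=> x _; apply: contrapT => h2; apply: h; exists x => i Di; apply: contrapT => nA.
  by apply: h2; exists (fun x => ~ A i x); split=> //; exists i.
move=> l [hl hc].
have [k [Dk hk]] : exists k, D k /\ forall U, List.In U l -> forall x, A k x -> ~ U x.
  elim: l hl {hc} => [|U l IH] hl; first by exists i0.
  have [k [Dk hk]] := IH (fun U h => hl U (or_intror h)).
  have [i [Di e]] := hl U (or_introl erefl).
  have [j [Dj h1 h2]] := dir _ _ Dk Di; exists j; split=> // U' [<-|/hk h3] x hx.
    by rewrite e; apply; exact: h2.
  by apply: h3; exact: h1.
have [x Ax] := ne k Dk; have [U [Ul Ux]] := hc x Logic.I.
exact: hk Ul x Ax Ux.
Qed.

Lemma finite_cover U : open_nbhd0 U ->
  exists ts : seq V, forall v, exists2 t, t \in ts & U (v - t).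
Proof.
move=> [hU U0].
have [] := cg_compact hV (F := fun A => exists t, A = fun v => U (v - t)).
- by move=> A [t ->]; exact: (op_transl hT).
- by move=> x _; exists (fun v => U (v - x)); split; [exists x|rewrite subrr].
move=> l [hl hc].
have [ts hts] : exists ts : seq V, forall A, List.In A l ->
  exists2 t, t \in ts & A = fun v => U (v - t).
  elim: l hl {hc} => [|A l IH] hl; first by exists [::].
  have [ts hts] := IH (fun U h => hl U (or_intror h)).
  have [t e] := hl A (or_introl erefl).
  exists (t :: ts) => B [<-|/hts [u uts ->]]; first by exists t; rewrite ?inE ?eqxx.
  by exists u; rewrite // inE uts orbT.
exists ts => v; have [A [/hts [t tts ->] h]] := hc v Logic.I; by exists t.
Qed.

(* Nets indexed by the neighbourhoods of 0 have cluster points. *)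
Lemma cluster (S : (V -> Prop) -> V -> Prop) :
  (forall U U', open_nbhd0 U -> open_nbhd0 U' -> (forall x, U x -> U' x) ->
    forall x, S U x -> S U' x) ->
  (forall U, open_nbhd0 U -> exists x, S U x) ->
  exists h, forall U, open_nbhd0 U -> closure (S U) h.
Proof.
move=> mono ne; apply: (fip (D := open_nbhd0) (A := fun U => closure (S U)) (nb0T hT)).
- by move=> U _; exact: cl_closure.
- move=> U U' hU hU'; exists (fun x => U x /\ U' x); split; first exact: nb0I.
    move=> x hx O hO; have [s [hs Os]] := hx O hO; exists s; split=> //.
    exact: (mono _ _ (nb0I hT hU hU') hU (fun y h => proj1 h) _ hs).
  move=> x hx O hO; have [s [hs Os]] := hx O hO; exists s; split=> //.
  exact: (mono _ _ (nb0I hT hU hU') hU' (fun y h => proj2 h) _ hs).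
move=> U hU; have [x hx] := ne U hU; exists x => O [_ O0]; exists x; by rewrite subrr.
Qed.

Lemma cl_diff A B : is_closed A -> is_closed B -> is_closed (fun x =>
  exists a b, [/\ A a, B b & x = a - b]).
Proof.
move=> hA hB; set D := (fun x => _).
apply: (cl_of_closure hT) => x hx.
have [a ha] := @cluster (fun U a => A a /\ exists b, B b /\ U (a - b - x))
  (ltac:(by move=> U U' _ _ h y [Ay [b [Bb hb]]]; split=> //; exists b; split=> //; exact: h))
  (ltac:(by move=> U hU; have [s [[a [b [Aa Bb ->]]] hs]] := hx U hU; exists a; split=> //;
    exists b)).
have Aa : A a.
  by apply: (closed_closure hT) => // U hU; have [s [[As _] h]] := ha U hU U hU; exists s.
have Bb : B (a - x).
  apply: (closed_closure hT) => // U hU; have [W hW hWU] := nb0_half hT hU.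
  have [s [[As [b [Bb h]]] hs]] := ha W hW W hW; exists b; split=> //.
  by rewrite (_ : b - (a - x) = (s - a) - (s - b - x)); [exact: hWU|zmod].
by exists a, (a - x); split=> //; zmod.
Qed.

Lemma cl_mulrn_image A n : is_closed A -> is_closed (fun x => exists2 a, A a & x = a *+ n).
Proof.
move=> hA; set D := (fun x => _).
apply: (cl_of_closure hT) => x hx.
have [a ha] := @cluster (fun U a => A a /\ U (a *+ n - x))
  (ltac:(by move=> U U' _ _ h y [Ay hy]; split=> //; exact: h))
  (ltac:(by move=> U hU; have [s [[a Aa ->] hs]] := hx U hU; exists a)).
exists a.
  by apply: (closed_closure hT) => // U hU; have [s [[As _] h]] := ha U hU U hU; exists s.
apply: contrapT => ne.
have [U hU] := @nb0_sep V op hT (a *+ n - x) (ltac:(by move/eqP; rewrite subr_eq0 => /eqP e;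
  apply: ne)).
apply; have [W hW hWU] := nb0_half hT hU.
have [s [[As h] hs]] := ha W hW _ (nb0_mulrn hT n hW).
by rewrite (_ : a *+ n - x = (s *+ n - x) - (s - a) *+ n); [apply: hWU|zmod].
Qed.

Lemma cl_sub0 : is_closed (fun x => x = 0).
Proof.
apply: (op_local hT) => x /(nb0_sep hT) [U [hU U0] nU].
exists (fun y => U (x - y)); split; [exact: (op_reflect hT)|by rewrite subrr|].
by move=> y hy y0; apply: nU; rewrite y0 subr0 in hy.
Qed.

(** Otherwise the closed sets [P] minus [O] are nonempty and directed, and a common point would lie
    in the core but not in [O]. *)
Lemma core_nbhd O : op O -> (forall x, core x -> O x) ->
  exists2 P, open_subgroup P & forall x, P x -> O x.
Proof.
move=> hO hc; apply: contrapT => h.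
have [|||x hx] := @fip _ open_subgroup (fun P x => P x /\ ~ O x) _ (osgT hT).
- by move=> P hP; apply: clI => //; [exact: osg_cl|exact: cl_op].
- move=> P P' hP hP'; exists (fun x => P x /\ P' x); split; first exact: osgI.
    by move=> x [[]].
  by move=> x [[]].
- move=> P hP; apply: contrapT => h2; apply: h; exists P => // x Px.
  by apply: contrapT => nO; apply: h2; exists x.
by have [_] := hx _ (osgT hT); apply; apply: hc => P /hx [].
Qed.

Lemma uniform_recurrence U : open_nbhd0 U -> exists2 N, (0 < N)%N &
  forall x, exists i, [/\ (0 < i)%N, (i <= N)%N & U (x *+ i)].
Proof.
move=> /(nb0_half hT) [W hW hWU]; have [ts hts] := finite_cover hW.
exists (size ts).
  by have [t] := hts 0; case: (ts).
move=> x.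
have hx i : exists t, t \in ts /\ W (x *+ i - t) by have [t] := hts (x *+ i); exists t.
have [c hc] := choice hx.
have [i [j [ij jk e]]] := pigeonhole (fun i => (hc i).1).
exists (j - i)%N; rewrite subn_gt0 ij; split=> //; first exact: leq_trans (leq_subr _ _) jk.
rewrite mulrnBr 1?ltnW // (_ : _ - _ = (x *+ j - c j) - (x *+ i - c i)); last by rewrite e; zmod.
by apply: hWU; [exact: (hc j).2|exact: (hc i).2].
Qed.

Lemma osg_exponent P : open_subgroup P -> exists2 e, (0 < e)%N & forall x, P (x *+ e).
Proof.
move=> hP; have [N N0 hN] := uniform_recurrence (osg_nb0 hP).
exists N`!; first exact: fact_gt0.
move=> x; have [i [i0 iN Pi]] := hN x.
have /dvdnP [q ->] : (i %| N`!)%N by apply: dvdn_fact; rewrite i0.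
by rewrite mulnC mulrnA; apply: sgMn => //; case: hP.
Qed.

Definition is_connected S := forall U U', op U -> op U' -> (forall x, S x -> U x \/ U' x) ->
  (exists x, S x /\ U x) -> (exists x, S x /\ U' x) -> exists x, S x /\ U x /\ U' x.

Lemma conn_osg S P : is_connected S -> S 0 -> open_subgroup P -> forall x, S x -> P x.
Proof.
move=> hS S0 hP x Sx; apply: contrapT => nP.
have [|||||y [_ [h1 h2]]] := hS P (fun y => ~ P y).
- by case: hP.
- exact: osg_cl.
- by move=> y _; exact: EM.
- by exists 0; split=> //; case: hP => -[].
- by exists x.
exact: h2.
Qed.

Definition span U x := exists n, signed_sum n U x.

Lemma sg_span U : subgroup (span U).
Proof.
split; first by exists 0%N.
by move=> a b [n ha] [m hb]; exists (n + m)%N; apply: ssumD => //; exact: ssumN.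
Qed.

Lemma osg_span U : open_nbhd0 U -> open_subgroup (span U).
Proof.
move=> hU; apply: (sg_osg hT (sg_span U) hU) => u Uu; exists 1%N; exact: ssum_1.
Qed.

Lemma nb0_ssum n U : open_nbhd0 U -> exists2 W, open_nbhd0 W & forall v, signed_sum n W v -> U v.
Proof.
move=> hU; apply: (@pb_ssum V open_nbhd0 _ n U hU); split.
- by move=> W [].
- by move=> W /(nb0_half hT).
- by move=> W /finite_cover.
Qed.

(* The 3-chains inside a small neighbourhood of the core cannot jump between
   two disjoint closed pieces of it. *)
Lemma conn_core : is_connected core.
Proof.
move=> U U' hU hU' hc [a [ca Ua]] [b [cb Ub]]; apply: contrapT => h.
pose A x := core x /\ ~ U' x; pose B x := core x /\ ~ U x.
have clA : is_closed A by apply: clI => //; [exact: cl_core|exact: cl_op].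
have clB : is_closed B by apply: clI => //; [exact: cl_core|exact: cl_op].
have AB x : core x -> A x \/ B x.
  move=> cx; have [Ux|nU] := pselect (U x); [left|by right]; split=> // U'x.
  by apply: h; exists x.
have nbD : open_nbhd0 (fun z => ~ exists b a, [/\ B b, A a & z = b - a]).
  split; first exact: cl_diff.
  move=> [x [y [[hx nx] [hy ny] /esym/eqP]]]; rewrite subr_eq0 => /eqP e.
  by subst y; case: (hc x hx).
have [W hW hWD] := nb0_ssum 3 nbD.
have hO : op (fun x => exists c, core c /\ W (x - c)).
  apply: (op_local hT) => x [c [cc hx]]; exists (fun y => W (y - c)); split=> //.
    by apply: (op_transl hT); case: hW.
  by move=> y hy; exists c.
have [|P hP PW] := core_nbhd hO.
  by move=> x cx; exists x; rewrite subrr; case: hW.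
have hPW : open_nbhd0 (fun x => P x /\ W x) by apply: nb0I => //; exact: osg_nb0.
have Aa : A a by split=> // U'a; apply: h; exists a.
have Bb : B b by split=> // Ub'; apply: h; exists b.
(* The span of a neighbourhood is an open subgroup, so it contains the core: a finite chain of small
   steps leads from [a] to [b]. *)
have [n hn] := (sg_core op).2 _ _ cb ca _ (osg_span hPW).
have key m v w : signed_sum m (fun x => P x /\ W x) v -> P w ->
    (exists2 c, A c & W (w - c)) -> exists2 c, A c & W (w + v - c).
  elim: m v w => [|m IH] v w /=; first by move=> ->; rewrite addr0.
  move=> [w1 [u [hw1 hu ->]]] Pw [c Ac hc1]; rewrite addrA.
  have Pw1 : P w1 by case: hw1 => [[]|[]] // /(sgN hP.1); rewrite opprK.
  have hw1' : W w1 \/ W (- w1) by case: hw1 => [[]|[]] *; [left|right].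
  have Pww : P (w + w1) by apply: sgD => //; case: hP.
  apply: IH => //; have [c2 [cc2 hc2]] := PW _ Pww.
  case: (AB c2 cc2) => [|Bc2]; first by exists c2.
  exfalso; apply: (hWD (c2 - c)); last by exists c2, c.
  rewrite (_ : c2 - c = (w - c) + (w1 - (w + w1 - c2))); last by zmod.
  apply: (@ssumD _ 1 2); first exact: ssum_1.
  by apply: (@ssumD _ 1 1); [exists w1, 0; rewrite addr0|apply: ssumN; exact: ssum_1].
have [||c Ac] := key n (b - a) a hn; first exact: ca.
  by exists a => //; rewrite subrr; case: hW.
rewrite (_ : a + (b - a) - c = b - c) => [hbc|]; last by zmod.
apply: (hWD (b - c)); last by exists b, c.
by apply: (@ssum_le _ 1) => //; [case: hW|exact: ssum_1].
Qed.

Lemma coreE x : core x <-> exists S, is_connected S /\ S 0 /\ S x.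
Proof.
split=> [cx|[S [hS [S0 Sx]]] P hP]; last exact: conn_osg Sx.
by exists core; split; [exact: conn_core|split=> //; case: (sg_core op)].
Qed.

End CompactTopology.

(** * Characters of compact groups *)

Lemma sg_coprime (V : zmodType) (S : V -> Prop) (x : V) (m n : nat) :
  subgroup S -> coprime m n -> S (x *+ m) -> S (x *+ n) -> S x.
Proof.
move=> hS cmn hm hn.
have [m0|m0] := posnP m.
  by move: cmn hn; rewrite m0 /coprime gcd0n => /eqP ->.
case: (egcdnP n m0) => km kn e _.
have -> : x = (x *+ m) *+ km - (x *+ n) *+ kn.
  rewrite -!mulrnA (mulnC m) e (eqP cmn) mulrnDr (mulnC kn); zmod.
by apply: hS.2; exact: sgMn.
Qed.

Section Characters.
Variables (R : realType) (V : zmodType) (op : (V -> Prop) -> Prop).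
Hypothesis hV : compact_group op.
Let hT : top_group op := hV.
Local Notation open_nbhd0 := (open_nbhd0 op).
Local Notation is_closed := (is_closed op).
Local Notation core := (core op).

Definition circle_character (chi : V -> R) := circle_hom chi /\
  forall e, 0 < e -> exists2 U, open_nbhd0 U & forall u, U u ->
    exists k : int, `|chi u - k%:~R| < e.

Lemma int_congr (s t : R) : s - t \is a Num.int -> (s \is a Num.int) = (t \is a Num.int).
Proof. by move=> h; rewrite -[s](subrK t) rpredDl. Qed.

Lemma dist_int_gap (s e : R) : (forall k : int, e < `|s - k%:~R|) ->
  exists2 d, 0 < d & forall k : int, e + d <= `|s - k%:~R|.
Proof.
move=> h; pose f := Num.floor s.
have /andP [f1 f2] := floor_itv s; rewrite intrD in f2; rewrite -/f in f1 f2.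
have h1 := h f; have h2 := h (f + 1); rewrite intrD in h2.
rewrite ger0_norm in h1; last by lra.
rewrite ltr0_norm in h2; last by lra.
pose d := Num.min (s - f%:~R - e) (f%:~R + 1 - s - e).
exists d; first by rewrite lt_min; lra.
have d1 : d <= s - f%:~R - e by rewrite ge_min lexx.
have d2 : d <= f%:~R + 1 - s - e by rewrite ge_min lexx orbT.
move=> k; have [kf|kf] := leP k f.
  have : k%:~R <= f%:~R :> R by rewrite ler_int.
  move=> kf'; rewrite ger0_norm; lra.
have : (f + 1)%:~R <= k%:~R :> R by rewrite ler_int; lia.
rewrite intrD => kf'; rewrite ltr0_norm; lra.
Qed.

Section OneCharacter.
Variable chi : V -> R.
Hypothesis hchi : circle_hom chi.

Lemma circ0 : chi 0 \is a Num.int.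
Proof. by have := hchi 0 0; rewrite addr0 opprD addrA subrr sub0r rpredN. Qed.

Lemma circN a : chi (- a) + chi a \is a Num.int.
Proof. by have := hchi (- a) a; rewrite addNr rpredBl ?circ0. Qed.

Lemma circB a b : chi (a - b) - (chi a - chi b) \is a Num.int.
Proof.
rewrite (_ : _ - _ = chi (a - b) - (chi a + chi (- b)) + (chi (- b) + chi b)); last by ring.
by rewrite rpredD ?circN.
Qed.

Lemma circMn a n : chi (a *+ n) - chi a *+ n \is a Num.int.
Proof.
elim: n => [|n IH]; first by rewrite !mulr0n subr0 circ0.
rewrite (_ : _ - _ = chi (a *+ n.+1) - (chi a + chi (a *+ n)) + (chi (a *+ n) - chi a *+ n)).
  by rewrite rpredD // mulrS.
by rewrite [chi a *+ n.+1]mulrS; ring.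
Qed.

Lemma circMz a (n : int) : chi (a *~ n) - chi a *~ n \is a Num.int.
Proof.
case: n => i; first exact: circMn.
rewrite NegzE !mulrNz.
rewrite (_ : _ - _ = (chi (- (a *~ i.+1)) + chi (a *~ i.+1)) - (chi (a *+ i.+1) - chi a *+ i.+1)).
  by rewrite rpredB ?circMn ?circN.
by rewrite -!pmulrn; ring.
Qed.

Lemma sg_circ : subgroup (fun x => chi x \is a Num.int).
Proof.
split; first exact: circ0.
move=> a b ha hb; have := circB a b; rewrite rpredBr //; by rewrite rpredB.
Qed.

Hypothesis cchi : circle_character chi.

Lemma cl_near_int e : is_closed (fun x => exists k : int, `|chi x - k%:~R| <= e).
Proof.
apply: op_local hV _ _ => x nx.
have [k|d d0 hd] := @dist_int_gap (chi x) e.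
  by rewrite ltNge; apply/negP => hk; apply: nx; exists k.
have [U [hU U0] hUd] := cchi.2 d d0.
exists (fun y => U (x - y)); split; [exact: (op_reflect hV x hU)|by rewrite subrr|].
move=> y /hUd [k hk] [k' hk'].
have /intrP [k2 hk2] := circB x y.
have := hd (k + k' - k2); rewrite leNgt; case/negP.
rewrite (_ : chi x - _ = (chi (x - y) - k%:~R) + (chi y - k'%:~R)); last first.
  by rewrite intrB intrD -hk2; ring.
by rewrite addrC; apply: le_lt_trans (ler_normD _ _) _; exact: ler_ltD.
Qed.

Lemma op_near_int e : op (fun x => exists k : int, `|chi x - k%:~R| < e).
Proof.
apply: op_local hV _ _ => x [k0 hx].
have d0 : 0 < e - `|chi x - k0%:~R| by rewrite subr_gt0.
have [U [hU U0] hUd] := cchi.2 _ d0.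
exists (fun y => U (y - x)); split; [exact: (op_transl hV (- x) hU)|by rewrite subrr|].
move=> y /hUd [k hk].
have /intrP [k2 hk2] := circB y x; exists (k + k0 - k2).
rewrite (_ : chi y - _ = (chi (y - x) - k%:~R) + (chi x - k0%:~R)); last first.
  by rewrite intrB intrD -hk2; ring.
by apply: le_lt_trans (ler_normD _ _) _; lra.
Qed.

Lemma csg_circ : closed_subgroup op (fun x => chi x \is a Num.int).
Proof.
split; first exact: sg_circ.
apply: (cl_ext _ (cl_near_int 0)) => x; split=> [[k]|/intrP [k ->]]; last first.
  by exists k; rewrite subrr normr0.
by rewrite normr_le0 subr_eq0 => /eqP ->; rewrite intr_int.
Qed.
End OneCharacter.

(** Taking the sets [U + S] as neighbourhoods amounts to working in the quotient by [S]. Since [S]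
    lies in all of them, [theta] is within 3/10 of integers at every multiple of an [s] in [S],
    hence integral on [S]. *)
Lemma closed_char S x : closed_subgroup op S -> ~ S x ->
  exists2 chi, circle_character chi & (forall s, S s -> chi s \is a Num.int) /\
    chi x \isn't a Num.int.
Proof.
move=> [sS cS] nx.
pose N W := exists2 U, open_nbhd0 U & forall u s, U u -> S s -> W (u + s).
have hN : precompact_base N.
  split.
  - by move=> W [U [_ U0]] /(_ 0 0); rewrite addr0; apply=> //; case: sS.
  - move=> W [U hU hUW]; have [A hA hAU] := nb0_half hV hU.
    exists (fun x => exists a s, [/\ A a, S s & x = a + s]).
      by exists A => // a s Aa Ss; exists a, s.
    move=> _ _ [a [s [Aa Ss ->]]] [b [t [Ab St ->]]].
    rewrite (_ : _ - _ = (a - b) + (s - t)); last by zmod.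
    by apply: hUW; [exact: hAU|exact: sS.2].
  move=> W [U hU hUW]; have [ts hts] := finite_cover hV hU.
  exists ts => v; have [t tts ht] := hts v; exists t => //.
  by rewrite -[_ - _]addr0; apply: hUW => //; case: sS.
have hW0 : N (fun y => y <> x).
  exists (fun u => ~ S (x - u)).
    by split; [exact: (op_reflect hV x cS)|rewrite subr0].
  move=> u s nu Ss e; apply: nu; by rewrite -e addrC addKr.
have [|theta [h1 [W [U hU hUW] hW] h3]] := @precompact_character R V N _ x hN hW0;
  first by move=> /(_ erefl).
have cont : circle_character theta.
  split=> // e e0; have [n hn] := expn2_arch e0.
  have [A hA hAU] := nb0_ssum hV (2 ^ n) hU.
  exists A => // a Aa.
  have [j jn|k hk] := @near_int_doubling R (theta a) n.
    have Uaj : U (a *+ j).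
      by apply: hAU; apply: ssum_le jn _; [case: hA|apply: ssum_mulrn => //; case: hA].
    have [k hk] := hW _ (hUW _ 0 Uaj sS.1); rewrite addr0 in hk.
    have /intrP [k' hk'] := circMn h1 a j; exists (k - k').
    by rewrite mulr_natr intrB -hk' (_ : _ - _ = theta (a *+ j) - k%:~R) //; ring.
  exists k; have p0 : 0 < (2 ^ n)%:R :> R by rewrite ltr0n expn_gt0.
  by rewrite -(ltr_pM2r p0); apply: le_lt_trans hk _; lra.
exists theta => //; split=> // s Ss; apply/intrP.
apply: near_int_multiples => j.
have Ssj : S (s *+ j) by exact: sgMn.
have [k hk] := hW _ (hUW 0 _ hU.2 Ssj); rewrite add0r in hk.
have /intrP [k' hk'] := circMn h1 s j; exists (k - k').
by rewrite mulr_natr intrB -hk' (_ : _ - _ = theta (s *+ j) - k%:~R) //; ring.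
Qed.

(** A point [c] outside the closed subgroup of p-multiples is detected by a character that is
    integral on that subgroup. On the core its values modulo 1 are then multiples of 1/p, and
    connectedness leaves only the value 0. *)
Lemma core_divisible p c : prime p -> core c -> exists2 c', core c' & c = c' *+ p.
Proof.
move=> pp hc; apply: contrapT => nc.
have p0 : 0 < p%:R :> R by rewrite ltr0n prime_gt0.
have hS : closed_subgroup op (fun x => exists2 a, core a & x = a *+ p).
  split; last by apply: cl_mulrn_image; [exact: hV|exact: cl_core].
  split; first by exists 0; rewrite ?mul0rn //; case: (sg_core op).
  move=> _ _ [a ha ->] [b hb ->]; exists (a - b); first exact: (sg_core op).2.
  by rewrite mulrnBl.
have [chi [hchi cchi] [h1 h2]] := closed_char hS nc.
have pint x : core x -> chi x *+ p \is a Num.int.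
  by move=> hx; have := circMn hchi x p; rewrite rpredBl // h1 //; exists x.
(* With [2 * e] below the gap 1/p, the two open sets used below overlap only at distances between
   [e] and [2 * e] from the integers, where no value of [chi] on the core lies. *)
pose e : R := (4 * p%:R)^-1.
have e0 : 0 < e by rewrite invr_gt0 mulr_gt0.
have ep : e * p%:R = 4^-1 by rewrite /e; field; rewrite gt_eqF.
have far x : core x -> (exists k : int, `|chi x - k%:~R| < 2 * e) -> chi x \is a Num.int.
  move=> /pint /intrP [m hm] [k hk].
  have h3 : `|m%:~R - (k * p)%:~R| < 1 :> R.
    rewrite -hm intrM -pmulrn -mulr_natr -mulrBl normrM normr_nat.
    have : `|chi x - k%:~R| * p%:R < 2 * e * p%:R by rewrite ltr_pM2r.
    by rewrite -mulrA ep; lra.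
  have {h3} : m = k * p.
    have : (`|m - k * p| < 1)%R by rewrite -(ltr_int R) intr_norm intrB.
    lia.
  move=> e1; move: hm; rewrite e1 intrM -pmulrn -mulr_natr => /(mulIf (lt0r_neq0 p0)) ->.
  exact: intr_int.
have [|||||y [hy [hy1 hy2]]] := @conn_core V op hV (fun x =>
  exists k : int, `|chi x - k%:~R| < 2 * e)
   (fun x => ~ exists k : int, `|chi x - k%:~R| <= e).
- exact: op_near_int.
- exact: cl_near_int.
- move=> x _; have [[k hk]|] := EM (exists k : int, `|chi x - k%:~R| <= e); last by right.
  by left; exists k; lra.
- exists 0; split; first by case: (sg_core op).
  have /intrP [k ->] := circ0 hchi; exists k; rewrite subrr normr0; lra.
- exists c; split=> // -[k hk]; case/negP: h2; apply: far => //.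
  by exists k; lra.
apply: hy2; have /intrP [k ->] := far _ hy hy1; exists k; rewrite subrr normr0; lra.
Qed.
End Characters.

(** * Locally essential connected components *)

Section LocallyEssentialCore.
Variables (R : realType) (V : zmodType) (op : (V -> Prop) -> Prop).
Hypothesis hV : compact_group op.
Let hT : top_group op := hV.
Local Notation open_nbhd0 := (open_nbhd0 op).
Local Notation is_closed := (is_closed op).
Local Notation core := (core op).
Local Notation closed_subgroup := (closed_subgroup op).
Local Notation open_subgroup := (open_subgroup op).

Lemma clU A B : is_closed A -> is_closed B -> is_closed (fun x => A x \/ B x).
Proof.
move=> hA hB; apply: op_ext (tg_inter hV hA hB) => x.
by split=> [[nA nB] [|]|h]; rewrite ?nA //; split=> ?; apply: h; [left|right].
Qed.

Lemma cl_bounded_ex (F : nat -> V -> Prop) n : (forall j, is_closed (F j)) ->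
  is_closed (fun x => exists2 j, (j < n)%N & F j x).
Proof.
move=> hF; elim: n => [|n IH].
  by apply: op_ext (tg_full hV) => x; split=> // _ [].
apply: cl_ext (clU IH (hF n)) => x; split=> [[[j jn hj]|hn]|[j]].
- by exists j => //; exact: ltnW.
- by exists n.
by rewrite ltnS leq_eqVlt => /orP [/eqP ->|jn] hj; [right|left; exists j].
Qed.

Lemma cl_point a : is_closed (fun x => x = a).
Proof.
apply: cl_ext (cl_transl hV (- a) (cl_sub0 hV)) => x.
by split=> [/eqP|->]; rewrite ?subrr // subr_eq0 => /eqP.
Qed.

(** Convergence of [x *+ p ^ n] to 0 modulo the core, tested on open subgroups. *)
Definition topologically_torsion (p : nat) (x : V) :=
  forall P, open_subgroup P -> exists n, P (x *+ p ^ n).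

Lemma topologically_torsion_mulrn p x n : topologically_torsion p x ->
  topologically_torsion p (x *+ n).
Proof.
move=> h P hP; have [m hm] := h P hP; exists m.
by rewrite -mulrnA mulnC mulrnA; apply: sgMn => //; case: hP.
Qed.

(* Modulo each open subgroup, [y] is the p-part of [x]; compactness glues these parts. *)
Lemma exists_topologically_torsion p x P : prime p -> open_subgroup P -> ~ P x -> P (x *+ p) ->
  exists y, [/\ topologically_torsion p y, P (x - y) & forall O, open_subgroup O -> O x -> O y].
Proof.
move=> pp hP nPx Ppx.
pose A (Q : V -> Prop) y := [/\ P (x - y), forall O, open_subgroup O -> O x ->
  O y & exists n, Q (y *+ p ^ n)].
have [|||y hy] := @fip V op hV _ open_subgroup A _ (osgT hV).
- move=> Q hQ.
  have hS : open_subgroup (fun y => exists n, Q (y *+ p ^ n)).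
    apply: (@sg_osg V op hV _ Q); [|exact: osg_nb0|by move=> u; exists 0%N].
    split; first by exists 0%N; rewrite mul0rn; case: hQ => -[].
    move=> a b [n hn] [m hm]; exists (n + m)%N; rewrite mulrnBl.
    apply: hQ.1.2; first by rewrite expnD mulrnA; apply: sgMn => //; case: hQ.
    by rewrite addnC expnD mulrnA; apply: sgMn => //; case: hQ.
  apply: cl_ext (clI hV (cl_reflect hV x (osg_cl hV hP)) (clI hV (cl_forall hV (F :=
    fun O y => open_subgroup O -> O x -> O y) _) (osg_cl hV hS))).
    by move=> y; split=> [[h1 [h2 h3]]|[h1 h2 h3]]; split.
  by move=> O; apply: cl_imp => // hO; apply: cl_imp => // _; exact: osg_cl.
- move=> Q Q' hQ hQ'; exists (fun y => Q y /\ Q' y); split; first exact: osgI.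
    by move=> y [h1 h2 [n [h3 h4]]]; split=> //; exists n.
  by move=> y [h1 h2 [n [h3 h4]]]; split=> //; exists n.
- move=> Q hQ; have [e e0 he] := osg_exponent hV hQ.
  have [e' cpe ee] := pfactor_coprime pp e0; set s := logn p e in ee.
  have [u hu] : exists u, (u * e' = 1 %[mod p])%N.
    have e'0 : (0 < e')%N by move: e0; rewrite ee muln_gt0 => /andP [].
    have cp : coprime e' p by rewrite coprime_sym.
    case: (egcdnP p e'0) => u v e1 _; exists u.
    by rewrite e1 (eqP cp) modnMDl.
  (* The factor [e'] kills the prime-to-p part modulo [Q]. As [u * e'] is 1 modulo [p] and [x *+ p]
     is in [P], the point stays congruent to [x] modulo [P]. *)
  exists (x *+ (u * e')); split.
  - have p1 := prime_gt1 pp; rewrite (modn_small p1) in hu.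
    rewrite (divn_eq (u * e') p) hu mulrnDr mulr1n.
    rewrite (_ : _ - _ = - (x *+ p *+ (u * e' %/ p))); last by rewrite -mulrnA mulnC; zmod.
    by apply: sgN; [case: hP|apply: sgMn => //; case: hP].
  - by move=> O hO Ox; apply: sgMn => //; case: hO.
  - exists s; rewrite -mulrnA -mulnA -ee mulnC mulrnA; apply: sgMn => //; by case: hQ.
exists y; split.
- by move=> Q hQ; have [_ _] := hy Q hQ.
- by have [] := hy _ (osgT hV).
- by have [] := hy _ (osgT hV).
Qed.

Hypothesis essential : exists2 V0, open_nbhd0 V0 & forall H, closed_subgroup H ->
  (forall x, H x -> V0 x) ->
  (exists x, H x /\ x <> 0) -> exists x, [/\ H x, core x & x <> 0].

(** The cyclic group generated by [x] has at most [p] elements and stays in [V0]. It meets the core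
    in some [x *+ j] with [j] prime to [p], which gives [x] back. *)
Lemma small_torsion_core p : prime p ->
  exists2 W, open_nbhd0 W & forall x, W x -> x *+ p = 0 -> core x.
Proof.
move=> pp; have [V0 hV0 hess] := essential.
have [W hW hWV] := nb0_ssum hV p hV0; exists W => // x Wx px.
have p0 := prime_gt0 pp.
have mulE n : x *+ n = x *+ (n %% p)
  by rewrite {1}(divn_eq n p) mulnC mulrnDr mulrnA px mul0rn add0r.
pose H y := exists2 j, (j < p)%N & y = x *+ j.
have HE n : H (x *+ n) by exists (n %% p)%N; rewrite ?ltn_pmod // -mulE.
have [->|x0] := EM (x = 0); first by case: (sg_core op).
have [|||y [[j jp ->] cy y0]] := hess H.
- split; last by apply: cl_bounded_ex => j; exact: cl_point.
  split; first by have := HE 0%N; rewrite mulr0n.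
  move=> _ _ [i _ ->] [j jp ->].
  rewrite (_ : _ - _ = x *+ (i + (p - j))); first exact: HE.
  by rewrite mulrnDr mulrnBr 1?ltnW // px sub0r.
- move=> _ [j jp ->]; apply: hWV; have W0 := hW.2.
  by apply: ssum_le (ltnW jp) _ => //; exact: ssum_mulrn.
- by exists x; split=> //; have := HE 1%N.
apply: (@sg_coprime _ core x j p (sg_core op)) => //; last by rewrite px; case: (sg_core op).
rewrite coprime_sym prime_coprime // gtnNdvd //.
by rewrite lt0n; apply/eqP => j0; apply: y0; rewrite j0.
Qed.

(** Divisibility of the core turns [x] into the true p-torsion element [x - c]. If that element is
    close to a p-torsion element [t] of the core, [small_torsion_core] applies to [x - c - t];
    compactness supplies an [O] for which it always is. *)
Lemma torsion_free_osg p : prime p ->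
  exists2 O, open_subgroup O & forall x, O x -> core (x *+ p) -> core x.
Proof.
move=> pp; have [W hW hWc] := small_torsion_core pp; have sc := sg_core op.
pose T x := x *+ p = 0 /\ core x.
pose TW x := exists t, T t /\ W (x - t).
have opTW : op TW.
  apply: op_local => // x [t [Tt ht]]; exists (fun y => W (y - t)); split=> //.
    by apply: (op_transl hV); case: hW.
  by move=> y hy; exists t.
apply: contrapT => h.
have [|||x hx] := @fip V op hV _ open_subgroup (fun O x =>
  [/\ O x, x *+ p = 0 & ~ TW x]) _ (osgT hV).
- move=> O hO; have := clI hV (osg_cl hV hO) (clI hV (cl_mulrn hV p (cl_sub0 hV)) (cl_op opTW)).
  by apply: cl_ext => x; split=> [[h1 [h2 h3]]|[h1 h2 h3]]; split.
- move=> Q Q' hQ hQ'; exists (fun y => Q y /\ Q' y); split; first exact: osgI.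
    by move=> y [[]].
  by move=> y [[]].
- move=> O hO; apply: contrapT => h2; apply: h; exists O => // x Ox cpx.
  have [c cc ec] := core_divisible R hV pp cpx.
  have pxc : (x - c) *+ p = 0 by rewrite mulrnBl ec subrr.
  apply/(sg_eqD (a := x) (b := c) sc) => //.
  apply: contrapT => nxc; apply: h2; exists (x - c); split=> //.
    by apply: hO.1.2 => //; exact: cc.
  move=> [t [[pt ct] Wt]]; apply: nxc; apply/(sg_eqD (b := t) sc) => //.
  by apply: hWc => //; rewrite mulrnBl pxc pt subrr.
have cx : core x by move=> P /hx [].
have [_ px nT] := hx _ (osgT hV); apply: nT; exists x; rewrite subrr; split=> //.
by case: hW.
Qed.

(** Zorn's lemma for reverse inclusion: by compactness the intersection of a chain still meets the
    coset of [x]. *)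
Lemma minimal_csg_meeting O x : closed_subgroup O -> O x ->
  exists H, [/\ closed_subgroup H, forall z, H z -> O z,
  exists2 y, H y & core (y - x) &
  forall H', closed_subgroup H' -> (forall y, H' y -> H y) -> (exists2 y, H' y & core (y - x)) ->
    forall y, H y -> H' y].
Proof.
move=> hO Ox.
pose Q H := [/\ closed_subgroup H, forall z, H z -> O z & exists2 y, H y & core (y - x)].
pose T := {H : V -> Prop | Q H}.
have QO : Q O by split=> //; exists x => //; rewrite subrr; case: (sg_core op).
pose le (s t : T) := `[< forall y, sval t y -> sval s y >].
have [||A tot|H hH] := @ZL_preorder T (exist _ O QO) le.
- by move=> s; apply/asboolP.
- by move=> r s t /asboolP h1 /asboolP h2; apply/asboolP => y hy; apply: h1; exact: h2.
- have [[s0 As0]|nA] := EM (exists s, A s); last first.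
    by exists (exist _ O QO) => s As; case: nA; exists s.
  pose I y := forall s, A s -> sval s y.
  have cI : closed_subgroup I.
    split; last by apply: cl_forall => // s; apply: cl_imp => // _; case: (svalP s) => -[].
    split=> [s _|a b ha hb s As]; first by case: (svalP s) => -[[]].
    by case: (svalP s) => -[[_ h] _] _ _; apply: h; [exact: ha|exact: hb].
  have [|||y hy] := @fip V op hV _ A (fun s y => sval s y /\ core (y - x)) s0 As0.
  - move=> s _; apply: clI => //; first by case: (svalP s) => -[].
    by apply: cl_transl => //; exact: cl_core.
  - move=> s t As At; have [/asboolP h|/asboolP h] := tot _ _ As At.
      by exists t; split=> // y [h1 h2]; split=> //; exact: h.
    by exists s; split=> // y [h1 h2]; split=> //; exact: h.
  - by move=> s _; case: (svalP s) => _ _ [y h1 h2]; exists y.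
  have QI : Q I.
    split=> //; first by move=> z /(_ s0 As0); case: (svalP s0) => _ h _ /h.
    by exists y; [move=> s /hy []|case: (hy s0 As0)].
  by exists (exist _ I QI) => s As; apply/asboolP => z; exact.
case: H hH => H [h1 h2 h3] hH; exists H; split=> // H' c' sub m'.
have Q' : Q H' by split=> // z /sub /h2.
have := hH (exist _ H' Q'); rewrite /le /= => h; apply/asboolP; apply: h.
by apply/asboolP.
Qed.

Lemma csg_mulrn H n : closed_subgroup H -> closed_subgroup (fun x => exists2 h, H h & x = h *+ n).
Proof.
move=> [[h0 hB] hc]; split; last exact: cl_mulrn_image.
split; first by exists 0; rewrite ?mul0rn.
by move=> _ _ [a ha ->] [b hb ->]; exists (a - b); [exact: hB|rewrite mulrnBl].
Qed.

Lemma csgI H H' : closed_subgroup H -> closed_subgroup H' -> closed_subgroup (fun x =>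
  H x /\ H' x).
Proof.
move=> [[h0 hB] hc] [[h0' hB'] hc']; split; last exact: clI.
by split=> // a b [ha ha'] [hb hb']; split; [exact: hB|exact: hB'].
Qed.

Lemma csg_zero : closed_subgroup (fun x => x = 0).
Proof. by split; [split=> // a b -> ->; rewrite subrr|exact: cl_sub0]. Qed.

Lemma csg_osg P : open_subgroup P -> closed_subgroup P.
Proof. by move=> hP; split; [case: hP|exact: osg_cl]. Qed.

(* If no value of [chi] on [M] were close to but different from an integer, all
   these values would be killed by a fixed factorial, against divisibility. *)
Lemma divisible_char_dense (M : V -> Prop) (chi : V -> R) m x e :
  subgroup M -> (forall n y, (0 < n)%N -> M y -> exists2 z, M z & y = z *+ n) ->
  circle_character op chi -> M m -> chi m \isn't a Num.int -> 0 < e ->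
  exists2 k, M k & exists j : int, `|chi (x - k) - j%:~R| < e.
Proof.
move=> sM dM [hchi cchi] Mm nm e0.
have [k0 [j0 [Mk0 s0 se]]] : exists k0, exists j0 : int, [/\ M k0, 0 < `|chi k0 - j0%:~R|
  & `|chi k0 - j0%:~R| < e].
  apply: contrapT => h.
  have [U hU hUe] := cchi e e0.
  have [N N0 hN] := uniform_recurrence hV hU.
  have [z Mz mz] := dM _ m (fact_gt0 N) Mm.
  case/negP: nm; rewrite mz.
  have [i [i0 iN /hUe [j hj]]] := hN z.
  have zi : chi (z *+ i) \is a Num.int.
    have [d0|d0] := eqVneq (chi (z *+ i)) j%:~R; first by rewrite d0 intr_int.
    case: h; exists (z *+ i), j; split=> //; first exact: sgMn.
    by rewrite normr_gt0 subr_eq0.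
  have /dvdnP [q ->] : (i %| N`!)%N by apply: dvdn_fact; rewrite i0.
  by rewrite mulnC mulrnA (sgMn _ (sg_circ hchi)).
set s := chi k0 - _ in s0 se.
have s1 : s != 0 by rewrite -normr_gt0.
pose n := Num.floor (chi x / s).
exists (k0 *~ n); first exact: sgMz.
have kn := circMz hchi k0 n.
have /intrP [a ha] := kn.
have /intrP [b hb] := circB hchi x (k0 *~ n).
exists (b - a - j0 * n).
have -> : chi (x - k0 *~ n) - (b - a - j0 * n)%:~R = chi x - s * n%:~R.
  have -> : chi (x - k0 *~ n) = b%:~R + (chi x - chi (k0 *~ n)) by rewrite -hb; ring.
  have -> : chi (k0 *~ n) = a%:~R + chi k0 * n%:~R by rewrite -ha mulrzr; ring.
  by rewrite !intrB intrM /s; ring.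
apply: lt_trans se.
have /andP [f1 f2] := floor_itv (chi x / s); rewrite -/n in f1 f2.
rewrite intrD in f2.
have -> : chi x - s * n%:~R = s * (chi x / s - n%:~R) by field.
rewrite normrM -[ltRHS]mulr1 ltr_pM2l // ger0_norm; lra.
Qed.

(** An element of exact order [p ^ n.+1] in R/Z generates all the elements killed by [p ^ n.+1]: its
    numerator is prime to [p] and can be inverted. *)
Lemma prime_power_int_gen p n (s t : R) : prime p -> s *+ p ^ n.+1 \is a Num.int ->
  t *+ p ^ n.+1 \is a Num.int -> s *+ p ^ n \isn't a Num.int ->
  exists k : int, t - s *~ k \is a Num.int.
Proof.
move=> pp /intrP [a ha] /intrP [b hb] ns.
have pn0 : (p ^ n.+1)%:R != 0 :> R by rewrite pnatr_eq0 expn_eq0 negb_and -lt0n prime_gt0.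
have p0 : p%:R != 0 :> R by rewrite pnatr_eq0 -lt0n prime_gt0.
have cop : coprimez a (p ^ n.+1)%N.
  rewrite coprimezE /= coprime_sym coprimeXl // prime_coprime //.
  apply: contra ns => pa; have /dvdzP [c hc] : (p %| a)%Z by [].
  apply/intrP; exists c; apply: (mulIf p0).
  by rewrite mulr_natr -mulrnA -expnSr ha hc intrM -pmulrn mulr_natr.
have [u [v huv]] := Bezoutz a (p ^ n.+1)%N.
exists (u * b); apply/intrP; exists (v * b); apply: (mulIf pn0).
have -> : (t - s *~ (u * b)) * (p ^ n.+1)%:R = b%:~R - a%:~R * (u * b)%:~R.
  by rewrite mulrBl mulr_natr hb -ha -mulrzr -mulr_natr; ring.
move: huv; rewrite (eqP cop) => /(congr1 (fun z : int => z%:~R : R)).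
rewrite !intrD !intrM -pmulrn => huv.
transitivity (b%:~R * (u%:~R * a%:~R + v%:~R * (p ^ n.+1)%:R) - a%:~R * (u * b)%:~R : R).
  by rewrite huv mulr1 intrM.
by rewrite !intrM; ring.
Qed.

(* A topologically p-torsion [x] outside the core lies, modulo the core, in a
   closed subgroup [H] minimal among those meeting [x + core]. Characters and
   minimality show that [M = H :&: core] is divisible, and then that it is trivial,
   so that [H] is a copy of the p-adic integers avoiding the core; but the small
   subgroup [p ^ n H] must meet the core. *)
Lemma topologically_torsion_free p : prime p -> exists2 O, open_subgroup O & forall x, O x ->
  topologically_torsion p x -> core x.
Proof.
move=> pp; have [O hO TF] := torsion_free_osg pp; exists O => // x Ox tx.
apply: contrapT => ncx; have sc := sg_core op.
have [H [cH HO [x0 Hx0 cx0] minH]] := minimal_csg_meeting (csg_osg hO) Ox.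
have sH : subgroup H by case: cH.
have nc0 : ~ core x0 by move=> h; apply: ncx; apply/(sg_eqD sc cx0).
(* Minimality makes the exponent uniform: the elements of [H] sent into [P] by [p ^ n] form a closed
   subgroup that still meets the coset. *)
have topH P : open_subgroup P -> exists n, forall h, H h -> P (h *+ p ^ n).
  move=> hP; have [n hn] := tx P hP; exists n => h Hh.
  have hPn : P (x0 *+ p ^ n).
    rewrite -(subrK x x0) mulrnDl; apply: sgD; [by case: hP| |exact: hn].
    by apply: sgMn; [case: hP|exact: cx0].
  have cB : closed_subgroup (fun h => H h /\ P (h *+ p ^ n)).
    apply: csgI => //; split; last by apply: (cl_mulrn hV); exact: osg_cl.
    split; first by rewrite mul0rn; case: hP => -[].
    by move=> a b ha hb; rewrite mulrnBl; apply: hP.1.2.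
  have [_ //] := minH _ cB (fun y h => proj1 h) (ex_intro2 _ _ x0 (conj Hx0 hPn) cx0) h Hh.
have ptf h n : H h -> core (h *+ p ^ n) -> core h.
  elim: n => [|n IH] Hh; first by rewrite expn0.
  rewrite expnSr mulrnA => c1; apply: IH => //; apply: TF => //.
  by apply: HO; exact: sgMn.
have qdiv q h : coprime q p -> H h -> core (h *+ q) -> core h.
  move=> cqp Hh ch P hP; have [n hn] := topH P hP.
  apply: (@sg_coprime _ P h q (p ^ n)); [by case: hP|by rewrite coprimeXr|exact: ch|exact: hn].
(* Modulo each open subgroup [H] is killed by a power of [p], so [q] acts invertibly there; by
   compactness the q-multiples of [H] meet the coset, and minimality applies. *)
have Hq q : prime q -> coprime q p -> forall y, H y -> exists2 h, H h & y = h *+ q.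
  move=> pq cqp; have cH' := csg_mulrn q cH.
  apply: minH => //; first by move=> _ [h Hh ->]; exact: sgMn.
  have [|||y hy] := @fip V op hV _ open_subgroup (fun P y =>
    (exists2 h, H h & x0 - y = h *+ q) /\ P y) _ (osgT hV).
  - move=> P hP; apply: clI => //; last exact: osg_cl.
    exact: (cl_reflect hV x0 (proj2 cH')).
  - move=> Q Q' hQ hQ'; exists (fun y => Q y /\ Q' y); split; first exact: osgI.
      by move=> y [? []].
    by move=> y [? []].
  - move=> P hP; have [n hn] := topH P hP.
    case: (egcdnP (p ^ n) (prime_gt0 pq)) => u v e _.
    have cop : gcdn q (p ^ n) = 1%N by apply/eqP; exact: coprimeXr.
    exists (x0 - x0 *+ u *+ q); split.
      by exists (x0 *+ u); [exact: sgMn|zmod].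
    have -> : x0 - x0 *+ u *+ q = - (x0 *+ p ^ n *+ v).
      by rewrite -!mulrnA e cop (mulnC v) mulrnDr; zmod.
    by apply: sgN; [case: hP|apply: sgMn; [case: hP|exact: hn]].
  have [[h Hh eh] _] := hy _ (osgT hV).
  exists (x0 - y); first by exists h.
  rewrite (_ : x0 - y - x = (x0 - x) - y); last by zmod.
  by apply: sc.2 => // P hP; case: (hy P hP).
(* The kernel of [chi] in [H] contains [x0 - k], a point of the same coset, so by minimality it is
   all of [H]. *)
have key (chi : V -> R) k m : circle_character op chi -> H k -> core k -> H m ->
    chi (x0 - k) \is a Num.int -> chi m \is a Num.int.
  move=> cchi Hk ck Hm ik.
  have cB : closed_subgroup (fun h => H h /\ chi h \is a Num.int) by apply: csgI => //;
    exact: csg_circ cchi.1 cchi.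
  apply: (proj2 (minH _ cB (fun y h => proj1 h) _ m Hm)).
  exists (x0 - k); first by split=> //; exact: sH.2.
  rewrite (_ : x0 - k - x = (x0 - x) - k); last by zmod.
  exact: sc.2.
(* A character detecting [m] modulo p-multiples has values of order dividing [p] on [H]. So [chi x0]
   is a multiple of [chi m], and subtracting this multiple of [m] from [x0] contradicts [key]. *)
have Mp m : H m -> core m -> exists2 h, H h & m = h *+ p.
  move=> Hm cm; apply: contrapT => nm.
  have [chi cchi [h1 h2]] := closed_char R hV (csg_mulrn p cH) nm.
  have pint h : H h -> chi h *+ p \is a Num.int.
    by move=> Hh; have := circMn cchi.1 h p; rewrite rpredBl // h1 //; exists h.
  have [k hk] := @prime_power_int_gen p 0 (chi m) (chi x0) pp (pint m Hm) (pint x0 Hx0) h2.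
  case/negP: h2; apply: (key chi (m *~ k) m cchi (sgMz k sH Hm) (sgMz k sc cm) Hm).
  rewrite (int_congr (t := chi x0 - chi m *~ k)) //.
  rewrite (_ : _ - _ = (chi (x0 - m *~ k) - (chi x0 - chi (m *~ k))) - (chi (m *~ k) - chi m
    *~ k)).
    by rewrite rpredB ?circB ?circMz //; case: cchi.
  by ring.
have Mdiv n m : (0 < n)%N -> H m /\ core m -> exists2 z, H z /\ core z & m = z *+ n.
  elim/ltn_ind: n m => n IH m n0 [Hm cm].
  have [n1|n1] := leqP n 1.
    by exists m => //; rewrite (_ : n = 1%N) //; apply/eqP; rewrite eqn_leq n1.
  have pq := pdiv_prime n1; set q := pdiv n in pq.
  have [z [Hz cz] mz] : exists2 z, H z /\ core z & m = z *+ q.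
    have [qp|qp] := eqVneq q p.
      have [z Hz mz] := Mp m Hm cm; exists z; rewrite ?qp //; split=> //.
      by apply: (ptf z 1%N) => //; rewrite expn1 -mz.
    have cqp : coprime q p by rewrite prime_coprime // dvdn_prime2.
    have [z Hz mz] := Hq q pq cqp m Hm; exists z => //; split=> //.
    by apply: (qdiv q) => //; rewrite -mz.
  have /dvdnP [r rq] := pdiv_dvd n; rewrite -/q in rq.
  have r0 : (0 < r)%N by move: n0; rewrite rq muln_gt0 => /andP [].
  have rn : (r < n)%N by rewrite rq ltn_Pmulr // prime_gt1.
  have [w hw zw] := IH r rn z r0 (conj Hz cz).
  by exists w => //; rewrite mz zw -mulrnA -rq.
have sM : subgroup (fun y => H y /\ core y).
  by split=> [|a b [Ha ca] [Hb cb]]; [split; [exact: sH.1|exact: sc.1]|split;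
    [exact: sH.2|exact: sc.2]].
(* A character nontrivial on the divisible group [M] has dense image there. Compactness then yields
   a [k] in [M] with [chi (x0 - k)] integral, and [key] makes [chi m] integral. *)
have M0 m : H m -> core m -> m = 0.
  move=> Hm cm; apply: contrapT => nm.
  have [chi cchi [_ h2]] := closed_char R hV csg_zero nm.
  have dense := fun e => @divisible_char_dense _ chi m x0 e sM Mdiv cchi (conj Hm cm) h2.
  have [|||k hk] := @fip V op hV nat (fun _ => True) (fun n k => (H k /\ core k) /\
      exists j : int, `|chi (x0 - k) - j%:~R| <= n.+1%:R^-1) 0%N Logic.I.
  - move=> n _; apply: clI => //.
      by apply: clI => //; [case: cH|exact: cl_core].
    exact: (cl_reflect hV x0 (cl_near_int hV cchi.1 cchi n.+1%:R^-1)).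
  - have mono i j k : (i <= j)%N -> (H k /\ core k) /\
    (exists l : int, `|chi (x0 - k) - l%:~R| <= j.+1%:R^-1) ->
      (H k /\ core k) /\ exists l : int, `|chi (x0 - k) - l%:~R| <= i.+1%:R^-1.
      move=> ij [hk [l hl]]; split=> //; exists l; apply: le_trans hl _.
      by rewrite lef_pV2 ?posrE ?ltr0n // ler_nat.
    move=> i j _ _; exists (maxn i j); split=> // k; apply: mono;
      [exact: leq_maxl|exact: leq_maxr].
  - move=> n _; have e0 : 0 < n.+1%:R^-1 :> R by rewrite invr_gt0 ltr0n.
    have [k hk [j hj]] := dense _ e0.
    by exists k; split=> //; exists j; exact: ltW.
  have [Hk ck] := (hk 0%N Logic.I).1.
  case/negP: h2; apply: (key chi k) => //.
  apply: contraT => nint; exfalso.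
  have [j|d d0 hd] := @dist_int_gap R (chi (x0 - k)) 0.
    rewrite normr_gt0 subr_eq0; apply: contra nint => /eqP ->; exact: intr_int.
  pose n := Num.bound d^-1.
  have [j hj] := (hk n Logic.I).2.
  have := hd j; rewrite add0r leNgt; case/negP; apply: le_lt_trans hj _.
  rewrite invf_plt ?posrE // ?ltr0n //.
  apply: lt_trans (archi_boundP _) _; first by rewrite invr_ge0 ltW.
  by rewrite ltr_nat.
have [V0 hV0 hess] := essential.
have cHp n := csg_mulrn (p ^ n) cH.
(* A point lying in all the groups [p ^ n H] belongs to [H] and to the core, hence is 0; by
   compactness these groups shrink into [V0]. *)
have [n hn] : exists n, forall y, (exists2 h, H h & y = h *+ p ^ n) -> V0 y.
  apply: contrapT => h.
  have [|||y hy] := @fip V op hV nat (fun _ => True) (fun n y =>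
    (exists2 h, H h & y = h *+ p ^ n) /\ ~ V0 y) 0%N Logic.I.
  - by move=> n _; apply: clI => //; [case: (cHp n)|apply: cl_op => //; case: hV0].
  - have mono i j y : (i <= j)%N -> (exists2 h, H h & y = h *+ p ^ j) /\ ~ V0 y ->
      (exists2 h, H h & y = h *+ p ^ i) /\ ~ V0 y.
      move=> ij [[h1 Hh1 ->] nV]; split=> //; exists (h1 *+ p ^ (j - i)); first exact: sgMn.
      by rewrite -mulrnA -expnD subnK.
    move=> i j _ _; exists (maxn i j); split=> // k; apply: mono;
      [exact: leq_maxl|exact: leq_maxr].
  - move=> n _; apply: contrapT => h2; apply: h; exists n => y hy.
    by apply: contrapT => nV; apply: h2; exists y.
  have [[h1 Hh1 e1] nV] := hy 0%N Logic.I; rewrite expn0 mulr1n in e1.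
  apply: nV; rewrite (M0 y); [by case: hV0|by rewrite e1|].
  by move=> P hP; have [n hn] := topH P hP; have [[h2 Hh2 ->] _] := hy n Logic.I; exact: hn.
have [|y [[h1 Hh1 e1] cy y0]] := hess _ (cHp n) hn.
  exists (x0 *+ p ^ n); split; first by exists x0.
  by move=> e; apply: nc0; apply: (ptf _ n) => //; rewrite e; exact: sc.1.
by apply: y0; apply: M0 => //; rewrite e1; exact: sgMn.
Qed.

End LocallyEssentialCore.

Lemma exists_prime_step (V : zmodType) (P : V -> Prop) (x : V) (e : nat) :
  (0 < e)%N -> P (x *+ e) -> ~ P x ->
  exists q j, [/\ prime q, ~ P (x *+ j) & P (x *+ j *+ q)].
Proof.
elim/ltn_ind: e => e IH e0 Pe nP.
have e1 : (1 < e)%N by case: e e0 Pe {IH} => [|[|]] // _; rewrite mulr1n => /nP.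
have pq := pdiv_prime e1; have /dvdnP [r er] := pdiv_dvd e.
have r0 : (0 < r)%N by move: e0; rewrite er muln_gt0 => /andP [].
have [Pr|nPr] := EM (P (x *+ r)).
  by apply: (IH r) => //; rewrite [X in (_ < X)%N]er ltn_Pmulr // prime_gt1.
by exists (pdiv e), r; split=> //; rewrite -mulrnA -er.
Qed.

(** * Torsion primes modulo the core, and the dense subgroup *)

Section InfinitelyManyPrimes.
Variables (R : realType) (V : zmodType) (op : (V -> Prop) -> Prop).
Hypothesis hV : compact_group op.
Let hT : top_group op := hV.
Local Notation open_nbhd0 := (open_nbhd0 op).
Local Notation is_closed := (is_closed op).
Local Notation core := (core op).
Local Notation closed_subgroup := (closed_subgroup op).
Local Notation open_subgroup := (open_subgroup op).

Definition core_torsion_prime p := prime p /\ exists z, ~ core z /\ core (z *+ p).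
Local Notation I := core_torsion_prime.

Hypothesis essential : exists2 V0, open_nbhd0 V0 & forall H, closed_subgroup H ->
  (forall x, H x -> V0 x) ->
  (exists x, H x /\ x <> 0) -> exists x, [/\ H x, core x & x <> 0].
Hypothesis infinite_index : ~ exists l : seq V, forall x, exists2 y, y \in l & core (x - y).

Lemma topologically_torsion_free_below B : exists2 O, open_subgroup O &
  forall p x, prime p -> (p < B)%N -> O x -> topologically_torsion op p x -> core x.
Proof.
elim: B => [|B [O hO h]]; first by exists (fun _ => True); [exact: osgT|].
have [pB|npB] := boolP (prime B); last first.
  exists O => // p x pp; rewrite ltnS leq_eqVlt => /orP [/eqP pB|]; last exact: h.
  by rewrite -pB pp in npB.
have [O' hO' h'] := topologically_torsion_free R hV essential pB.
exists (fun x => O x /\ O' x); first exact: osgI.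
by move=> p x pp; rewrite ltnS leq_eqVlt => /orP [/eqP ->|pB'] [Ox O'x]; [exact: h'|exact: h].
Qed.

(** Being of finite index, [O] is not contained in the core. A point of [O] outside the core has a
    multiple of prime order [q] modulo some open subgroup; the q-part [y] of this multiple stays in
    [O] and outside the core, so [q < B] is excluded by the choice of [O]. *)
Lemma infinitely_many_primes B : exists p, (B <= p)%N /\ I p.
Proof.
have [O hO hOB] := topologically_torsion_free_below B; have sc := sg_core op.
have [x Ox ncx] : exists2 x, O x & ~ core x.
  apply: contrapT => h; apply: infinite_index.
  have [ts hts] := finite_cover hV (osg_nb0 hO); exists ts => x.
  have [t tts ht] := hts x; exists t => //; apply: contrapT => nc.
  by apply: h; exists (x - t).
have [P hP nPx] : exists2 P, open_subgroup P & ~ P x.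
  by apply: contrapT => h; apply: ncx => P hP; apply: contrapT => nP; apply: h; exists P.
have [e e0 he] := osg_exponent hV hP.
have [q [j [pq nPj Pjq]]] := exists_prime_step e0 (he x) nPx.
have [y [ty Pxy hy]] := exists_topologically_torsion hV pq hP nPj Pjq.
have Oy : O y by apply: hy => //; apply: sgMn => //; case: hO.
have ncy : ~ core y.
  by move=> cy; apply: nPj; apply/(sg_eqD (proj1 hP) Pxy); exact: cy.
exists q; split; first by rewrite leqNgt; apply/negP => qB; apply: ncy; exact: (hOB q).
split=> //.
(* Some [y *+ q ^ n] falls into [O'], hence into the core; the last such multiple outside the core
   has order [q] modulo it. *)
have [O' hO' h'] := topologically_torsion_free R hV essential pq.
have [n hn] := ty O' hO'.
have := h' _ hn (topologically_torsion_mulrn _ ty).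
elim: n {hn} => [|n IH]; first by rewrite expn0 mulr1n.
have [c|nc] := EM (core (y *+ q ^ n)); first by move=> _; exact: IH.
by rewrite expnSr mulrnA => c; exists (y *+ q ^ n).
Qed.

Lemma prime_power_generator (chi : V -> R) p n : circle_hom chi -> prime p ->
  (forall y, chi y *+ p ^ n \is a Num.int) ->
  exists g, forall y, exists k : int, chi (y - g *~ k) \is a Num.int.
Proof.
move=> hchi pp; elim: n => [|n IH] hn.
  by exists 0 => y; exists 0; rewrite subr0; have := hn y; rewrite mulr1n.
have [h|/existsNP [g /negP hg]] := EM (forall y, chi y *+ p ^ n \is a Num.int); first exact: IH.
exists g => y; have [k hk] := prime_power_int_gen pp (hn g) (hn y) hg; exists k.
rewrite (int_congr (t := chi y - chi g *~ k)) //.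
rewrite (_ : _ - _ = (chi (y - g *~ k) - (chi y - chi (g *~ k))) - (chi (g *~ k) - chi g *~ k)).
  by rewrite rpredB ?circB ?circMz.
by ring.
Qed.

(** A character trivial on the core is integral on an open subgroup, hence has some finite order
    [e]. Multiplying it by the prime-to-p part of [e] leaves a cyclic p-group as image and does not
    lose [z], whose value has order [p]. *)
Lemma cyclic_quotient p : I p -> exists L n g z, [/\ closed_subgroup L, forall x, core x -> L x,
  forall y, L (y *+ p ^ n), ~ L z /\ core (z *+ p) & forall y, exists k : int, L (y - g *~ k)].
Proof.
move=> [pp [z [ncz cz]]].
have [chi cchi [h1 h2]] := closed_char R hV (csg_core hV) ncz.
have hchi := cchi.1.
have [|P hP hPn] := core_nbhd hV (op_near_int hV hchi cchi (3 / 10)).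
  by move=> x /h1 /intrP [k ->]; exists k; rewrite subrr normr0; lra.
have Pint x : P x -> chi x \is a Num.int.
  move=> Px; apply/intrP; apply: near_int_multiples => j.
  have [k hk] := hPn _ (sgMn j (proj1 hP) Px).
  have /intrP [k' hk'] := circMn hchi x j; exists (k - k').
  by rewrite mulr_natr intrB -hk' (_ : _ - _ = chi (x *+ j) - k%:~R) ?ltW //; ring.
have [e e0 he] := osg_exponent hV hP.
have [e' cpe ee] := pfactor_coprime pp e0; set n := logn p e in ee.
pose lambda y := chi y *+ e'.
have hlam : circle_hom lambda.
  move=> a b; rewrite (_ : _ - _ = (chi (a + b) - (chi a + chi b)) *+ e');
    last by rewrite /lambda mulrnBl mulrnDl.
  by rewrite rpredMn.
have clam : circle_character op lambda.
  split=> // d d0; exists P; first exact: osg_nb0.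
  move=> u /Pint ui; have /intrP [k hk] : lambda u \is a Num.int by rewrite rpredMn.
  by exists k; rewrite hk subrr normr0.
have lamn y : lambda y *+ p ^ n \is a Num.int.
  by rewrite /lambda -mulrnA -ee -(int_congr (circMn hchi y e)) Pint.
have [g hg] := prime_power_generator hlam pp lamn.
exists (fun x => lambda x \is a Num.int), n, g, z; split=> //.
- exact: csg_circ.
- by move=> x /h1 hx; rewrite rpredMn.
- by move=> y; rewrite (int_congr (circMn hlam y _)).
split=> // lz; case/negP: h2.
apply: (@sg_coprime _ (fun s : R => s \is a Num.int) _ p e') => //.
  by split=> [|a b ha hb]; rewrite ?rpred0 ?rpredB.
by rewrite -(int_congr (circMn hchi z p)) h1.
Qed.

Lemma prime_to_p_inverse p n E : prime p -> coprime p E -> (0 < E)%N ->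
  exists u v : nat, (u * E = v * p ^ n + 1)%N.
Proof.
move=> pp cp E0; case: (egcdnP (p ^ n) E0) => u v e _; exists u, v.
by rewrite e; congr (_ + _)%N; apply/eqP; rewrite -/(coprime _ _) coprime_sym coprimeXl.
Qed.

(* [G] is the group of all [x] whose images in the cyclic p-groups [V / L p] agree,
   for all [p] at once, with one and the same integer multiple of the generators. *)
Lemma exists_dense_subgroup : exists G : V -> Prop, [/\ subgroup G, forall x, core x -> G x,
  forall x P, open_subgroup P -> exists2 g, G g & P (g - x) &
  forall B, exists p z, [/\ (B <= p)%N, prime p, ~ G z & core (z *+ p)]].
Proof.
have hd p : exists d : (V -> Prop) * nat * V * V, I p ->
   [/\ closed_subgroup d.1.1.1, forall x, core x ->
     d.1.1.1 x, forall y, d.1.1.1 (y *+ p ^ d.1.1.2),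
   ~ d.1.1.1 d.2 /\ core (d.2 *+ p) & forall y, exists k : int, d.1.1.1 (y - d.1.2 *~ k)].
  have [Ip|nI] := EM (I p); last by exists ((fun _ => True), 0%N, 0, 0) => /nI.
  by have [L [n [g [z h]]]] := cyclic_quotient Ip; exists (L, n, g, z).
have [d {}hd] := choice hd.
pose L p := (d p).1.1.1; pose n p := (d p).1.1.2; pose g p := (d p).1.2; pose z p := (d p).2.
have cL p : I p -> closed_subgroup (L p) by move=> /hd [].
have sL p : I p -> subgroup (L p) by move=> /cL [].
have coreL p x : I p -> core x -> L p x by move=> /hd [_ h _ _ _]; exact: h.
have Ln p y : I p -> L p (y *+ p ^ n p) by move=> /hd [_ _ h _ _]; exact: h.
have nLz p : I p -> ~ L p (z p) by move=> /hd [_ _ _ []].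
have cz p : I p -> core (z p *+ p) by move=> /hd [_ _ _ []].
have gen p y : I p -> exists k : int, L p (y - g p *~ k) by move=> /hd [_ _ _ _]; exact.
(* A multiplier that erases the quotients at primes below [B] and is invertible at all later ones;
   it serves to correct one prime without disturbing the previous ones. *)
have kill B : exists E, [/\ (0 < E)%N, forall p, prime p -> (B <= p)%N -> coprime p E &
    forall q y, I q -> (q < B)%N -> L q (y *+ E)].
  elim: B => [|B [E [E0 cE hE]]].
    by exists 1%N; split=> // p _ _; exact: coprimen1.
  have [IB|nIB] := EM (I B); last first.
    exists E; split=> // [p pp Bp|q y Iq]; first exact: cE (ltnW Bp).
    by rewrite ltnS leq_eqVlt => /orP [/eqP qB|]; [rewrite qB in Iq|exact: hE].
  have pB : prime B by case: IB.
  exists (E * B ^ n B)%N; split.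
  - by rewrite muln_gt0 E0 expn_gt0 prime_gt0.
  - move=> p pp Bp; rewrite coprimeMr cE 1?ltnW //= coprimeXr //.
    by rewrite prime_coprime // dvdn_prime2 // gtn_eqF.
  move=> q y Iq; rewrite ltnS leq_eqVlt => /orP [/eqP qB|qB].
    by rewrite qB mulrnA; exact: Ln.
  by rewrite mulrnA; apply: sgMn; [exact: sL|exact: hE].
pose G x := exists k : int, forall p, I p -> L p (x - g p *~ k).
exists G; split.
- split; first by exists 0 => p Ip; rewrite subr0; case: (sL p Ip).
  move=> a b [k hk] [l hl]; exists (k - l) => p Ip.
  rewrite (_ : _ - _ = (a - g p *~ k) - (b - g p *~ l)); last by zmod.
  by apply: (sL p Ip).2; [exact: hk|exact: hl].
- by move=> x cx; exists 0 => p Ip; rewrite subr0; exact: coreL.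
- move=> x P hP; have [e e0 he] := osg_exponent hV hP.
  (* Chinese remainder theorem for the primes up to [e], by adjusting the integer [k] rather than
     the point [x]. *)
  have [k hk] : exists k : int, forall p, I p -> (p < e.+1)%N -> L p (x - g p *~ k).
    elim: (e.+1) => [|B [k hk]]; first by exists 0.
    have [IB|nIB] := EM (I B); last first.
      exists k => p Ip; rewrite ltnS leq_eqVlt => /orP [/eqP qB|];
        [by rewrite qB in Ip|exact: hk].
    have [E [E0 cE hE]] := kill B; have pB : prime B by case: IB.
    have [u [v uv]] := prime_to_p_inverse (n B) pB (cE B pB (leqnn B)) E0.
    have [j hj] := gen B (x - g B *~ k) IB.
    exists (k + (u * E)%N%:Z * j) => p Ip; rewrite ltnS leq_eqVlt => /orP [/eqP qB|qB].
      rewrite qB uv (_ : _ - _ = (x - g B *~ k - g B *~ j) - (g B *+ B ^ n B) *~ (v%:Z * j)).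
        by apply: (sL B IB).2 => //; apply: sgMz; [exact: sL|exact: Ln].
      by rewrite PoszD PoszM mulrDl mul1r; zmod.
    rewrite (_ : _ - _ = (x - g p *~ k) - (g p *+ E) *~ (u%:Z * j)); last by rewrite PoszM; zmod.
    by apply: (sL p Ip).2; [exact: hk|apply: sgMz; [exact: sL|exact: hE]].
  (* Beyond [e] the point is adjusted instead: [e] is prime to [p], so the correction can be a
     multiple of [e], which lies in [P]. Finitely many primes are treated by induction, all of them
     by compactness. *)
  have [|||w hw] := @fip V op hV nat (fun _ => True)
     (fun i w => P w /\ forall p, I p -> (p < e.+1 + i)%N ->
       L p (w + (x - g p *~ k))) 0%N Logic.I.
  - move=> i _; apply: clI => //; first exact: osg_cl.
    apply: cl_forall => // p; apply: cl_imp => // Ip; apply: cl_imp => // _.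
    by apply: (cl_transl hV); case: (cL p Ip).
  - move=> i j _ _; exists (maxn i j); split=> // w [Pw h]; split=> // p Ip pi; apply: h => //.
      by apply: leq_trans pi _; rewrite leq_add2l leq_maxl.
    by apply: leq_trans pi _; rewrite leq_add2l leq_maxr.
  - move=> i _; elim: i => [|i [w [Pw h]]].
      exists 0; split; first by case: hP => -[].
      by move=> p Ip; rewrite addn0 add0r; exact: hk.
    pose B := (e.+1 + i)%N.
    have [IB|nIB] := EM (I B); last first.
      exists w; split=> // p Ip; rewrite addnS ltnS leq_eqVlt => /orP [/eqP qB|];
        [by rewrite qB in Ip|exact: h].
    have [E [E0 cE hE]] := kill B; have pB : prime B by case: IB.
    have cBe : coprime B (E * e).
      rewrite coprimeMr cE //= prime_coprime // gtnNdvd //; rewrite /B; lia.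
    have Ee0 : (0 < E * e)%N by rewrite muln_gt0 E0.
    have [u [v uv]] := prime_to_p_inverse (n B) pB cBe Ee0.
    pose y := g B *~ k - x - w.
    exists (w + y *+ (u * (E * e))); split.
      apply: sgD => //; first by case: hP.
      by rewrite mulnA mulrnA; exact: he.
    move=> p Ip; rewrite addnS ltnS leq_eqVlt => /orP [/eqP qB|qB].
      have {}qB : p = B by [].
      rewrite qB uv (_ : _ + _ = (y *+ v) *+ B ^ n B); first exact: Ln.
      by rewrite /y; zmod.
    rewrite (_ : _ + _ = (w + (x - g p *~ k)) + (y *+ (u * e)) *+ E); last by zmod.
    by apply: sgD; [exact: sL|exact: h|exact: hE].
  exists (w + x); last by rewrite addrK; case: (hw 0%N Logic.I).
  exists k => p Ip; have [_ h] := hw p Logic.I.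
  by rewrite -addrA; apply: h => //; rewrite addSn ltnS leq_addl.
move=> B; have [p [Bp Ip]] := infinitely_many_primes B.
exists p, (z p); split=> //; [by case: Ip| |exact: cz].
move=> [k hk]; have [k0|k0] := eqVneq k 0.
  by apply: (nLz p Ip); have := hk p Ip; rewrite k0 subr0.
(* At [q] the element [z p] vanishes, so [k] kills the generator and thus the whole quotient; but
   [z q] has order [q] there, and [k] is prime to [q]. *)
have [q [qB Iq]] := infinitely_many_primes (maxn p `|k|%N).+1.
rewrite gtn_max in qB; case/andP: qB => pq kq.
have [pp pq'] : prime p /\ prime q by case: Ip; case: Iq.
have Lz : L q (z p).
  apply: (@sg_coprime _ (L q) _ p (q ^ n q)); [exact: sL| | |exact: Ln].
    by rewrite coprimeXr // prime_coprime // dvdn_prime2 // ltn_eqF.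
  by apply: coreL => //; exact: cz.
have Lg : L q (g q *~ k).
  rewrite (_ : _ *~ _ = z p - (z p - g q *~ k)); last by zmod.
  by apply: (sL q Iq).2 => //; exact: hk.
have Lk y : L q (y *~ k).
  have [j hj] := gen q y Iq.
  rewrite (_ : y *~ k = (y - g q *~ j) *~ k + (g q *~ k) *~ j); last by zmod.
  by apply: sgD; [exact: sL|apply: sgMz => //; exact: sL|apply: sgMz => //; exact: sL].
apply: (nLz q Iq); apply: (@sg_coprime _ (L q) _ q `|k|%N); first exact: sL.
- by rewrite prime_coprime // gtnNdvd // absz_gt0.
- by apply: coreL => //; exact: cz.
have := Lk (z q); case: (k) => i; first by rewrite -pmulrn.
by rewrite NegzE mulrNz => /(sgN (sL q Iq)); rewrite opprK -pmulrn.
Qed.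

End InfinitelyManyPrimes.

(** * Carriers, subgroups and quotients *)

Lemma exist_eq (T : Type) (P : T -> Prop) (a b : T) (p : P a) (q : P b) :
  a = b -> exist P a p = exist P b q.
Proof. by move=> e; subst b; congr exist; exact: Prop_irrelevance. Qed.

Lemma sig_eq (T : Type) (P : T -> Prop) (a b : {x | P x}) :
  proj1_sig a = proj1_sig b -> a = b.
Proof. by case: a b => [a p] [b q] /= e; exact: exist_eq. Qed.

Definition is_ab_group (A : topab) : Prop :=
  (forall x y z : car A, add x (add y z) = add (add x y) z) /\
  (forall x y : car A, add x y = add y x) /\
  (forall x : car A, add zer x = x) /\
  (forall x : car A, add (opp x) x = zer).

Lemma top_ab_ab A : is_top_ab_group A -> is_ab_group A.
Proof. by move=> [? [? [? [? _]]]]. Qed.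

(** Carrying [hA] in the type lets the group structure be inferred from the type alone. *)
Definition zcar (A : topab) (hA : is_ab_group A) : Type := car A.

HB.instance Definition _ (A : topab) (hA : is_ab_group A) := gen_eqMixin (zcar hA).
HB.instance Definition _ (A : topab) (hA : is_ab_group A) := gen_choiceMixin (zcar hA).
HB.instance Definition _ (A : topab) (hA : is_ab_group A) :=
  GRing.isZmodule.Build (zcar hA) (proj1 hA) (proj1 (proj2 hA))
    (proj1 (proj2 (proj2 hA))) (proj2 (proj2 (proj2 hA))).

Section Carrier.
Variables (A : topab) (hA : is_ab_group A).
Local Notation V := (zcar hA : zmodType).

Lemma natmulE (x : V) n : @natmul A x n = (x *+ n : V).
Proof. by elim: n => // n IH; rewrite mulrS -IH. Qed.

Lemma is_subgroup_sg (S : car A -> Prop) : is_subgroup S <-> @subgroup V S.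
Proof.
split=> [[h0 hD hN]|hS]; first by split=> // a b ha hb; apply: hD => //; exact: hN.
split; [by case: hS|by move=> x y; exact: (sgD hS)|by move=> x; exact: (sgN hS)].
Qed.

Lemma subgrp_ab (S : car A -> Prop) (h : is_subgroup S) : is_ab_group (subgrp h).
Proof.
split; [|split; [|split]].
- by move=> x y z; apply: sig_eq; exact: (@addrA V).
- by move=> x y; apply: sig_eq; exact: (@addrC V).
- by move=> x; apply: sig_eq; exact: (@add0r V).
- by move=> x; apply: sig_eq; exact: (@addNr V).
Qed.

Section Quotient.
Variable N : car A -> Prop.
Hypothesis hN : @subgroup V N.

Lemma qmap_eq (x y : V) : qmap N x = qmap N y <-> N ((x - y) : V).
Proof.
split=> [|h].
  move/(congr1 (@proj1_sig _ _)) => /= e.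
  have : coset N y x.
    rewrite -e; exists (0 : V); split; [by case: hN|by rewrite -[add _ _]/((x : V) + 0) addr0].
  move=> [n [Nn ->]]; rewrite -[add _ _]/((y : V) + (n : V)).
  by rewrite (_ : _ - _ = (n : V)) //; zmod.
apply: sig_eq => /=; apply: funext => z; apply/propext; split=> [[n [Nn ->]]|[n [Nn ->]]].
  exists ((x - y + (n : V)) : V); split; first exact: (sgD hN).
  by change ((x : V) + (n : V) = y + (x - y + (n : V)) :> V); zmod.
exists (((n : V) - (x - y)) : V); split; first exact: hN.2.
by change ((y : V) + (n : V) = x + ((n : V) - (x - y)) :> V); zmod.
Qed.

Lemma qmap_surj (q : quo_car N) : exists x : V, q = qmap N x.
Proof. by case: q => C [x e]; exists x; apply: sig_eq. Qed.

Lemma rep_qmap (x : V) : N (((rep (qmap N x) : V) - x) : V).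
Proof.
have : proj1_sig (qmap N x) ((rep (qmap N x) : V)).
  apply: ClassicalEpsilon.epsilon_spec; exists (x : V) => /=; exists (0 : V); split;
    first by case: hN.
  by change (x = x + 0 :> V); rewrite addr0.
move=> [n [Nn ->]]; rewrite -[add _ _]/((x : V) + (n : V)) (_ : _ - _ = (n : V)) //; zmod.
Qed.

Lemma quo_add (x y : V) : @add (quo N) (qmap N x) (qmap N y) = qmap N (x + y : V).
Proof.
apply/qmap_eq; rewrite -[add _ _]/((rep (qmap N x) : V) + (rep (qmap N y) : V)).
rewrite (_ : _ - _ = ((rep (qmap N x) : V) - x) + ((rep (qmap N y) : V) - y)); last by zmod.
by apply: (sgD hN); exact: rep_qmap.
Qed.

Lemma quo_opp (x : V) : @opp (quo N) (qmap N x) = qmap N (- x : V).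
Proof.
apply/qmap_eq; rewrite -[opp _]/(- (rep (qmap N x) : V)).
rewrite (_ : _ - _ = - ((rep (qmap N x) : V) - x)); last by zmod.
by apply: (sgN hN); exact: rep_qmap.
Qed.

Lemma quo_zer : @zer (quo N) = qmap N (0 : V). Proof. by []. Qed.

Lemma quo_ab : is_ab_group (quo N).
Proof.
split; [|split; [|split]].
- move=> a b c; have [x ->] := qmap_surj a; have [y ->] := qmap_surj b.
  by have [z ->] := qmap_surj c; rewrite !quo_add addrA.
- move=> a b; have [x ->] := qmap_surj a; have [y ->] := qmap_surj b.
  by rewrite !quo_add addrC.
- by move=> a; have [x ->] := qmap_surj a; rewrite quo_zer quo_add add0r.
- by move=> a; have [x ->] := qmap_surj a; rewrite quo_opp quo_add addNr.
Qed.

Lemma quo_natmul (x : V) n : @natmul (quo N) (qmap N x) n = qmap N (x *+ n : V).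
Proof.
elim: n => [|n IH] //.
by rewrite mulrS -quo_add -IH.
Qed.
End Quotient.
End Carrier.

Section TopologicalCarrier.
Variables (A : topab) (hA : is_top_ab_group A).
Local Notation V := (zcar (top_ab_ab hA) : zmodType).
Local Notation op := (@opn A : (V -> Prop) -> Prop).

Lemma carrier_top_group : hausdorff A -> top_group op.
Proof.
move=> hH; have [_ [_ [_ [_ [h1 [h2 [h3 h4]]]]]]] := hA.
by split.
Qed.

Lemma carrier_compact_group : hausdorff A -> compact (fun _ : car A => True) -> compact_group op.
Proof. by move=> hH hC; split; [exact: carrier_top_group|exact: hC]. Qed.
End TopologicalCarrier.

Lemma In_mem (T : eqType) (x : T) (l : seq T) : x \in l <-> List.In x l.
Proof.
elim: l => [|y l IH] //=; rewrite inE; split=> [/orP [/eqP ->|/IH]|[->|/IH ->]];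
  rewrite ?eqxx ?orbT //.
  by left.
by right.
Qed.

Section CompactCarrier.
Variables (K : topab) (hK : is_top_ab_group K) (hH : hausdorff K).
Hypothesis hC : compact (fun _ : car K => True).
Local Notation V := (zcar (top_ab_ab hK) : zmodType).
Local Notation op := (@opn K : (V -> Prop) -> Prop).
Let hV : compact_group op := carrier_compact_group hK hH hC.
Let hT : top_group op := hV.
Local Notation core := (@core V op).
Local Notation C := (@comp0 K).

Lemma comp0_core (x : V) : C x <-> core x.
Proof. by rewrite (coreE hV). Qed.

Lemma comp0E : C = core :> (V -> Prop).
Proof. by apply: funext => x; apply/propext; exact: comp0_core. Qed.

Lemma sg_comp0 : @subgroup V C. Proof. by rewrite comp0E; exact: sg_core. Qed.

Lemma essential_core : locally_essential C ->
  exists2 V0, open_nbhd0 op V0 & forall H, closed_subgroup op H -> (forall x, H x -> V0 x) ->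
  (exists x : V, H x /\ x <> 0) -> exists x : V, [/\ H x, core x & x <> 0].
Proof.
move=> [U [[U0 [h1 [h2 h3]]] hU]]; exists U0 => // H [sH cH] HU ne.
have hs := proj2 (is_subgroup_sg (top_ab_ab hK) H) sH.
have [x [Hx [Cx x0]]] := hU H hs cH (fun x Hx => h3 x (HU x Hx)) ne.
by exists x; split=> //; apply/comp0_core.
Qed.

Lemma infinite_quo : infinite_set (fun _ : car (quo C) => True) <->
  ~ exists l : seq V, forall x : V, exists2 y, y \in l & core (x - y).
Proof.
split=> h [l hl]; apply: h.
  exists (List.map (fun x : V => qmap C x) l) => q _.
  have [x ->] := qmap_surj (top_ab_ab hK) q; have [y /In_mem yl hxy] := hl x.
  have -> : qmap C x = qmap C y by apply/(qmap_eq sg_comp0); exact/comp0_core.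
  exact: (List.in_map (fun x : V => qmap C x)).
exists (List.map (fun q => rep q : V) l) => x.
exists (rep (qmap C x)).
  by apply/In_mem; apply: (List.in_map (fun q => rep q : V)); exact: hl.
by apply/comp0_core; rewrite -opprB; apply: (sgN sg_comp0); exact: (rep_qmap sg_comp0).
Qed.
End CompactCarrier.

(** * Finite index, and the primes of the quotient by the core *)

Section FiniteIndex.
Variables (V : zmodType) (op : (V -> Prop) -> Prop).
Hypothesis hV : compact_group op.
Let hT : top_group op := hV.

(** The complement of the core is a finite union of its cosets, each of them closed. *)
Lemma op_core_finite_index (l : seq V) :
  (forall x, exists2 y, y \in l & core op (x - y)) -> op (core op).
Proof.
move=> hl; have sc := sg_core op.
have h : forall s : seq V, is_closed op (fun x =>
  exists2 y, y \in s & ~ core op y /\ core op (x - y)).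
  elim=> [|y s IH]; first by apply: op_ext (tg_full hT) => x; split=> // _ [].
  have [cy|ncy] := EM (core op y).
    apply: cl_ext IH => x; split=> [[z zs hz]|[z]]; first by exists z => //; rewrite inE zs orbT.
    by rewrite inE => /orP [/eqP -> []|zs hz] //; exists z.
  apply: cl_ext (clU hV (cl_transl hT (- y) (cl_core hT)) IH) => x.
  split=> [[h|[z zs hz]]|[z]].
  - by exists y; rewrite ?inE ?eqxx.
  - by exists z => //; rewrite inE zs orbT.
  by rewrite inE => /orP [/eqP -> [_ h]|zs hz]; [left|right; exists z].
have ho : op (fun x => ~ exists2 y, y \in l & ~ core op y /\ core op (x - y)) := h l.
apply: op_ext ho => x; split=> [nh|cx [y yl [ncy]]].
  have [y yl hxy] := hl x; apply: contrapT => ncx; apply: nh; exists y => //; split=> // cy.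
  by apply: ncx; apply/(sg_eqD sc hxy).
by move=> h'; apply: ncy; apply/(sg_eqD sc h').
Qed.
End FiniteIndex.

Section PiStar.
Variables (K : topab) (hK : is_top_ab_group K) (hH : hausdorff K).
Hypothesis hC : compact (fun _ : car K => True).
Local Notation hA := (top_ab_ab hK).
Local Notation V := (zcar hA : zmodType).
Local Notation op := (@opn K : (V -> Prop) -> Prop).
Let hV : compact_group op := carrier_compact_group hK hH hC.
Let hT : top_group op := hV.
Local Notation core := (@core V op).
Local Notation C := (@comp0 K).
Let sC : @subgroup V C := sg_comp0 hK hH hC.
Let coreC (x : V) : C x <-> core x := comp0_core hH hC x.

Lemma qmap_zer (x : V) : qmap C x = @zer (quo C) <-> core x.
Proof. by rewrite -[zer]/(qmap C (0 : V)) (qmap_eq sC) subr0. Qed.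

Lemma pi_star_of_prime p : core_torsion_prime op p -> pi_star (quo C) p.
Proof.
move=> [pp [z [ncz cz]]]; split=> //.
have p0 := prime_gt0 pp.
pose H (q : car (quo C)) := exists m : nat, q = qmap C (z *+ m : V).
have hH' : @is_subgroup (quo C) H.
  split; first by exists 0%N.
    by move=> _ _ [m ->] [n ->]; exists (m + n)%N; rewrite (quo_add sC) mulrnDr.
  move=> _ [m ->]; exists (p.-1 * m)%N; rewrite (quo_opp sC); apply/(qmap_eq sC)/coreC.
  rewrite (_ : _ - _ = - (z *+ p *+ m)); last by rewrite -{2}(prednK p0); zmod.
  exact: (sgN (sg_core op) (sgMn m (sg_core op) cz)).
exists H, hH'; split; last first.
  exists (qmap C (z : V)); split; first by exists 1%N.
  by move/qmap_zer.
left.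
have Hz : H (qmap C (z : V)) by exists 1%N.
have nm m : proj1_sig (@natmul (subgrp hH') (exist _ _ Hz) m) = qmap C (z *+ m : V).
  by rewrite -(quo_natmul sC); elim: m => //= m ->.
exists (exist _ _ Hz), 1%N; split; [|split].
- by move=> [q [m e]]; exists m; apply: sig_eq; rewrite nm.
- by apply: sig_eq; rewrite nm expn1; apply/qmap_zer.
move=> m; rewrite expn1 => /andP [m0 mp] /(congr1 (@proj1_sig _ _)); rewrite nm => /qmap_zer cm.
apply: ncz; apply: (@sg_coprime _ core z p m (sg_core op)) => //.
by rewrite prime_coprime // gtnNdvd.
Qed.

(** A p-monothetic group killed by an [e] prime to [p] is trivial: the generator of a cyclic
    p-group, and each coordinate of a p-adic integer, is also killed by a power of [p]. *)
Lemma pi_star_dvd e p : (forall x : V, core (x *+ e)) -> pi_star (quo C) p -> (p %| e)%N.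
Proof.
move=> he [pp [H [hS [mono [x0 [Hx0 nx0]]]]]].
apply: contraT => npe; exfalso; apply: nx0.
have cpe : coprime p e by rewrite prime_coprime.
pose A := subgrp hS.
have hQ : is_ab_group (quo C) := quo_ab sC.
have hAA : is_ab_group A := subgrp_ab hQ hS.
have exp_e (y : zcar hAA) : y *+ e = 0.
  rewrite -natmulE; apply: sig_eq => /=.
  have [x ex] := qmap_surj hA (proj1_sig (y : car A)).
  have -> : proj1_sig (natmul (y : car A) e) = natmul (proj1_sig (y : car A)) e.
    by elim: (e) => //= m ->.
  by rewrite ex (quo_natmul sC); apply/qmap_zer.
suff h : exist _ x0 Hx0 = 0 :> zcar hAA by exact: (congr1 (@proj1_sig _ _) h).
case: mono => [[g [k [gen [gk _]]]]|[S [h [f [fhom [[finj _] _]]]]]].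
  have g0 : (g : zcar hAA) = 0.
    apply: (@sg_coprime (zcar hAA) (fun y => y = 0) g (p ^ k) e).
    - by split=> // a b -> ->; rewrite subr0.
    - exact: coprimeXl.
    - by rewrite -natmulE.
    - exact: exp_e.
  have [m ->] := gen (exist _ x0 Hx0).
  by rewrite natmulE g0 mul0rn.
pose c j (y : zcar hAA) : 'Z_(p ^ j.+1) := proj1_sig (proj1_sig (f y)) j.
have cD j y z : c j (y + z) = c j y + c j z by rewrite /c [f _]fhom.
have c0 j : c j 0 = 0.
  by have := cD j 0 0; rewrite addr0 => /(congr1 (fun t => t - c j 0)); rewrite subrr addrK.
have cM j y n : c j (y *+ n) = c j y *+ n by elim: n => [|n IH]; rewrite ?mulr0n // !mulrS cD IH.
apply: finj; apply: sig_eq; apply: sig_eq; apply: functional_extensionality_dep => j.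
rewrite -/(c j (exist _ x0 Hx0)) -/(c j 0) c0.
apply: (@sg_coprime _ (fun t => t = 0) _ (p ^ j.+1) e).
- by split=> // a b -> ->; rewrite subr0.
- exact: coprimeXl.
- rewrite -mulr_natr pchar_Zp ?mulr0 //; apply: leq_trans (prime_gt1 pp) _.
  by rewrite -{1}(expn1 p) leq_exp2l // prime_gt1.
- by rewrite -cM exp_e c0.
Qed.

Lemma infinite_pi_star : locally_essential C ->
  infinite_set (fun _ : car (quo C) => True) -> infinite_set (pi_star (quo C)).
Proof.
move=> /(essential_core hK hH hC) ess /(infinite_quo hK hH hC) inf [l hl].
have [p [lp /pi_star_of_prime /hl pl]] :=
  infinitely_many_primes Rdefinitions.R hV ess inf (foldr maxn 0 l).+1.
have : (p <= foldr maxn 0 l)%N.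
  elim: l pl {hl lp} => //= n l IH [->|/IH]; first exact: leq_maxl.
  by move=> h; apply: leq_trans h (leq_maxr _ _).
by rewrite leqNgt lp.
Qed.

Lemma finite_index_exponent (l : seq V) :
  (forall x, exists2 y, y \in l & core (x - y)) ->
    exists2 e, (0 < e)%N & forall x : V, core (x *+ e).
Proof.
move=> hl; apply: (osg_exponent hV); split; [exact: sg_core|exact: op_core_finite_index hl].
Qed.

Lemma infinite_quo_of_pi_star :
  infinite_set (pi_star (quo C)) -> infinite_set (fun _ : car (quo C) => True).
Proof.
move=> inf; apply/(infinite_quo hK hH hC) => -[l hl]; apply: inf.
have [e e0 he] := finite_index_exponent hl.
exists (iota 0 e.+1) => p /(pi_star_dvd he) pe; apply/In_mem.
by rewrite mem_iota /= add0n ltnS dvdn_leq.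
Qed.
End PiStar.

Lemma hom_sub (A B : topab) (hA : is_ab_group A) (hB : is_ab_group B) (f : car A -> car B) :
  is_hom f -> forall x y : zcar hA, f (x - y : zcar hA) = (f x : zcar hB) - (f y : zcar hB)
    :> zcar hB.
Proof.
move=> hf x y.
have e : (f (x - y : zcar hA) : zcar hB) + (f y : zcar hB) = f x.
  have -> : (f (x - y : zcar hA) : zcar hB) + (f y : zcar hB) = f ((x - y : zcar hA) + y :
    zcar hA).
    by rewrite [RHS]hf.
  by rewrite subrK.
by rewrite -e addrK.
Qed.

Lemma hom_zer (A B : topab) (hA : is_ab_group A) (hB : is_ab_group B) (f : car A -> car B) :
  is_hom f -> f (0 : zcar hA) = 0 :> zcar hB.
Proof. by move=> hf; have := @hom_sub A B hA hB f hf 0 0; rewrite !subrr. Qed.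

(** * Local minimality *)

Section LocallyMinimal.
Variables (K : topab) (hK : is_top_ab_group K) (hH : hausdorff K).
Hypothesis hC : compact (fun _ : car K => True).
Local Notation hA := (top_ab_ab hK).
Local Notation V := (zcar hA : zmodType).
Local Notation op := (@opn K : (V -> Prop) -> Prop).
Let hV : compact_group op := carrier_compact_group hK hH hC.
Let hT : top_group op := hV.
Local Notation core := (@core V op).
Local Notation C := (@comp0 K).

(* The closures in [K] of the neighbourhoods of 0 of a coarser group topology on
   the subgroup intersect in a closed subgroup that meets the subgroup trivially;
   local essentiality makes it trivial, and compactness turns this into the
   equality of the two topologies. *)
Lemma locally_minimal_of_core_subset (S : car K -> Prop) (h : is_subgroup S) :
  locally_essential C -> (forall x : V, core x -> S x) -> locally_minimal (subgrp h).
Proof.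
move=> /(essential_core hK hH hC) [V0 hV0 hess] coreS.
(* The smaller [V1] ensures that even the closure in [K] of a set inside [V1] remains in [V0], where
   local essentiality applies. *)
have [V1 hV1 hV10] := nb0_half hT hV0.
exists (fun y => V1 (proj1_sig y)); split.
  exists (fun y => V1 (proj1_sig y)); split; last by split=> //; case: hV1.
  by exists V1; split=> //; case: hV1.
move=> B f hB hHB fhom fcont [finj fsurj] [W0 [oW0 [W00 hW0]]].
pose hZ := subgrp_ab hA h.
pose Z : zmodType := zcar hZ.
pose W : zmodType := zcar (top_ab_ab hB).
have hTB : @top_group W (@opn B) := carrier_top_group hB hHB.
pose F (y : Z) : W := f y.
pose pr (y : Z) : V := proj1_sig (y : car (subgrp h)).
have FB (x y : Z) : F (x - y) = F x - F y := @hom_sub _ _ hZ (top_ab_ab hB) f fhom x y.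
have F0 : F 0 = 0 := @hom_zer _ _ hZ (top_ab_ab hB) f fhom.
have prB (x y : Z) : pr (x - y) = pr x - pr y by [].
pose nbB := @open_nbhd0 W (@opn B).
pose A (U : W -> Prop) (x : V) := exists y : Z, U (F y) /\ pr y = x.
have AS (U U' : W -> Prop) x : (forall w, U w -> U' w) -> closure op (A U) x ->
  closure op (A U') x.
  move=> UU' hx O hO; have [s [[y [hy e]] hs]] := hx O hO.
  by exists s; split=> //; exists y; split=> //; exact: UU'.
pose N (x : V) := forall U, nbB U -> closure op (A U) x.
have cN : closed_subgroup op N.
  split; last by apply: (cl_forall hT) => U; apply: (cl_imp hT) => _; exact: cl_closure.
  split.
    move=> U [_ U0] O [_ O0]; exists 0; rewrite subrr; split=> //; exists 0; split=> //.
    by rewrite F0.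
  move=> a b ha hb U hU O hO.
  have [U' hU' hUU] := nb0_half hTB hU; have [O' hO' hOO] := nb0_half hT hO.
  have [_ [[x [hx <-]] Ox]] := ha U' hU' O' hO'; have [_ [[y [hy <-]] Oy]] := hb U' hU' O' hO'.
  exists (pr x - pr y); split; last first.
    by rewrite (_ : _ - _ = (pr x - a) - (pr y - b)); [exact: hOO|zmod].
  by exists (x - y); split=> //; rewrite FB; exact: hUU.
have NV0 x : N x -> V0 x.
  have hW0' : nbB W0 by [].
  move=> /(_ W0 hW0') hx.
  have [_ [[y [hy <-]] Vy]] := hx V1 hV1.
  have V1y : V1 (pr y).
    by have [v [Vv e]] := hW0 _ hy; rewrite /pr -(finj _ _ e).
  by rewrite (_ : x = pr y - (pr y - x)); [exact: hV10|zmod].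
have N0 x : N x -> x = 0.
  move=> Nx; apply: contrapT => x0.
  (* A nonzero [N] would contain a nonzero point of the core, hence of [S]; there [f] is defined and
     injective, and separating its value from 0 contradicts continuity. *)
  have [z [Nz cz z0]] := hess N cN NV0 (ex_intro _ x (conj Nx x0)).
  have Sz := coreS z cz; pose gz : Z := exist _ z Sz : car (subgrp h).
  have Fz : F gz <> 0.
    rewrite -F0 => /finj /(congr1 (@proj1_sig _ _)) /= e; exact: z0.
  have [U hU nU] := nb0_sep hTB Fz.
  have [U' hU' hUU] := nb0_half hTB hU.
  have [O [oO hO]] := fcont U' (proj1 hU').
  have nO : open_nbhd0 op O.
    split=> //; apply/(hO (0 : Z)); rewrite -/(F 0) F0; by case: hU'.
  have [_ [[y [hy <-]] Oy]] := Nz U' hU' O nO.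
  have hyz : U' (F (y - gz)) by apply/(hO (y - gz : Z)).
  by apply: nU; rewrite (_ : F gz = F y - F (y - gz)); [exact: hUU|rewrite FB; zmod].
have key (O : V -> Prop) : open_nbhd0 op O -> exists2 U, nbB U & forall y : Z, U (F y) ->
  O (pr y).
  move=> hO; apply: contrapT => hn.
  have [|||x hx] := @fip V op hV _ nbB (fun U x => closure op (A U) x /\ ~ O x) (fun _ =>
    True) (nb0T hTB).
  - move=> U hU; apply: (clI hT); first exact: cl_closure.
    by apply: cl_op; case: hO.
  - move=> U U' hU hU'; exists (fun w => U w /\ U' w); split; first exact: (nb0I hTB).
      by move=> x [hx nO]; split=> //; apply: AS hx => w [].
    by move=> x [hx nO]; split=> //; apply: AS hx => w [].
  - move=> U hU; apply: contrapT => h2; apply: hn; exists U => // y Uy.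
    apply: contrapT => nO; apply: h2; exists (pr y); split=> // P [_ P0].
    by exists (pr y); rewrite subrr; split=> //; exists y.
  have x0 : x = 0 by apply: N0 => U /hx [].
  by have [_] := hx _ (nb0T hTB); rewrite x0; case: hO.
move=> P [O [oO hO]]; apply: (op_local hTB) => w [y [Py e]].
have [U hU hUO] := key _ (nb0_at hT oO (proj1 (hO y) Py)).
exists (fun w' : W => U (w' - F y)); split.
- exact: (op_transl hTB _ (proj1 hU)).
- by rewrite -e subrr; case: hU.
move=> w' hw'; have [y' e'] := fsurj w'; exists y'; split=> //.
apply/hO; have := hUO ((y' : Z) - (y : Z)).
by rewrite FB [F y']e' prB subrK; exact.
Qed.

Lemma comp0_subgrp (S : car K -> Prop) (h : is_subgroup S) (y : car (subgrp h)) :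
  (forall x : V, core x -> S x) -> @comp0 (subgrp h) y <-> core (proj1_sig y).
Proof.
move=> coreS; split.
  move=> [T [cT [T0 Ty]]]; apply/(comp0_core hH hC).
  exists (fun x => exists t, T t /\ proj1_sig t = x); split; last by split; [exists zer|exists y].
  move=> U U' oU oU' cov [_ [[a [Ta <-]] Ua]] [_ [[b [Tb <-]] Ub]].
  have [|||||t [Tt [h1 h2]]] := cT (fun t => U (proj1_sig t)) (fun t => U' (proj1_sig t)).
  - by exists U.
  - by exists U'.
  - by move=> t Tt; apply: cov; exists t.
  - by exists a.
  - by exists b.
  by exists (proj1_sig t); split=> //; exists t.
move=> cy; exists (fun t => core (proj1_sig t)); split; last by split=> //; exact: (sg_core op).1.
move=> U U' [O [oO hO]] [O' [oO' hO']] cov [a [ca Ua]] [b [cb Ub]].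
have [|||x [cx [Ox O'x]]] := conn_core hV oO oO'.
- move=> x cx; have := cov (exist _ x (coreS x cx)) cx.
  by case=> [/hO|/hO']; [left|right].
- by exists (proj1_sig a); split=> //; apply/hO.
- by exists (proj1_sig b); split=> //; apply/hO'.
by exists (exist _ x (coreS x cx)); split=> //; split; [apply/hO|apply/hO'].
Qed.

Lemma compact_comp0 : compact C.
Proof.
move=> F oF cF.
have [||l [hl hcov]] := hC (F := fun U => F U \/ U = (fun x => ~ C x)).
- move=> U [/oF //|->]; rewrite (comp0E hK hH hC); exact: (cl_core hT).
- move=> x _; have [Cx|nC] := EM (C x); last by exists (fun x => ~ C x); split=> //; right.
  by have [U [FU Ux]] := cF x Cx; exists U; split=> //; left.
have [l' hl'] : exists l', forall U, List.In U l' <-> List.In U l /\ F U.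
  elim: l {hl hcov} => [|U l [l' hl']]; first by exists nil => U; split=> // -[].
  have [FU|nF] := EM (F U).
    exists (U :: l') => U'; split=> [[<-|/hl' [h1 h2]]|[[<-|h1] h2]].
    - by split=> //; left.
    - by split=> //; right.
    - by left.
    - by right; apply/hl'.
  exists l' => U'; split=> [/hl' [h1 h2]|[[e|h1] h2]].
  - by split=> //; right.
  - by rewrite e in nF.
  - by apply/hl'.
exists l'; split=> [U /hl' [] //|x Cx].
have [U [Ul Ux]] := hcov x Logic.I; exists U; split=> //; apply/hl'; split=> //.
by case: (hl U Ul) => // e; move: Ux; rewrite e.
Qed.

Lemma infinite_quo_of_C_Clm : C_Clm K -> infinite_set (fun _ : car (quo C) => True).
Proof.
move=> [_ [_ [_ [S [h [_ [_ [hc [_ nmin]]]]]]]]].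
apply/(infinite_quo hK hH hC) => -[l hl]; apply: nmin.
have oC : op C by rewrite (comp0E hK hH hC); exact: op_core_finite_index hl.
have cS (y : car (subgrp h)) : comp0 y <-> C (proj1_sig y).
  split=> [cy|/hc [y' [cy' /sig_eq <-]] //]; apply/hc; by exists y.
have hZ := subgrp_ab hA h; set D := @comp0 (subgrp h).
have sD : @subgroup (zcar hZ) D.
  have [s0 sB] := sg_comp0 hK hH hC.
  by split=> [|a b /cS ha /cS hb]; apply/cS => //; exact: sB.
have hQ : is_ab_group (quo D) := quo_ab sD.
(* With the core open, 0 is isolated in the quotient; a group in which the image of this singleton
   is a neighbourhood of 0 is discrete. *)
exists (fun q => q = zer); split.
  exists (fun q => q = zer); split; last by split.
  apply: (ex_intro _ C); split=> // y.
  split=> [e|/cS hy]; first by apply/cS; have := proj1 (qmap_eq sD (y : zcar hZ) 0) e;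
    rewrite subr0.
  by apply: (proj2 (qmap_eq sD (y : zcar hZ) 0)); rewrite subr0.
move=> B f hB hHB fhom fcont [finj fsurj] [U [oU [U0 hU]]].
have hTB := carrier_top_group hB hHB.
move=> P oP; apply: (op_local hTB) => w [q [Pq e]].
exists (fun w' : zcar (top_ab_ab hB) => U (w' - w)); split.
- exact: (op_transl hTB _ oU).
- by rewrite subrr.
move=> w' /hU [_ [-> e2]]; have [q' e'] := fsurj w'.
have : w' - w = 0 by rewrite -e2; exact: (@hom_zer _ _ hQ (top_ab_ab hB) f fhom).
by move/eqP; rewrite subr_eq0 => /eqP ->; exists q.
Qed.
End LocallyMinimal.

(** * Strictly coarser group topologies on the quotient of a dense subgroup *)

Section NotLocallyMinimal.
Variables (K : topab) (hK : is_top_ab_group K) (hH : hausdorff K).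
Hypothesis hC : compact (fun _ : car K => True).
Local Notation hA := (top_ab_ab hK).
Local Notation V := (zcar hA : zmodType).
Local Notation op := (@opn K : (V -> Prop) -> Prop).
Let hV : compact_group op := carrier_compact_group hK hH hC.
Let hT : top_group op := hV.
Local Notation core := (@core V op).
Local Notation C := (@comp0 K).
Variables (S : car K -> Prop) (h : is_subgroup S).
Hypotheses (coreS : forall x : V, core x -> S x) (dS : dense S).
Local Notation hZ := (subgrp_ab hA h).
Local Notation Z := (zcar hZ : zmodType).
Local Notation D := (@comp0 (subgrp h)).
Local Notation pr y := (proj1_sig (y : car (subgrp h)) : V).

Let DE (y : Z) : D y <-> core (pr y) := comp0_subgrp hH hC y coreS.

Let sD : @subgroup Z D.
Proof.
have [s0 sB] := sg_core op.
by split=> [|a b /DE ha /DE hb]; apply/DE => //; exact: sB.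
Qed.

Lemma qmap_subgrp_eq (x y : Z) : qmap D x = qmap D y <-> core (pr x - pr y).
Proof. by split=> [/(qmap_eq sD)/DE //|hxy]; apply/(qmap_eq sD)/DE. Qed.

Section CoarserTopology.
Variable N : V -> Prop.
Hypotheses (cN : closed_subgroup op N) (coreN : forall x, core x -> N x)
  (NS : forall x, N x -> S x -> core x).

Let sN : subgroup N. Proof. by case: cN. Qed.

(* The topology induced on [S / D] by its embedding into [K / N]. *)
Definition induced_opn (U : quo_car D -> Prop) : Prop :=
  exists W : V -> Prop, [/\ op W, forall x n, W x -> N n -> W (x + n) &
    forall y : Z, U (qmap D y) <-> W (pr y)].

Definition induced_quo : topab :=
  @TopAb (quo_car D) (@zer (quo D)) (@add (quo D)) (@opp (quo D)) induced_opn.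

Definition trace (A : V -> Prop) (q : quo_car D) : Prop :=
  exists2 y : Z, q = qmap D y & exists2 n, N n & A (pr y + n).

Lemma trace_qmap A (y : Z) : trace A (qmap D y) <-> exists2 n, N n & A (pr y + n).
Proof.
split=> [[y' /qmap_subgrp_eq e [n Nn An]]|hy]; last by exists y.
exists (n - (pr y - pr y')); first by apply: sN.2 => //; exact: coreN.
by rewrite (_ : _ + _ = pr y' + n) //; zmod.
Qed.

Lemma induced_trace A : op A -> induced_opn (trace A).
Proof.
move=> oA; exists (fun x => exists2 n, N n & A (x + n)); split.
- apply: (op_local hT) => x [n Nn An]; exists (fun y => A (y + n)); split=> //.
    exact: op_transl.
  by move=> y hy; exists n.
- move=> x n [m Nm Am] Nn; exists (m - n); first exact: sN.2.
  by rewrite (_ : _ + _ = x + m) //; zmod.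
by move=> y; exact: trace_qmap.
Qed.

Lemma induced_top_ab : is_top_ab_group induced_quo.
Proof.
have [q1 [q2 [q3 q4]]] := quo_ab sD.
split=> //; split=> //; split=> //; split=> //; split; [|split; [|split]].
- by exists (fun _ => True); split=> //; exact: tg_full hT.
- move=> F hF; pose G W := exists U, [/\ F U, op W, forall x n, W x -> N n -> W (x + n) &
    forall y : Z, U (qmap D y) <-> W (pr y)].
  exists (fun x => exists W, G W /\ W x); split.
  + by apply: (tg_union hT) => W [U []].
  + by move=> x n [W [[U [h1 h2 h3 h4]] Wx]] Nn; exists W; split; [exists U|exact: h3].
  move=> y; split=> [[U [FU Uy]]|[W [[U [h1 h2 h3 h4]] Wy]]].
    have [W [h1 h2 h3]] := hF U FU; exists W; split; first by exists U.
    exact/h3.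
  by exists U; split=> //; apply/h4.
- move=> U U' [W [h1 h2 h3]] [W' [h1' h2' h3']]; exists (fun x => W x /\ W' x); split.
  + exact: (tg_inter hT).
  + by move=> x n [Wx W'x] Nn; split; [exact: h2|exact: h2'].
  by move=> y; split=> [[/h3 a /h3' b]|[/h3 a /h3' b]].
move=> U q q' [W [h1 h2 h3]].
have [a ->] := qmap_surj hZ q; have [b ->] := qmap_surj hZ q'.
rewrite -[add _ _]/(@add (quo D) (qmap D a) (@opp (quo D) (qmap D b))) (quo_opp sD) (quo_add sD).
move/h3 => Wab.
have [A [B [oA [oB [Aa [Bb AB]]]]]] := tg_sub hT h1 (Wab : W (pr a - pr b)).
exists (trace A), (trace B); split; [exact: induced_trace|split; [exact: induced_trace|]].
split; first by exists a => //; exists 0; rewrite ?addr0 //; exact: sN.1.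
split; first by exists b => //; exists 0; rewrite ?addr0 //; exact: sN.1.
move=> _ _ [x -> [n Nn An]] [y -> [m Nm Bm]].
rewrite -[add _ _]/(@add (quo D) (qmap D x) (@opp (quo D) (qmap D y))) (quo_opp sD) (quo_add sD).
apply/h3; change (W (pr x - pr y)).
rewrite (_ : pr x - pr y = (pr x + n - (pr y + m)) + (m - n)); last by zmod.
by apply: h2; [exact: AB|exact: sN.2].
Qed.

Lemma induced_hausdorff : hausdorff induced_quo.
Proof.
move=> q q'; have [a ->] := qmap_surj hZ q; have [b ->] := qmap_surj hZ q' => nab.
have nN : ~ N (pr a - pr b).
  by move=> Nab; apply: nab; apply/qmap_subgrp_eq; apply: NS => //;
    exact: (proj2_sig (a - b : Z)).
have [A [B [oA [oB [Aa [Bb AB]]]]]] := tg_sub hT (proj2 cN : op _) nN.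
exists (trace A), (trace B); split; [exact: induced_trace|split; [exact: induced_trace|]].
split; first by exists a => //; exists 0; rewrite ?addr0 //; exact: sN.1.
split; first by exists b => //; exists 0; rewrite ?addr0 //; exact: sN.1.
move=> r [[y -> [n Nn An]] /trace_qmap [m Nm Bm]].
apply: (AB _ _ An Bm); rewrite (_ : _ - _ = n - m); last by zmod.
exact: sN.2.
Qed.

Lemma induced_coarser U : induced_opn U -> @opn (quo D) U.
Proof. by move=> [W [h1 h2 h3]]; exists W; split. Qed.

(** The witness is the trace of an open subgroup [P] that misses [z]. An N-invariant open set
    inducing it would contain [z] along with 0, and by density a point of [S] near [z]; that point
    would lie in [P], and with it [z]. *)
Lemma induced_strictly_coarser z : N z -> ~ core z ->
  exists2 U, @opn (quo D) U & ~ induced_opn U.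
Proof.
move=> Nz ncz.
have [P hP nPz] : exists2 P, open_subgroup op P & ~ P z.
  by apply: contrapT => hn; apply: ncz => P hP; apply: contrapT => nP; apply: hn; exists P.
pose U q := exists2 y : Z, q = qmap D y & P (pr y).
have UE (y : Z) : U (qmap D y) <-> P (pr y).
  split=> [[y' /qmap_subgrp_eq e]|Py]; last by exists y.
  by move=> Py'; apply/(sg_eqD (proj1 hP) (e P hP)).
exists U; first by exists P; split; [case: hP|exact: UE].
move=> [W [h1 h2 h3]].
have W0 : W (pr (0 : Z)) by apply/h3/UE; case: hP => -[].
have Wz : W z by have := h2 _ _ W0 Nz; rewrite add0r.
have [||g [[Wg Pg] Sg]] := @dS (fun x : V => W x /\ P (x - z)).
- by apply: (tg_inter hT) => //; apply: (op_transl hT); case: hP.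
- by exists z; split=> //; rewrite subrr; case: hP => -[].
have Pg' : P g by apply/(UE (exist _ g Sg))/h3.
by apply: nPz; apply/(sg_eqD (proj1 hP) Pg).
Qed.
End CoarserTopology.

Lemma quo_not_locally_minimal :
  (forall B, exists p (z : V), [/\ (B <= p)%N, prime p, ~ S z & core (z *+ p)]) ->
  ~ locally_minimal (quo D).
Proof.
move=> hz [W [[U [oU [U0 UW]]] hmin]].
have [O [oO hO]] := oU.
have [|P hP PO] := core_nbhd hV oO.
  move=> x cx; refine (proj1 (hO (exist _ x (coreS cx))) _).
  suff -> : qmap D (exist _ x (coreS cx)) = @zer (quo D) by [].
  by apply: (proj2 (qmap_subgrp_eq (exist _ x (coreS cx)) 0)); rewrite subr0.
have [e e0 he] := osg_exponent hV hP.
(* Since [p > e], both [z *+ p] and [z *+ e] lie in [P] with coprime factors, which puts [z] into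
   [P]. *)
have [p [z [ep pp nSz cz]]] := hz e.+1; have sc := sg_core op.
have ncz : ~ core z by move=> /coreS.
have sS : @subgroup V S by apply/is_subgroup_sg.
have Pz : P z.
  apply: (@sg_coprime _ P z p e); [by case: hP| |exact: cz|exact: he].
  by rewrite prime_coprime // gtnNdvd.
pose N (x : V) := exists2 j, (j < p)%N & core (x - z *+ j).
have NE x j : core (x - z *+ j) -> N x.
  move=> hj; exists (j %% p)%N; first by rewrite ltn_pmod // prime_gt0.
  rewrite (_ : _ - _ = (x - z *+ j) + z *+ p *+ (j %/ p)); last by rewrite {2}(divn_eq j p); zmod.
  exact: (sgD sc hj (sgMn _ sc cz)).
have cN : closed_subgroup op N.
  split; last first.
    apply: (cl_bounded_ex hV (F := fun j x => core (x - z *+ j))) => j.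
    exact: (cl_transl hT _ (cl_core hT)).
  split; first by apply: (@NE 0 0%N); rewrite mulr0n subr0; exact: sc.1.
  move=> a b [i ip hi] [j jp hj]; apply: (@NE _ (i + (p - j))%N).
  rewrite (_ : _ - _ = (a - z *+ i) - (b - z *+ j) - z *+ p);
    first exact: sc.2 (sc.2 _ _ hi hj) cz.
  by rewrite mulrnDr mulrnBr 1?ltnW //; zmod.
have coreN x : core x -> N x by move=> cx; apply: (@NE x 0%N); rewrite mulr0n subr0.
have NS x : N x -> S x -> core x.
  move=> [j jp hj] Sx; case: (posnP j) => [j0|j0]; first by move: hj; rewrite j0 mulr0n subr0.
  exfalso; apply: nSz; apply: (@sg_coprime _ _ _ p j sS).
  - by rewrite prime_coprime // gtnNdvd.
  - exact: coreS.
  by rewrite (_ : z *+ j = x - (x - z *+ j)); [apply: sS.2 => //; exact: coreS|zmod].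
have NP x n : P x -> N n -> P (x + n).
  move=> Px [j _ hj]; apply: sgD => //; first by case: hP.
  rewrite -(subrK (z *+ j) n); apply: sgD; [by case: hP|exact: hj|apply: sgMn => //; by case: hP].
have Nz : N z by apply: (@NE z 1%N); rewrite mulr1n subrr; exact: sc.1.
have [U1 oU1 nU1] := induced_strictly_coarser Nz ncz.
apply: nU1.
(* Applied to the identity map, local minimality would make [U1] open in the induced topology. *)
have := hmin (induced_quo N) (fun q =>
  q) (induced_top_ab cN coreN) (induced_hausdorff cN coreN NS).
have -> : U1 = image (fun q : car (quo D) => q : car (induced_quo N)) U1.
  by apply: funext => q; apply/propext; split=> [Uq|[_ [Uq <-]]] //; exists q.
move=> hm; apply: hm => //.
- by move=> U2; exact: induced_coarser.
- by split=> // q; exists q.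
exists (fun q => exists2 y : Z, q = qmap D y & P (pr y)); split; last split.
- exists P; split; [by case: hP|exact: NP|].
  move=> y; split=> [[y' /qmap_subgrp_eq e' Py']|Py]; last by exists y.
  by apply/(sg_eqD (proj1 hP) (e' P hP)).
- by exists 0 => //; case: hP => -[].
by move=> _ [y -> Py]; exists (qmap D y); split=> //; apply: UW; apply/hO; exact: PO.
Qed.
End NotLocallyMinimal.

Theorem theorem5p8 (K : topab) :
  is_top_ab_group K -> hausdorff K -> compact (fun _ : car K => True) ->
  locally_essential (@comp0 K) ->
  (C_Clm K <-> infinite_set (pi_star (quo (@comp0 K)))) /\
  (infinite_set (pi_star (quo (@comp0 K))) <->
   infinite_set (fun _ : car (quo (@comp0 K)) => True)).
Proof.
move=> hK hH hC hess.
have cb := infinite_pi_star hK hH hC hess; have bc := infinite_quo_of_pi_star hK hH hC.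
split; last by split=> [/bc|/cb].
split=> [/(infinite_quo_of_C_Clm hK hH hC)/cb //|/bc inf].
pose hV := carrier_compact_group hK hH hC.
have [G [sG cG dG zG]] := exists_dense_subgroup Rdefinitions.R hV
  (essential_core hK hH hC hess) (proj1 (infinite_quo hK hH hC) inf).
pose h : is_subgroup G := proj2 (is_subgroup_sg (top_ab_ab hK) G) sG.
have dense_G : dense G.
  move=> U oU [x Ux].
  pose V : zmodType := zcar (top_ab_ab hK); pose op : (V -> Prop) -> Prop := @opn K.
  (* [dG] approximates only modulo open subgroups, that is, up to the core; since [G] contains the
     core, the error [c] can be added back. *)
  have oO : op (fun y : V => exists c, core op c /\ U ((x : V) + y + c)).
    apply: (op_local hV) => y [c [cc Uc]]; exists (fun y' : V => U ((x : V) + y' + c));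
      split=> //.
      apply: op_ext (op_transl hV ((x : V) + c) oU) => t; by rewrite addrCA addrA.
    by move=> y' hy'; exists c.
  have [|P hP PO] := core_nbhd hV oO.
    move=> c cc; exists (- c); split; first exact: (sgN (sg_core _)).
    by rewrite addrK.
  have [g Gg /PO [c [cc Uc]]] := dG x P hP.
  exists ((g : V) + c); split; last exact: (sgD sG _ (cG _ cc)).
  by move: Uc; rewrite (_ : (x : V) + _ + c = g + c) //; zmod.
split=> //; split=> //; split=> //; exists G, h; split=> //; split; [|split; [|split]].
- exact: (locally_minimal_of_core_subset hH hC).
- move=> x; split=> [cx|[y [/(comp0_subgrp hH hC y cG) cy <-]]]; last exact/(comp0_core hH hC).
  have cx' : @core (zcar (top_ab_ab hK)) (@opn K) x by apply/(comp0_core hH hC).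
  by exists (exist _ x (cG x cx')); split=> //; apply/(comp0_subgrp hH hC _ cG).
- exact: (compact_comp0 hK hH hC).
exact: (quo_not_locally_minimal hH hC cG dense_G zG).
Qed.
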